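(* Suppose $b:[0,\infty)\to\mathbb R$ is a continuous function and there exists a $t>0$ such that $b(t)>0$. If the integral equation $$\int_0^\infty f(t|x)\,g(x)\,dx=f(t)$$ has a solution $g\in\mathcal G\cap L^2(\mathbb R,e^{-x^2})$, then it is unique and it is given by $$g(x)=\frac{1}{\sqrt{2\pi}}\sum_{n=0}^\infty\frac{t^{n/2}a_n(t)}{2^n n!}H_n\!\left(\frac{x}{\sqrt{2t}}\right)$$ for any $t>0$ such that $b(t)>0$, where $$a_n(t):=\int_0^t\frac{e^{-\frac{b(s)^2}{2(t-s)}}}{(t-s)^{(n+1)/2}}H_n\!\left(\frac{b(s)}{\sqrt{2(t-s)}}\right)f(s)\,ds .$$
   Context: $W_t$ is a standard Brownian motion started at $0$. The boundary $b$ satisfies $b(0)=0$ and is (standing assumption) continuously differentiable, which ensures that for $x>0$ the first passage time $\tau_x=\inf\{t>0: W_t+x\le b(t)\}$ has a continuous density, denoted $f(t|x)$ (i.e. the density of $\tau_X$ conditional on $X=x$). $f$ is a given probability density on $[0,\infty)$ (the target density). $\mathcal G$ is the class of functions $g$ on $(0,\infty)$ such that $\int_0^\infty|g(x)|\,dx<\infty$ or $|g|<K$ for some constant $K$. Functions on $(0,\infty)$ are regarded as functions on $\mathbb R$ by extending them by $0$; $L^2(\mathbb R,e^{-x^2})$ is the $L^2$ space with weight $e^{-x^2}$. $H_n(x)=(-1)^ne^{x^2}\frac{d^n}{dx^n}(e^{-x^2})$ are the Hermite polynomials. Functions are identified when equal almost everywhere, and the series is the Hermite (complete orthogonal basis)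 expansion, in $L^2(\mathbb R,e^{-u^2})$, of $u\mapsto g(u\sqrt{2t})$.
   Formalization: Convergence of the series to g is claimed only when u↦g(u√(2t)) lies in L²(R,e^{-u²}) (automatic if t≤1/2 or g bounded; without it the L² expansion fails for some integrable g, t>1/2); for every t>0 with b(t)>0 the terms are shown to be its Hermite coefficients. *)

(* Defs.v *)
From HB Require Import structures.
From mathcomp Require Import all_boot all_order all_algebra.
From mathcomp Require Import all_classical all_reals all_analysis.
Import Order.TTheory GRing.Theory Num.Theory.
Import numFieldNormedType.Exports.

Set Implicit Arguments.
Unset Strict Implicit.
Unset Printing Implicit Defensive.

Local Open Scope classical_set_scope.
Local Open Scope ring_scope.

Section brownian_motion.
Context d (T : measurableType d) (R : realType) (P : probability T R).

(* Mutual independence of a finite family of real random variables.  The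
   product rule for subfamilies is the case where some A i are setT. *)
Definition mutually_independent (n : nat) (X : 'I_n -> T -> R) : Prop :=
  forall A : 'I_n -> set R, (forall i, measurable (A i)) ->
    P [set w | forall i, A i (X i w)] = (\prod_(i < n) P (X i @^-1` A i))%E.

(* Only the times t >= 0 are constrained.  The second parameter of
   [normal_prob] is the standard deviation. *)
Definition standard_brownian_motion (W : R -> {RV P >-> R}) : Prop :=
  [/\ forall w, W 0 w = 0,
      forall w, {within `[0, +oo[, continuous (fun t => W t w)},
      forall s t, 0 <= s -> s < t -> forall A : set R, measurable A ->
        P [set w | A (W t w - W s w)] = normal_prob 0 (Num.sqrt (t - s)) A
    & forall (n : nat) (s : nat -> R), 0 <= s 0%N ->
        (forall i, s i <= s i.+1) ->
        mutually_independent (fun (i : 'I_n) w => W (s i.+1) w - W (s i) w)].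

(* inf {t > 0 : W_t + x <= b t}, equal to +oo if there is no such t. *)
Definition first_passage (b : R -> R) (W : R -> {RV P >-> R}) (x : R) (w : T)
    : \bar R :=
  ereal_inf [set t%:E | t in [set t | 0 < t /\ W t w + x <= b t]].

(* k t x is f(t|x); its values at t <= 0 or x <= 0 are irrelevant.  The density
   may be defective, as the first passage time may be infinite with positive
   probability. *)
Definition first_passage_density (b : R -> R) (W : R -> {RV P >-> R})
    (k : R -> R -> R) : Prop :=
  forall x, 0 < x ->
    [/\ forall t, 0 < t -> 0 <= k t x,
        forall t, 0 < t -> {for t, continuous (fun s => k s x)}
      & forall A : set R, measurable A ->
          P [set w | exists2 t, A t & first_passage b W x w = t%:E] =
          (\int[lebesgue_measure]_(t in A `&` `]0%R, +oo[) (k t x)%:E)%E].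

End brownian_motion.

Section integral_equation.
Context (R : realType).
Implicit Types (b f g h : R -> R) (k : R -> R -> R) (t x : R) (n : nat).
Local Notation mu := (@lebesgue_measure R).

(* Continuity on [0, +oo[ and C^1 on ]0, +oo[; no one-sided derivative at 0 is
   required, so this is implied by C^1 on [0, +oo[. *)
Definition C1_boundary b : Prop :=
  [/\ b 0 = 0, {within `[0, +oo[, continuous b},
      forall t, 0 < t -> derivable b t 1
    & forall t, 0 < t -> {for t, continuous (derive1 b)}].

Definition density_on_halfline f : Prop :=
  [/\ measurable_fun (`[0, +oo[ : set R) f, forall t, 0 <= t -> 0 <= f t
    & (\int[mu]_(t in `[0%R, +oo[) (f t)%:E = 1)%E].

Definition extend0 g : R -> R := fun x => if 0 < x then g x else 0.

Definition class_G g : Prop :=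
  measurable_fun (`]0, +oo[ : set R) g /\
  ((\int[mu]_(x in `]0%R, +oo[) `|g x|%:E < +oo)%E \/
   exists K : R, {ae mu, forall x, 0 < x -> `|g x| < K}).

(* L^2(R, e^{-x^2}) *)
Definition L2_gauss h : Prop :=
  measurable_fun setT h /\
  (\int[mu]_x (h x ^+ 2 * expR (- x ^+ 2))%:E < +oo)%E.

Definition solves_equation k f g : Prop :=
  {ae mu, forall t, 0 < t ->
    (\int[mu]_(x in `]0%R, +oo[) (k t x * g x)%:E = (f t)%:E)%E}.

Definition is_solution k f g : Prop :=
  [/\ class_G g, L2_gauss (extend0 g) & solves_equation k f g].

Definition hermite n x : R :=
  (-1) ^+ n * expR (x ^+ 2) * derive1n n (fun y : R => expR (- y ^+ 2)) x.

Definition hermite_coef h n : R :=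
  (\int[mu]_u (h u * hermite n u * expR (- u ^+ 2))) /
  (\int[mu]_u (hermite n u ^+ 2 * expR (- u ^+ 2))).

(* Convergence in L^2(R, e^{-u^2}). *)
Definition L2_gauss_cvg (h_ : nat -> R -> R) h : Prop :=
  (fun N => \int[mu]_u ((h_ N u - h u) ^+ 2 * expR (- u ^+ 2))%:E)%E @ \oo
    --> 0%E.

Definition a_coef b f t n : R :=
  \int[mu]_(s in `[0, t])
    (expR (- (b s ^+ 2 / (2 * (t - s)))) / (t - s) `^ (n.+1%:R / 2) *
     hermite n (b s / Num.sqrt (2 * (t - s))) * f s).

Definition series_coef b f t n : R :=
  t `^ (n%:R / 2) * a_coef b f t n / (2 ^+ n * n`!%:R).

Definition hermite_partial_sum b f t (N : nat) x : R :=
  (Num.sqrt (2 * pi))^-1 *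
  \sum_(n < N) series_coef b f t n * hermite n (x / Num.sqrt (2 * t)).

End integral_equation.

(* Main.v *)
Require Import Defs.
From HB Require Import structures.
From mathcomp Require Import all_boot all_order all_algebra.
From mathcomp Require Import all_classical all_reals all_analysis.
From mathcomp Require Import measurable_realfun ring lra.
Import Order.TTheory GRing.Theory Num.Theory.
Import numFieldNormedType.Exports.
Local Open Scope classical_set_scope.
Local Open Scope ring_scope.
Set Implicit Arguments.
Unset Strict Implicit.

(* Let Psi(z) = pi^(-1/2) int_{-oo}^z exp(-v^2) dv and let x > 0.  A path started
   at x that is at most y <= b(t) at time t has crossed the boundary, and at its
   passage time s it sits exactly at b(s); independence of the increments gives
     Psi((y - x) / sqrt(2 t)) = int_0^t f(s|x) Psi((y - b(s)) / sqrt(2 (t - s))) ds.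
   Integrating against g and using Fubini and the integral equation, then
   differentiating n + 1 times in y < b(t), where the kernels stay bounded, yields
     int_0^oo g(x) e_n(sqrt(2 t), y - x) dx = int_0^t f(s) e_n(sqrt(2 (t - s)), y - b(s)) ds
   with e_n(c, z) the n-th derivative of exp(-(z / c)^2) / c.  When b(t) > 0, y = 0
   is allowed, and the left side is the n-th Hermite coefficient of
   u |-> g(u sqrt(2 t)) up to a constant.  Completeness comes from the density of
   polynomials in L^2 for weights with exponential moments; applied to the weight
   |(g - g')(u sqrt(2 t))| exp(-u^2) it also gives uniqueness. *)

(** * Independence of the Brownian past *)

(** Increments are independent of the past only at deterministic times, so a grid takes the place of
    the strong Markov property. The passage time is rounded up to a multiple of [t / n.+1]: the
    event that it lies in a given cell depends on the path up to the right end of the cell only,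
    hence is independent of the increment from there to [t]. Rounding down would lose this. The
    price is that the path sits on the boundary at the passage time but not at the grid point; by
    continuity it is within [eps] of it outside an event of vanishing probability, and [eps]
    disappears at the end because the identity depends continuously on the level [y].

    The kernel [k] is specified one starting point at a time. Its measurability in [x], which Fubini
    requires, is recovered from a pathwise comparison: a path started higher crosses later.

    Membership in [class_G] makes g(x) exp(A|x| - a x^2) integrable for all A and all a > 0. This
    estimate carries Fubini, the differentiations and the moments at every [t]; square integrability
    of the rescaled solution enters where the series has to converge. *)

Section independence_of_the_past.
Context d (T : measurableType d) (R : realType) (P : probability T R).

Definition cylinders (n : nat) (X : nat -> T -> R) : set (set T) :=
  [set E | exists2 A : nat -> set R, (forall i, measurable (A i)) &
     E = [set w | forall i, (i < n)%N -> A i (X i w)]].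

(** Measurability is built in so that, for measurable [F], these events form a lambda-system. *)
Definition independent_of (F : set T) : set (set T) :=
  [set E | measurable E /\ P (E `&` F) = (P E * P F)%E].

Lemma independent_ofT (F : set T) : independent_of F setT.
Proof. by split => //; rewrite setTI probability_setT mul1e. Qed.

Lemma independent_ofD (F E E' : set T) : measurable F -> E' `<=` E ->
  independent_of F E -> independent_of F E' -> independent_of F (E `\` E').
Proof.
move=> mF EE' [mE PE] [mE' PE']; split; first exact: measurableD.
have -> : (E `\` E') `&` F = (E `&` F) `\` (E' `&` F).
  by apply/seteqP; split=> w /=; tauto.
have fin A : measurable A -> P A \is a fin_num by exact: fin_num_measure.
have lty A : measurable A -> (P A < +oo)%E by move=> /fin; rewrite ltey_eq => ->.
have mEF : measurable (E `&` F) by exact: measurableI.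
have mEF' : measurable (E' `&` F) by exact: measurableI.
have e1 := @measureD _ _ _ P _ _ mEF mEF' (lty _ mEF).
have e2 := @measureD _ _ _ P _ _ mE mE' (lty _ mE).
rewrite [LHS]e1 [X in (X * _)%E]e2 setIACA setIid !(setIidr EE').
rewrite [X in (X - _)%E]PE [X in (_ - X)%E]PE' muleBl ?fin//.
by rewrite fin_num_adde_defr// fin.
Qed.

Lemma independent_of_bigcup (F : set T) (E : (set T)^nat) : measurable F ->
  nondecreasing_seq E -> (forall n, independent_of F (E n)) ->
  independent_of F (\bigcup_n E n).
Proof.
move=> mF ndE IE; have mE n : measurable (E n) by case: (IE n).
have mU : measurable (\bigcup_n E n) by exact: bigcupT_measurable.
split=> //.
have ndEF : nondecreasing_seq (fun n => E n `&` F).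
  by move=> m n mn; apply/subsetPset; apply: setSI; exact/subsetPset/ndE.
have := @nondecreasing_cvg_mu _ _ _ P (fun n => E n `&` F)
  (fun n => measurableI _ _ (mE n) mF).
rewrite -setI_bigcupl => /(_ (measurableI _ _ mU mF) ndEF) h1.
have h2 := @nondecreasing_cvg_mu _ _ _ P E mE mU ndE.
have h3 := cvgeZr (fin_num_measure P _ mF) h2.
rewrite -(cvg_lim (@ereal_hausdorff _) h1) -(cvg_lim (@ereal_hausdorff _) h3).
by congr (lim (_ @ \oo)); apply/funext => n /=; case: (IE n).
Qed.

Lemma independent_of_bigcap (F : set T) (E : (set T)^nat) : measurable F ->
  nonincreasing_seq E -> (forall n, independent_of F (E n)) ->
  independent_of F (\bigcap_n E n).
Proof.
move=> mF niE IE; rewrite -[X in independent_of _ X]setCK setC_bigcap -setTD.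
have IT := independent_ofT F.
apply: independent_ofD => //; apply: independent_of_bigcup => //.
  by move=> m n mn; apply/subsetPset; apply: subsetC; exact/subsetPset/niE.
by move=> n; rewrite -setTD; exact: independent_ofD.
Qed.

(** Dynkin's pi-lambda argument: cylinders are stable under intersection, and the events independent
    of a fixed event form a lambda-system. The variable of index [n] is the one that follows the
    past. *)
Lemma mutually_independent_past (n : nat) (X : nat -> T -> R) :
  (forall i, measurable_fun setT (X i)) ->
  mutually_independent P (fun i : 'I_n.+1 => X i) ->
  forall B, measurable B -> <<s cylinders n X >> `<=` independent_of (X n @^-1` B).
Proof.
move=> mX iX B mB; set F := X n @^-1` B.
have mF : measurable F by rewrite -[F]setTI; exact: mX.
apply: lambda_system_subset => //.
- move=> _ _ [A mA ->] [A' mA' ->]; exists (fun i => A i `&` A' i).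
    by move=> i; exact: measurableI.
  apply/seteqP; split => w /=; first by move=> [h h'] i ilt; split; auto.
  by move=> h; split=> i /h [].
- split.
  + by [].
  + exact: independent_ofT.
  + by move=> A B' AB' IA IB'; exact: independent_ofD.
  + by move=> E ndE IE; exact: independent_of_bigcup.
move=> _ [A mA ->]; split.
  rewrite (_ : [set w | _] =
      \big[setI/setT]_(i < n) (X i @^-1` A i)); last first.
    rewrite -(bigcap_mkord n (fun i => X i @^-1` A i)); apply/seteqP; split => w /= h i /=; exact: h.
  apply: bigsetI_measurable => i _.
  by rewrite -[X in measurable X]setTI; exact: mX.
(* The product rule is read with [C] in the last slot; taking [C] to be the whole line afterwards
   shows that the remaining product is the probability of the cylinder. *)
have iC C : measurable C ->
    P ([set w | forall i, (i < n)%N -> A i (X i w)] `&` X n @^-1` C) =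
    (\prod_(i < n) P (X i @^-1` A i) * P (X n @^-1` C))%E.
  move=> mC.
  have := iX (fun i : 'I_n.+1 => if (i < n)%N then A i else C).
  rewrite big_ord_recr/= ltnn.
  under eq_bigr do rewrite ltn_ord.
  move=> <-; last by move=> i; case: ifP.
  congr (P _); apply/seteqP; split => w /=.
    move=> [h hC] [i/= ilt]; case: ifP => // [|/negbT]; first exact: h.
    by rewrite -leqNgt => nlti; rewrite (_ : i = n)//; apply/eqP; rewrite eqn_leq nlti andbT -ltnS.
  move=> h; split.
    by move=> i ilt; have := h (Ordinal (ltnW ilt : (i < n.+1)%N)) => /=; rewrite ilt.
  by have := h ord_max; rewrite /= ltnn.
rewrite [LHS]iC//; congr (_ * _)%E.
by have := iC setT measurableT; rewrite preimage_setT setIT probability_setT mule1.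
Qed.

End independence_of_the_past.

(** * First passage times *)

Section first_zero.
Context (R : realType).
Implicit Types (h : R -> R) (s u : R).

Definition first_nonpos h : \bar R :=
  ereal_inf [set u%:E | u in [set u | 0 < u /\ h u <= 0]].

(** Truncating (u / s) 2^N leaves an error of at most s / 2^N from below, so the approximating
    points also stay in [0, s]. *)
Lemma cvg_dyadic s u : 0 < s -> 0 <= u -> u <= s ->
  exists2 k : nat -> nat, (forall N, (k N <= 2 ^ N)%N) &
    s * (k N)%:R / 2 ^+ N @[N --> \oo] --> u.
Proof.
move=> s0 u0 us.
have e0 N : 0 <= u / s * 2 ^+ N by rewrite mulr_ge0 ?exprn_ge0// divr_ge0// ltW.
exists (fun N => Num.truncn (u / s * 2 ^+ N)).
  move=> N; rewrite -(ler_nat R); have /andP[/le_trans h _] := truncn_itv (e0 N).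
  by apply: h; rewrite natrX ler_piMl ?exprn_ge0// ler_pdivrMr// mul1r.
have p2 N : 0 < (2 ^+ N : R) by rewrite exprn_gt0.
have ub N : s * (Num.truncn (u / s * 2 ^+ N))%:R / 2 ^+ N <= u.
  have /andP[h _] := truncn_itv (e0 N).
  by rewrite ler_pdivrMr// [leLHS]mulrC -ler_pdivlMr// [leRHS]mulrAC.
have lb N : u - s * 2^-1 ^+ N <= s * (Num.truncn (u / s * 2 ^+ N))%:R / 2 ^+ N.
  have /andP[_ h] := truncn_itv (e0 N).
  rewrite ler_pdivlMr// mulrBl -(mulrA s) -exprMn mulVf// expr1n mulr1 lerBlDr.
  rewrite -[X in _ + X]mulr1 -mulrDr natr1 [leRHS]mulrC -ler_pdivrMr// [leLHS]mulrAC; exact: ltW.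
apply: (@squeeze_cvgr _ _ _ _ (fun N => u - s * 2^-1 ^+ N) (cst u)).
- by apply: nearW => N; rewrite lb ub.
- rewrite -[X in _ --> X](subr0 u) -[X in _ - X](mulr0 s).
  apply: cvgB; first exact: cvg_cst.
  by apply: cvgMr; apply: cvg_expr; rewrite ger0_norm// invf_lt1// ltr1n.
- exact: cvg_cst.
Qed.

(** The strict inequality comes from continuity at [s]: positivity persists on a ball around [s],
    which pushes the infimum beyond [s]. Positivity at nonpositive times covers the case s = 0. *)
Lemma first_nonpos_gt h s : (forall u, u <= 0 -> 0 < h u) -> continuous h ->
  0 <= s -> (s%:E < first_nonpos h)%E <-> (forall u, 0 < u -> u <= s -> 0 < h u).
Proof.
move=> h0 ch s_ge0; split.
  move=> sh u u0 us; rewrite ltNge; apply/negP => hu0.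
  have : (first_nonpos h <= u%:E)%E by apply: ereal_inf_lbound; exists u.
  by move=> /(lt_le_trans sh); rewrite lte_fin ltNge us.
move=> hpos; have hs : 0 < h s.
  by move: s_ge0; rewrite le_eqVlt => /predU1P[<-|s0]; [exact: h0|exact: hpos].
have /nbhs_ballP[e /= e0 he] : \forall u \near s, 0 < h u.
  exact: (cvgr_gt _ (ch s)).
apply: (@lt_le_trans _ _ (s + e)%:E); first by rewrite lte_fin ltrDl.
apply/ereal_infP => _ [u [u0 hu] <-]; rewrite lee_fin leNgt; apply/negP => ue.
have [us|su] := leP u s; first by have := hpos _ u0 us; rewrite ltNge hu.
have : 0 < h u.
  by apply: he; rewrite /ball/= distrC ger0_norm ?subr_ge0 1?ltW// ltrBlDl.
by rewrite ltNge hu.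
Qed.

(** [h u] cannot be positive by the previous lemma, and cannot be negative as a left limit of
    positive values. *)
Lemma first_nonpos_eq h u : (forall v, v <= 0 -> 0 < h v) -> continuous h ->
  first_nonpos h = u%:E -> 0 < u /\ h u = 0.
Proof.
move=> h0 ch hu.
have u_ge0 : 0 <= u.
  by rewrite -lee_fin -hu; apply/ereal_infP => _ [v [v0 _] <-]; rewrite lee_fin ltW.
have hpos v : v < u -> 0 < h v.
  move=> vu; have [|v0] := leP v 0; first exact: h0.
  have : (v%:E < first_nonpos h)%E by rewrite hu lte_fin.
  by move/(first_nonpos_gt h0 ch (ltW v0)); exact.
have hule : h u <= 0.
  rewrite leNgt; apply/negP => hu0.
  suff : (u%:E < first_nonpos h)%E by rewrite hu ltxx.
  apply/(first_nonpos_gt h0 ch u_ge0) => v v0.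
  by rewrite le_eqVlt => /predU1P[->//|]; exact: hpos.
have u0 : 0 < u.
  by rewrite ltNge; apply/negP => /h0; rewrite ltNge hule.
split=> //; apply/eqP; rewrite eq_le hule/=.
have hl : h v @[v --> u^'-] --> h u by apply: cvg_at_left_filter; exact: ch.
apply: (cvgr_to_ge hl); near=> v; apply/ltW/hpos.
by near: v; exact: nbhs_left_lt.
Unshelve. all: end_near. Qed.

(** An uncountable condition becomes a countable union of countable intersections of conditions at
    finitely many times. The uniform margin 1 / (m + 1) comes from the minimum over the compact
    interval; without it positivity would not pass from dyadic points to their limits. *)
Lemma pos_dyadic h s : (forall u, u <= 0 -> 0 < h u) -> continuous h -> 0 < s ->
  (forall u, 0 < u -> u <= s -> 0 < h u) <->
  exists m : nat, forall N k, (k <= 2 ^ N)%N -> m.+1%:R^-1 <= h (s * k%:R / 2 ^+ N).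
Proof.
move=> h0 ch s0; split.
  move=> hpos.
  have [c cs hc] := EVT_min (ltW s0) (continuous_subspaceT ch : {within `[0, s], continuous h}).
  have hc0 : 0 < h c.
    move: cs; rewrite in_itv/= => /andP[c0 cs].
    by have [/h0//|c1] := leP c 0; exact: hpos.
  have [m mh] : exists m, m.+1%:R^-1 < h c.
    exists (Num.truncn (h c)^-1); rewrite invf_plt ?posrE ?ltr0Sn//.
    exact: truncnS_gt.
  exists m => N k kN; apply: (le_trans (ltW mh)); apply: hc.
  rewrite in_itv/= divr_ge0 ?mulr_ge0 ?exprn_ge0 ?(ltW s0)//=.
  by rewrite ler_pdivrMr ?exprn_gt0// ler_pM2l// -natrX ler_nat.
move=> [m hm] u u0 us.
have [k kN ck] := cvg_dyadic s0 (ltW u0) us.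
apply: (@lt_le_trans _ _ m.+1%:R^-1); first by rewrite invr_gt0.
have ckh : h (s * (k N)%:R / 2 ^+ N) @[N --> \oo] --> h u.
  by apply: continuous_cvg => //; exact: ch.
by apply: (cvgr_to_ge ckh); apply: nearW => N /=; exact: hm.
Qed.

End first_zero.

Lemma continuous_max0 (R : realType) (f : R -> R) :
  {within `[0, +oo[, continuous f} -> continuous (fun u : R => f (Num.max 0 u)).
Proof.
move=> /subspace_continuousP cf u.
have m0 v : `[0, +oo[%classic (Num.max 0 v : R).
  by rewrite /= in_itv/= andbT le_max lexx.
apply: (cvg_comp (fun v : R => Num.max 0 v) f _ (cf _ (m0 u))) => B /= hB.
have cm := @continuous_max R R (cst 0) id u (@cst_continuous _ _ _ _) (fun=> id).
have /cm : nbhs (Num.max 0 u) (fun v => `[0, +oo[%classic v -> B v) by exact: hB.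
by move=> h; apply: (@filterS _ (nbhs u) _ (fun v : R =>
  `[0, +oo[%classic (Num.max 0 v : R) -> B (Num.max 0 v)) _ _ h) => v; apply; exact: m0.
Qed.

(** * Survival of a Brownian path above the boundary *)

Section brownian_first_passage.
Context d (T : measurableType d) (R : realType) (P : probability T R)
  (W : R -> {RV P >-> R}) (b : R -> R).
Hypothesis hW : standard_brownian_motion W.
Hypothesis b0 : b 0 = 0.
Hypothesis cb : {within `[0, +oo[, continuous b}.

(** Negative times are clamped to 0: the path becomes continuous on the whole line and equals [x]
    for u <= 0, as the lemmas on first zeros require. *)
Definition gap (x : R) (w : T) (u : R) : R :=
  W (Num.max 0 u) w + x - b (Num.max 0 u).

Lemma gap_ge0 (x : R) w u : 0 <= u -> gap x w u = W u w + x - b u.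
Proof. by move=> u0; rewrite /gap max_r. Qed.

Lemma gap_pos (x : R) w u : 0 < x -> u <= 0 -> 0 < gap x w u.
Proof.
by move=> x0 u0; rewrite /gap max_l// b0; case: hW => -> _ _ _; rewrite add0r subr0.
Qed.

Lemma continuous_gap x w : continuous (gap x w).
Proof.
move=> u; apply: cvgB; last exact: (@continuous_max0 _ b cb u).
apply: cvgD; last exact: cvg_cst.
have cW : {within `[0, +oo[, continuous (fun v => W v w)} by case: hW.
exact: (@continuous_max0 _ _ cW u).
Qed.

Lemma first_passageE x w : first_passage b W x w = first_nonpos (gap x w).
Proof.
congr ereal_inf; apply/seteqP; split => [_ [u [u0 hu] <-]|_ [u [u0 hu] <-]];
  exists u => //; split => //.
  by rewrite gap_ge0 ?(ltW u0)// subr_le0.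
by move: hu; rewrite gap_ge0 ?(ltW u0)// subr_le0.
Qed.

Definition survives x s : set T :=
  [set w | forall u, 0 < u -> u <= s -> 0 < gap x w u].

Lemma survivesE (x s : R) : 0 < x -> 0 <= s ->
  survives x s = [set w | (s%:E < first_passage b W x w)%E].
Proof.
move=> x0 s0; apply/seteqP; split => w /=; rewrite first_passageE.
  by move=> h; apply/first_nonpos_gt => // [v|]; [exact: gap_pos|exact: continuous_gap].
by move=> /first_nonpos_gt; apply=> // [v|]; [exact: gap_pos|exact: continuous_gap].
Qed.

Lemma first_passage_eq (x : R) w u : 0 < x -> first_passage b W x w = u%:E ->
  0 < u /\ W u w + x = b u.
Proof.
move=> x0; rewrite first_passageE => /first_nonpos_eq[||u0].
- by move=> v; exact: gap_pos.
- exact: continuous_gap.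
by rewrite gap_ge0 ?(ltW u0)// => /eqP; rewrite subr_eq0 => /eqP.
Qed.

(** Survival is a limit of events that look at finitely many dyadic times up to [s], each a function
    of the increments before [r]; monotone limits preserve independence. *)
Lemma independent_survives (x s r t : R) (B : set R) : 0 < x -> 0 <= s -> s <= r -> r <= t ->
  measurable B -> independent_of P [set w | B (W t w - W r w)] (survives x s).
Proof.
move=> x0; rewrite le_eqVlt => /predU1P[<-|s0] sr rt mB.
  rewrite (_ : survives x 0 = setT); first exact: independent_ofT.
  by apply/seteqP; split => // w _ u u0; rewrite leNgt u0.
have mW u := measurable_funPT (W u).
pose E (m N : nat) := [set w | forall k, (k <= 2 ^ N)%N ->
  m.+1%:R^-1 <= gap x w (s * k%:R / 2 ^+ N)].
have -> : survives x s = \bigcup_m \bigcap_N E m N.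
  apply/seteqP; split=> w /=.
    move=> /pos_dyadic[v||//|m hm].
    - exact: gap_pos.
    - exact: continuous_gap.
    - by exists m => // N _ k; exact: hm.
  move=> [m _ hm]; apply/pos_dyadic => //.
  - by move=> v; exact: gap_pos.
  - exact: continuous_gap.
  - by exists m => N k; exact: hm.
have mF : measurable [set w | B (W t w - W r w)].
  by rewrite -[X in measurable X]setTI; apply: measurable_funB.
(* The events increase with [m] (smaller margin) and decrease with [N] (finer grid). *)
apply: independent_of_bigcup => //.
  move=> m m' mm'; apply/subsetPset => w hw N _ k kN.
  apply: le_trans (hw N I k kN).
  by rewrite lef_pV2 ?posrE ?ltr0Sn// ler_nat ltnS.
move=> m; apply: independent_of_bigcap => //.
  move=> N N' NN'; apply/subsetPset => w hw k kN.
  have e : (2 ^ N' = 2 ^ (N' - N) * 2 ^ N)%N by rewrite -expnD subnK.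
  have := hw (k * 2 ^ (N' - N))%N.
  rewrite e [X in (X <= _)%N]mulnC leq_mul2l kN orbT => /(_ isT).
  have -> // : s * (k * 2 ^ (N' - N))%:R / 2 ^+ N' = s * k%:R / 2 ^+ N.
  rewrite -!natrX e !natrM; field.
  by rewrite !pnatr_eq0 !expn_eq0.
move=> N.
(* The times are the dyadic points of [0, s], then [r], then [t]. The increment of index 2^N runs
   from [s] to [r], and the one of index 2^N + 1 is the increment from [r] to [t] under study. *)
pose sg i := if (i <= 2 ^ N)%N then s * i%:R / 2 ^+ N
             else if i == (2 ^ N).+1 then r else t.
pose X i w := W (sg i.+1) w - W (sg i) w.
have mX i : measurable_fun setT (X i) by exact: measurable_funB.
have iX : mutually_independent P (fun i : 'I_(2 ^ N).+2 => X i).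
  case: hW => _ _ _; apply.
    by rewrite /sg/= mulr0 mul0r.
  move=> i; rewrite /sg; have [iN|iN] := leqP i.+1 (2 ^ N).
    rewrite (ltnW iN) ler_pM2r ?invr_gt0 ?exprn_gt0// ler_pM2l// ler_nat.
    exact: leqnSn.
  have [iN'|iN'] := leqP i (2 ^ N).
    have -> : i = (2 ^ N)%N by apply/eqP; rewrite eqn_leq iN' -ltnS.
    by rewrite eqxx natrX mulfK// expf_neq0.
  have -> : (i.+1 == (2 ^ N).+1) = false by rewrite eqSS gtn_eqF.
  by case: ifP.
have cyl i B' : (i < (2 ^ N).+1)%N -> measurable B' ->
    <<s cylinders (2 ^ N).+1 X >> (X i @^-1` B').
  move=> iN mB'; apply: sub_sigma_algebra.
  exists (fun j => if j == i then B' else setT).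
    by move=> j; case: ifP.
  apply/seteqP; split => w /= => [h j jN|/(_ i iN)]; last by rewrite eqxx.
  by case: eqP => // ->.
have : <<s cylinders (2 ^ N).+1 X >> (E m N).
  pose T' := g_sigma_algebraType (cylinders (2 ^ N).+1 X).
  have mX' i : (i < (2 ^ N).+1)%N -> measurable_fun [set: T'] (X i : T' -> R).
    by move=> iN _ B' mB'; rewrite setTI; exact: cyl.
  (* Since the path starts at 0, its value at a grid point is the sum of the earlier increments,
     hence measurable for the cylinders. *)
  have telX k w : (k <= 2 ^ N)%N -> \sum_(i < k) X i w = W (s * k%:R / 2 ^+ N) w.
    move=> kN; rewrite -(big_mkord xpredT (fun i => X i w)) /X.
    rewrite (telescope_sumr (fun i => W (sg i) w) (leq0n k)).
    by rewrite /sg kN/= mulr0 mul0r; case: hW => -> _ _ _; rewrite subr0.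
  have gk k w : gap x w (s * k%:R / 2 ^+ N) = W (s * k%:R / 2 ^+ N) w + x - b (s * k%:R / 2 ^+ N).
    by rewrite gap_ge0// divr_ge0 ?exprn_ge0// mulr_ge0// ltW.
  have -> : E m N = \bigcap_(k in [set k | (k <= 2 ^ N)%N])
      ((fun w : T' => \sum_(i < k) X i w) @^-1`
        [set y | m.+1%:R^-1 <= y + x - b (s * k%:R / 2 ^+ N)]).
    apply/seteqP; split => w /= hw k kN.
      by rewrite /= telX// -gk; exact: hw.
    by have := hw k kN; rewrite /= telX// gk.
  apply: (@bigcap_measurableType _ T') => k kN.
  have mS : measurable_fun [set: T'] (fun w : T' => \sum_(i < k) X i w).
    rewrite (_ : (fun w => _) = (fun w : T' => \sum_(i < k) (if (i < (2 ^ N).+1)%N then X i w else 0))); last first.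
      apply/funext => w; apply: eq_bigr => i _.
      by rewrite (ltn_trans (ltn_ord i))// ltnS.
    apply: (@measurable_sum _ T' R setT 'I_k _ (fun i w => if (i < (2 ^ N).+1)%N then X i w else 0)) => i.
    case iN : (i < (2 ^ N).+1)%N; last exact: measurable_cst.
    exact: mX'.
  rewrite -[X in measurable X]setTI; apply: mS => //.
  rewrite (_ : [set y | _] = `[m.+1%:R^-1 - x + b (s * k%:R / 2 ^+ N), +oo[%classic).
    exact: measurable_itv.
  have aux c c' (y : R) : (c <= y + x - c') = (c - x + c' <= y).
    by apply/idP/idP => h; lra.
  by apply/seteqP; split => y /=; rewrite in_itv/= andbT aux.
have := mutually_independent_past mX iX mB.
suff -> : X (2 ^ N).+1 @^-1` B = [set w | B (W t w - W r w)] by exact.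
rewrite /X /sg ltnn eqxx (_ : ((2 ^ N).+2 <= 2 ^ N)%N = false)//.
  by rewrite (_ : ((2 ^ N).+2 == (2 ^ N).+1) = false)// eqSS gtn_eqF.
by apply/negbTE; rewrite -ltnNge ltnS leqnSn.
Qed.
End brownian_first_passage.

(** * The Gaussian identity at the passage time *)

Section right_grid.
Context (R : realType).
Local Notation mu := (@lebesgue_measure R).
Implicit Types (h s t : R).

Definition grid_above h s : R := h * (Num.ceil (s / h))%:~R.

Lemma grid_above_ge h s : 0 < h -> s <= grid_above h s.
Proof. by move=> h0; rewrite /grid_above mulrC -ler_pdivrMr// ceil_ge. Qed.

Lemma grid_above_lt h s : 0 < h -> grid_above h s < s + h.
Proof.
move=> h0; rewrite /grid_above mulrC -ltr_pdivlMr// mulrDl divff ?gt_eqF//.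
by rewrite -ltrBlDr -[X in _ - X]/(1%:~R) -intrB; exact: gt_pred_ceil.
Qed.

Lemma grid_aboveE h s (j : nat) : 0 < h -> h * j%:R < s -> s <= h * j.+1%:R ->
  grid_above h s = h * j.+1%:R.
Proof.
move=> h0 js sj; rewrite /grid_above; congr (_ * _).
rewrite (@ceil_def _ (s / h) j.+1)//.
rewrite intrB/= ltr_pdivlMr// ler_pdivrMr// ![_ * h]mulrC sj andbT.
by rewrite -[_ - _]/(j.+1%:R - 1 : R) -natr1 addrK.
Qed.

Lemma grid_above_itv h s : 0 < h -> 0 < s -> exists2 j : nat,
  h * j%:R < s & s <= h * j.+1%:R.
Proof.
move=> h0 s0; have sh0 : 0 < s / h by rewrite divr_gt0.
have := grid_above_lt s h0; have := grid_above_ge s h0.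
have : (0 < Num.ceil (s / h)) by rewrite -(ltr_int R) (lt_le_trans sh0)// ceil_ge.
rewrite /grid_above; case: (Num.ceil (s / h)) => // -[//|j] _ h1 h2.
by exists j => //; rewrite -(ltrD2r h) -[X in _ + X < _]mulr1 -mulrDr natr1.
Qed.

Lemma measurable_grid_above h : 0 < h -> measurable_fun setT (grid_above h).
Proof.
move=> h0; apply: nondecreasing_measurable => // s t st.
by rewrite /grid_above ler_pM2l// ler_int le_ceil// ler_pM2r// invr_gt0.
Qed.

Lemma cvg_grid_above t s : 0 < t -> grid_above (t / n.+1%:R) s @[n --> \oo] --> s.
Proof.
move=> t0; have h0 n : 0 < t / n.+1%:R by rewrite divr_gt0// ltr0n.
apply: (@squeeze_cvgr _ _ _ _ (cst s) (fun n => s + t / n.+1%:R)).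
- by apply: nearW => n; rewrite grid_above_ge//= ltW// grid_above_lt.
- exact: cvg_cst.
- rewrite -[X in _ --> X]addr0 -[X in _ --> _ + X](mulr0 t).
  by apply: cvgD; [exact: cvg_cst|apply: cvgMr; exact: cvg_harmonic].
Qed.

(** The cells partition []0, t]], so the sum is the integral of [k u] times [q] at the grid point
    above [u]; dominated convergence with dominating function [k] gives the limit. *)
Lemma cvg_grid_sum t (k q : R -> R) : 0 < t ->
  measurable_fun `]0, t] k -> (forall u, 0 < u -> u <= t -> 0 <= k u) ->
  (\int[mu]_(u in `]0%R, t]) (k u)%:E < +oo)%E ->
  (forall u, 0 < u -> u < t -> {for u, continuous q}) ->
  (forall u, 0 < u -> u <= t -> 0 <= q u <= 1) ->
  (\sum_(j < n.+1) ((\int[mu]_(u in `](t / n.+1%:R * j%:R)%R, (t / n.+1%:R * j.+1%:R)%R])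
      (k u)%:E) * (q (t / n.+1%:R * j.+1%:R))%:E))%E @[n --> \oo] -->
  (\int[mu]_(u in `]0%R, t]) (k u * q u)%:E)%E.
Proof.
move=> t0 mk k0 kfin cq q01; have h0 n : 0 < t / n.+1%:R by rewrite divr_gt0// ltr0n.
have hn n : t / n.+1%:R * n.+1%:R = t by rewrite divfK.
have gt n u : 0 < u -> u <= t -> grid_above (t / n.+1%:R) u <= t.
  move=> u0 ut; rewrite /grid_above.
  apply: (@le_trans _ _ (t / n.+1%:R * n.+1%:R)); last by rewrite divfK.
  rewrite ler_pM2l// -[n.+1%:R]/(n.+1%:Z%:~R) ler_int ceil_le_int.
  rewrite ler_pdivrMr ?h0//.
  by rewrite (etrans (mulrC _ _) (hn n) : n.+1%:~R * (t / n.+1%:~R) = t).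
have mq : measurable_fun `]0, t] q.
  have <- : `]0, t[%classic `|` [set t] = `]0, t]%classic by exact: setUitv1.
  apply/measurable_funU => //; split; last exact: measurable_fun_set1.
  apply: open_continuous_measurable_fun => [|u]; first exact: interval_open.
  by rewrite inE/= in_itv/= => /andP[u0 ut]; exact: cq.
have mqg n : measurable_fun `]0, t] (fun u => q (grid_above (t / n.+1%:R) u)).
  apply: (@measurable_comp _ _ _ _ _ _ `]0, t]%classic q _ (grid_above (t / n.+1%:R))) => //.
    move=> _ [u /= + <-]; rewrite !in_itv/= => /andP[u0 ut].
    by rewrite gt// andbT (lt_le_trans u0)// grid_above_ge.
  by apply: measurable_funTS; exact: measurable_grid_above.
have -> : (fun n => \sum_(j < n.+1) ((\int[mu]_(u in `](t / n.+1%:R * j%:R)%R, (t / n.+1%:R * j.+1%:R)%R])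
      (k u)%:E) * (q (t / n.+1%:R * j.+1%:R))%:E))%E =
  (fun n => \int[mu]_(u in `]0%R, t]) (k u * q (grid_above (t / n.+1%:R) u))%:E)%E.
  apply/funext => n.
  pose I j := `](t / n.+1%:R * j%:R)%R, (t / n.+1%:R * j.+1%:R)%R]%classic.
  have tI : trivIset [set: nat] I.
    move=> i j _ _ [u []]; rewrite /I/= !in_itv/= => /andP[iu ui] /andP[ju uj].
    have := grid_aboveE (h0 n) iu ui; rewrite (grid_aboveE (h0 n) ju uj).
    by move=> /(mulfI (lt0r_neq0 (h0 n)))/eqP; rewrite eqr_nat eqSS => /eqP.
  have UI : \big[setU/set0]_(j <- index_iota 0 n.+1) I j = `]0, t]%classic.
    rewrite big_mkord -(bigcup_mkord _ I); apply/seteqP; split => u /=.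
      move=> [j]; rewrite /= => jn; rewrite /I/= !in_itv/=.
      move=> /andP[ju uj]; apply/andP; split.
        by apply: le_lt_trans ju; rewrite mulr_ge0// ltW.
      apply: (le_trans uj); apply: (@le_trans _ _ (t / n.+1%:R * n.+1%:R)); last by rewrite divfK.
      by rewrite ler_pM2l// ler_nat.
    rewrite in_itv/= => /andP[u0 ut].
    have [j ju uj] := grid_above_itv (h0 n) u0.
    exists j; last by rewrite /I/= in_itv/= ju.
    rewrite /= -(ltr_nat R) -(ltr_pM2l (h0 n)).
    by apply: (lt_le_trans ju); rewrite divfK.
  have mkq : measurable_fun `]0, t] (fun u => k u * q (grid_above (t / n.+1%:R) u)).
    by apply: measurable_funM => //; exact: mqg.
  have kq0 u : `]0, t]%classic u -> (0 <= (k u * q (grid_above (t / n.+1%:R) u))%:E)%E.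
    rewrite /= in_itv/= => /andP[u0 ut]; rewrite lee_fin mulr_ge0 ?k0//.
    have gu := grid_above_ge u (h0 n).
    by have /andP[] := q01 _ (lt_le_trans u0 gu) (gt n _ u0 ut).
  rewrite -UI ge0_integral_bigsetU//=; last 4 first.
  - exact: (iota_uniq 0 n.+1).
  - exact: sub_trivIset tI.
  - by rewrite UI; apply/measurable_EFinP.
  - by move=> u; rewrite UI; exact: kq0.
  rewrite big_mkord; apply: eq_bigr => j _.
  have Ij u : u \in I j -> [/\ 0 < u, u <= t & grid_above (t / n.+1%:R) u = t / n.+1%:R * j.+1%:R].
    rewrite inE => uj; have : (\bigcup_(i in `I_n.+1) I i) u by exists j => //=; exact: ltn_ord.
    rewrite (bigcup_mkord n.+1 I) -(big_mkord xpredT I) UI/= in_itv/= => /andP[u0 ut].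
    by move: uj; rewrite /I/= in_itv/= => /andP[ju uj]; rewrite (grid_aboveE _ ju).
  under [RHS]eq_integral => u uj.
    have [u0 ut ->] := Ij _ uj; rewrite EFinM; over.
  have subI : I j `<=` `]0, t]%classic.
    by move=> u /mem_set/Ij[u0 ut _]; rewrite /= in_itv/= u0.
  rewrite ge0_integralZr//=.
  - exact: measurable_itv.
  - by apply/measurable_EFinP; exact: measurable_funS mk.
  - by move=> u /mem_set/Ij[u0 ut _]; rewrite lee_fin k0.
  - rewrite lee_fin; have h1 : 0 < t / n.+1%:R * j.+1%:R by rewrite mulr_gt0.
    have [] := andP (q01 _ h1 _) => //.
    by rewrite -[leRHS](hn n) ler_pM2l// ler_nat; exact: ltn_ord.
  - by move=> i; exact: measurable_itv.
apply: (@dominated_cvg _ _ _ mu _ _ _ _ (fun u => (k u)%:E)).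
- exact: measurable_itv.
- by move=> n; apply/measurable_EFinP; apply: measurable_funM => //; exact: mqg.
- move=> u; rewrite /= in_itv/= => /andP[u0 ut]; apply: cvg_EFin; first exact: nearW.
  apply: cvgMr; rewrite /comp/=.
  (* Continuity of [q] is assumed inside []0, t[] only. At u = t the sequence is constant, because
     [t] is a point of every grid. *)
  move: ut; rewrite le_eqVlt => /predU1P[ut|ut].
    rewrite ut (_ : (fun n => _) = cst (q t)); first exact: cvg_cst.
    apply/funext => n /=; congr q; rewrite (@grid_aboveE _ _ n)//.
    by rewrite -[ltRHS](hn n) ltr_pM2l// ltr_nat.
    by rewrite hn.
  have cu := cq u u0 ut; have cg := @cvg_grid_above t u t0.
  exact: (cvg_comp (fun n => grid_above (t / n.+1%:R) u) q cg cu).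
- by [].
- apply/integrableP; split; first exact/measurable_EFinP.
  suff -> : (\int[mu]_(u in `]0%R, t]) `|(k u)%:E| = \int[mu]_(u in `]0%R, t]) (k u)%:E)%E by [].
  apply: eq_integral => u; rewrite inE/= in_itv/= => /andP[u0 ut].
  by rewrite ger0_norm ?k0.
- move=> n u; rewrite /= in_itv/= => /andP[u0 ut].
  have gu := grid_above_ge u (h0 n).
  have /andP[q0 q1] := q01 _ (lt_le_trans u0 gu) (gt n _ u0 ut).
  by rewrite lee_fin normrM !ger0_norm ?k0// ler_piMr ?k0.
Qed.
End right_grid.

(** * The Gaussian distribution function and changes of scale *)

Section gaussian_cdf.
Context (R : realType).
Local Notation mu := (@lebesgue_measure R).

(** [c] times the image of Lebesgue measure under multiplication by [c] agrees with Lebesgue measure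
    on half-open intervals, hence everywhere. *)
Lemma ge0_integral_scale (c : R) (f : R -> \bar R) : 0 < c ->
  measurable_fun setT f -> (forall x, 0 <= f x)%E ->
  (\int[mu]_x f x = c%:E * \int[mu]_x f (c * x)%R)%E.
Proof.
move=> c0 mf f0.
pose h := fun x : measurableTypeR R => (c * x : measurableTypeR R).
have mc : measurable_fun setT h.
  by apply: continuous_measurable_fun; exact: mulrl_continuous.
have c0' : 0 <= c by exact: ltW.
pose m := @mscale _ _ R (NngNum c0') (pushforward mu h).
have -> : (\int[mu]_x f x = \int[m mc]_x f x)%E.
  apply: eq_measure_integral => A mA _.
  apply: lebesgue_measure_unique => //= _ [[a b]] _ <-.
  rewrite /m /mscale/= /pushforward.
  have -> : h @^-1` `]a, b] = `]a / c, b / c]%classic.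
    apply/seteqP; split => x; rewrite /h/= !in_itv/=;
      by rewrite ltr_pdivrMr// ler_pdivlMr// mulrC.
  rewrite !lebesgue_measure_itv/= !lte_fin ltr_pM2r ?invr_gt0//.
  case: ifP => _; last by rewrite mule0.
  rewrite -!EFinB -EFinM; congr EFin; field; exact: lt0r_neq0.
rewrite /m ge0_integral_mscale//= ge0_integral_pushforward//=.
Qed.

(** The centred normal density of variance 1/2, chosen so that exp(-v^2) is the Hermite weight. This
    is the origin of the scale factors [Num.sqrt (2 * t)] below. *)
Definition gauss_pdf (v : R) : R := (Num.sqrt pi)^-1 * expR (- v ^+ 2).

Definition gauss_cdf (z : R) : R := \int[mu]_(v in `]-oo, z]) gauss_pdf v.

Lemma gauss_pdf_ge0 v : 0 <= gauss_pdf v.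
Proof. by rewrite mulr_ge0 ?expR_ge0// invr_ge0 sqrtr_ge0. Qed.

Lemma continuous_gauss_pdf : continuous gauss_pdf.
Proof. by move=> v; apply: cvgMr; exact: continuous_gauss_fun. Qed.

Lemma integral_gauss_pdf : (\int[mu]_v (gauss_pdf v)%:E = 1)%E.
Proof.
rewrite (_ : (fun v => _) = (fun v => ((Num.sqrt pi)^-1)%:E * (gauss_fun v)%:E)%E)//.
rewrite ge0_integralZl//=.
- by rewrite integralT_gauss -EFinM mulVf// gt_eqF// sqrtr_gt0 pi_gt0.
- by apply/measurable_EFinP; exact: measurable_gauss_fun.
- by move=> v _; rewrite lee_fin gauss_fun_ge0.
Qed.

Lemma measurable_gauss_pdf : measurable_fun setT gauss_pdf.
Proof. by apply: continuous_measurable_fun; exact: continuous_gauss_pdf. Qed.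

Lemma integrable_gauss_pdf : mu.-integrable setT (EFin \o gauss_pdf).
Proof.
apply/integrableP; split; first by apply/measurable_EFinP; exact: measurable_gauss_pdf.
under eq_integral do rewrite /= ger0_norm ?gauss_pdf_ge0//.
by rewrite integral_gauss_pdf ltry.
Qed.

Lemma gauss_cdfE z : (gauss_cdf z)%:E = (\int[mu]_(v in `]-oo, z]) (gauss_pdf v)%:E)%E.
Proof.
rewrite fineK//; apply: integrable_fin_num => //.
by apply: integrableS integrable_gauss_pdf.
Qed.

Lemma gauss_cdf_ge0 z : 0 <= gauss_cdf z.
Proof. by apply: Rintegral_ge0 => v _; exact: gauss_pdf_ge0. Qed.

Lemma gauss_cdf_le1 z : gauss_cdf z <= 1.
Proof.
rewrite -lee_fin gauss_cdfE -integral_gauss_pdf; apply: ge0_subset_integral => //.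
  by apply/measurable_EFinP; exact: measurable_gauss_pdf.
by move=> v _; rewrite lee_fin gauss_pdf_ge0.
Qed.

Lemma is_derive_gauss_cdf (z : R) : is_derive z 1 gauss_cdf (gauss_pdf z).
Proof.
have zz : z < z + 1 by rewrite ltrDl.
have intz : mu.-integrable `]-oo, z + 1] (EFin \o gauss_pdf).
  by apply: integrableS integrable_gauss_pdf.
have [||dF F'] := @continuous_FTC1 R gauss_pdf -oo%O z (z + 1) zz intz.
- exact: ltNyr.
- exact: continuous_gauss_pdf.
by apply: DeriveDef; [exact: dF|rewrite -derive1E; exact: F'].
Qed.

Lemma normal_prob_le (sg z : R) : 0 < sg ->
  normal_prob 0 sg [set v | v <= z] = (gauss_cdf (z / Num.sqrt (2 * sg ^+ 2)))%:E.
Proof.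
move=> sg0; have c0 : 0 < Num.sqrt (2 * sg ^+ 2).
  by rewrite sqrtr_gt0 mulr_gt0 ?exprn_gt0.
rewrite gauss_cdfE /normal_prob (_ : [set v | v <= z] = `]-oo, z]%classic)//.
pose F : R -> \bar R := (fun v => (normal_pdf 0 sg v)%:E) \_ `]-oo, z].
have mF : measurable_fun setT F.
  apply/(measurable_restrictT _ _).1 => //.
  by apply/measurable_EFinP; apply: measurable_funTS; exact: measurable_normal_pdf.
have F0 v : (0 <= F v)%E.
  by apply: erestrict_ge0 => u _; rewrite lee_fin normal_pdf_ge0.
have mFc (c : R) : measurable_fun setT (fun v => F (c * v)).
  have mc : measurable_fun [set: R] (fun v : R => c * v).
    by apply: continuous_measurable_fun; exact: mulrl_continuous.
  exact: (measurableT_comp mF mc).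
have -> : (\int[mu]_(v in `]-oo, z]) (normal_pdf 0 sg v)%:E = \int[mu]_v F v)%E.
  exact: integral_mkcond.
rewrite (ge0_integral_scale c0 mF F0); set c := Num.sqrt _ in c0 *.
have -> : (c%:E * \int[mu]_v F (c * v)%R = \int[mu]_v (c%:E * F (c * v)%R))%E.
  by rewrite ge0_integralZl//; [exact: mFc|rewrite lee_fin ltW].
rewrite [RHS]integral_mkcond; apply: eq_integral => v _; rewrite /F !patchE.
have -> : (c * v \in `]-oo, z]%classic) = (v \in `]-oo, z / c]%classic).
  by apply/idP/idP; rewrite !inE/= !in_itv/= ler_pdivlMr// mulrC.
case: ifP => _; last by rewrite mule0.
rewrite -EFinM; congr EFin; rewrite /normal_pdf gt_eqF// /normal_fun.
rewrite /normal_peak /gauss_pdf mulrA; congr (_ * expR _).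
  have -> : sg ^+ 2 * pi *+ 2 = (2 * sg ^+ 2) * pi by rewrite -mulr_natl mulrA.
  rewrite sqrtrM ?mulr_ge0 ?exprn_ge0 ?(ltW sg0)// -/c; field.
  by rewrite !lt0r_neq0// sqrtr_gt0 pi_gt0.
rewrite subr0 exprMn sqr_sqrtr ?mulr_ge0 ?exprn_ge0 ?(ltW sg0)// -mulr_natl; field.
exact: lt0r_neq0.
Qed.
End gaussian_cdf.

(** * Decomposition of the law at time [t] along the passage time *)

Section first_passage_identity.
Context d (T : measurableType d) (R : realType) (P : probability T R)
  (W : R -> {RV P >-> R}) (b : R -> R) (x : R) (k : R -> R).
Local Notation mu := (@lebesgue_measure R).
Hypothesis hW : standard_brownian_motion W.
Hypothesis b0 : b 0 = 0.
Hypothesis cb : {within `[0, +oo[, continuous b}.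
Hypothesis x0 : 0 < x.
Hypothesis k_ge0 : forall t, 0 < t -> 0 <= k t.
Hypothesis ck : forall t, 0 < t -> {for t, continuous k}.
Hypothesis kP : forall A : set R, measurable A ->
  P [set w | exists2 t, A t & first_passage b W x w = t%:E] =
  (\int[mu]_(t in A `&` `]0%R, +oo[) (k t)%:E)%E.

Lemma incr_cdf (s t z : R) : 0 <= s -> s < t ->
  P [set w | W t w - W s w <= z] = (gauss_cdf (z / Num.sqrt (2 * (t - s))))%:E.
Proof.
move=> s0 st; case: hW => _ _ /(_ s t s0 st [set v | v <= z]) hN _.
have mz : measurable [set v : R | v <= z].
  by rewrite (_ : [set v | _] = `]-oo, z]%classic)//; exact: measurable_itv.
rewrite [LHS](hN mz) normal_prob_le ?sqr_sqrtr ?subr_ge0 1?ltW//.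
by rewrite sqrtr_gt0 subr_gt0.
Qed.

Lemma measurable_incr_le (s t z : R) : measurable [set w | W t w - W s w <= z].
Proof.
rewrite (_ : [set w | _] = (fun w => W t w - W s w) @^-1` `]-oo, z]).
  rewrite -[X in measurable X]setTI.
  apply: (measurable_funB (measurable_funPT (W t)) (measurable_funPT (W s))) => //.
by apply/seteqP; split => w /=; rewrite in_itv.
Qed.

Definition hits (a c : R) : set T :=
  [set w | exists2 u, `]a, c]%classic u & first_passage b W x w = u%:E].

(** As a difference of two survival events, a passage in a cell inherits their measurability and
    their independence of later increments. *)
Lemma hitsE (a c : R) : 0 <= a -> a <= c ->
  hits a c = survives W b x a `\` survives W b x c.
Proof.
move=> a0 ac; rewrite (survivesE hW b0 cb x0 a0).
rewrite (survivesE hW b0 cb x0 (le_trans a0 ac)); apply/seteqP; split => w /=.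
  move=> [u]; rewrite /= in_itv/= => /andP[au uc] ->.
  by rewrite !lte_fin au; split => //; apply/negP; rewrite -leNgt.
move=> [h1 /negP]; rewrite -leNgt => h2.
have h3 : first_passage b W x w \is a fin_num.
  by rewrite fin_numElt (lt_trans _ h1) ?ltNyr//= (le_lt_trans h2) ?ltry.
exists (fine (first_passage b W x w)); last by rewrite fineK.
by rewrite /= in_itv/= -lte_fin -lee_fin fineK// h1 h2.
Qed.

Lemma measurable_survives (a : R) : 0 <= a -> measurable (survives W b x a).
Proof.
move=> a0.
by have [] := independent_survives hW b0 cb x0 a0 (lexx a) (lexx a) measurable0.
Qed.

Lemma measurable_hits (a c : R) : 0 <= a -> a <= c -> measurable (hits a c).
Proof.
move=> a0 ac; rewrite hitsE//; apply: measurableD; apply: measurable_survives => //.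
exact: le_trans ac.
Qed.

Lemma hits_indep (a c t z : R) : 0 <= a -> a <= c -> c <= t ->
  P (hits a c `&` [set w | W t w - W c w <= z]) =
  (P (hits a c) * P [set w | (W t w - W c w <= z)%R])%E.
Proof.
move=> a0 ac ct; rewrite hitsE//.
have mz : measurable [set v : R | v <= z].
  by rewrite (_ : [set v | _] = `]-oo, z]%classic)//; exact: measurable_itv.
have Ic := independent_survives hW b0 cb x0 (le_trans a0 ac) (lexx c) ct mz.
have Ia := independent_survives hW b0 cb x0 a0 ac ct mz.
suff [] : independent_of P [set w | W t w - W c w <= z]
  (survives W b x a `\` survives W b x c) by [].
apply: independent_ofD Ia Ic; first exact: measurable_incr_le.
by move=> w h u u0 ua; apply: h => //; exact: le_trans ac.
Qed.

Lemma P_hits (a c : R) : 0 <= a ->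
  P (hits a c) = (\int[mu]_(u in `]a, c]) (k u)%:E)%E.
Proof.
move=> a0; rewrite /hits kP; last exact: measurable_itv.
congr (\int[mu]_(u in _) _)%E; apply/seteqP; split => u /=; rewrite !in_itv/= ?andbT.
  by case.
by move=> /[dup] h /andP[au _]; split => //; exact: le_lt_trans au.
Qed.

(* The path has not come back within eps of the boundary at the first grid
   point after the passage time. *)
Definition overshoots (t : R) (n : nat) (eps : R) : set T :=
  [set w | exists2 u, `]0, t]%classic u &
     first_passage b W x w = u%:E /\
     eps < `|gap W b x w (grid_above (t / n.+1%:R) u)|].

(** On each cell the rounded passage time is a constant, which leaves a finite union of events at
    fixed times. *)
Lemma overshootsE (t : R) (n : nat) (eps : R) : 0 < t ->
  overshoots t n eps = \bigcup_(j in `I_n.+1)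
    (hits (t / n.+1%:R * j%:R) (t / n.+1%:R * j.+1%:R) `&`
     [set w | eps < `|gap W b x w (t / n.+1%:R * j.+1%:R)|]).
Proof.
move=> t0; have h0 : 0 < t / n.+1%:R by rewrite divr_gt0// ltr0n.
have hn : t / n.+1%:R * n.+1%:R = t by rewrite divfK.
apply/seteqP; split => w.
  move=> [u]; rewrite /= in_itv/= => /andP[u0 ut] [hu hg].
  have [j ju uj] := grid_above_itv h0 u0; exists j.
    by rewrite /= -(ltr_nat R) -(ltr_pM2l h0) hn; exact: lt_le_trans ut.
  split; first by exists u => //=; rewrite in_itv/= ju.
  by rewrite /= -(grid_aboveE h0 ju uj).
move=> [j /= jn] [[u]]; rewrite /= in_itv/= => /andP[ju uj] hu hg.
exists u; last by rewrite (grid_aboveE h0 ju uj).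
rewrite /= in_itv/=; apply/andP; split.
  by apply: le_lt_trans ju; rewrite mulr_ge0// ltW.
by apply: (le_trans uj); rewrite -[leRHS]hn ler_pM2l// ler_nat.
Qed.

Lemma measurable_overshoots (t : R) (n : nat) (eps : R) : 0 < t ->
  measurable (overshoots t n eps).
Proof.
move=> t0; rewrite overshootsE//; apply: bigcup_measurable => j _.
have h0 : 0 < t / n.+1%:R by rewrite divr_gt0// ltr0n.
apply: measurableI.
  apply: measurable_hits; first by rewrite mulr_ge0// ltW.
  by rewrite ler_pM2l// ler_nat.
set s := t / _ * _; have s0 : 0 <= s by rewrite mulr_ge0// ltW.
rewrite (_ : [set w | _] = W s @^-1` [set v | eps < `|v + x - b s|]); last first.
  by apply/seteqP; split => w /=; rewrite gap_ge0.
rewrite -[X in measurable X]setTI; apply: (measurable_funPT (W s)) => //.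
rewrite (_ : [set v | _] = (fun v => `|v + x - b s|) @^-1` `]eps, +oo[).
  rewrite -[X in measurable X]setTI; apply: continuous_measurable_fun => //.
  by move=> v; apply: cvg_norm; apply: cvgB; [apply: cvgD|]; [exact: cvg_id|exact: cvg_cst..].
by apply/seteqP; split => v /=; rewrite in_itv/= andbT.
Qed.

(** For a fixed path with passage time [u] at most [t], the grid points tend to [u], where the gap
    is 0, so eventually there is no overshoot. Dominated convergence of the indicators concludes. *)
Lemma cvg_overshoots (t eps : R) : 0 < t -> 0 < eps ->
  P (overshoots t n eps) @[n --> \oo] --> 0%E.
Proof.
move=> t0 e0; have mO n := measurable_overshoots n eps t0.
have -> : (fun n => P (overshoots t n eps)) =
    (fun n => \int[P]_w (\1_(overshoots t n eps) w)%:E)%E.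
  by apply/funext => n; rewrite integral_indic// setIT.
rewrite -(integral0 P setT).
apply: (@dominated_cvg _ _ _ P _ _ _ _ (cst 1%E)) => //.
- by move=> n; apply/measurable_EFinP; exact: measurable_indic.
- move=> w _; apply: cvg_near_cst.
  have [[u [/= ut hu]]|nh] := pselect (exists u, `]0, t]%classic u /\ first_passage b W x w = u%:E); last first.
    apply: nearW => n; rewrite indicE memNset// => -[u ut [hu _]].
    by apply: nh; exists u.
  have [u0 gu] := first_passage_eq hW b0 cb x0 hu.
  have cg : gap W b x w (grid_above (t / n.+1%:R) u) @[n --> \oo] --> (0 : R).
    have -> : 0 = gap W b x w u by rewrite gap_ge0 ?(ltW u0)// gu subrr.
    have h1 := @cvg_grid_above R t u t0.
    have h2 : {for u, continuous (gap W b x w)} by exact: (continuous_gap hW cb).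
    exact: (cvg_comp (fun n => grid_above (t / n.+1%:R) u) _ h1 h2).
  have := cg; move=> /cvgrPdist_lt /(_ _ e0); apply: filterS => n /=.
  rewrite sub0r normrN => hn.
  rewrite indicE memNset// => -[v _ []]; rewrite hu => -[<-].
  by rewrite ltNge ltW.
- apply/integrableP; split; first exact: measurable_cst.
  by rewrite integral_cst//= normr1 mul1e probability_setT ltry.
- by move=> n w _; rewrite lee_fin ger0_norm ?indicE//; case: (_ \in _).
Qed.

(** It equals the closed Gaussian form for r < t. The last grid point is r = t, where that form
    would divide by zero and return [gauss_cdf 0]; the probability is still correct there. *)
Definition crossing_cdf (t z r : R) : R :=
  fine (P [set w | W t w - W r w <= z - b r]).

Lemma crossing_cdfE (t z r : R) :
  (crossing_cdf t z r)%:E = P [set w | W t w - W r w <= z - b r].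
Proof. by rewrite fineK// fin_num_measure//; exact: measurable_incr_le. Qed.

Lemma grid_hits_sum (t z : R) (n : nat) : 0 < t ->
  (\sum_(j < n.+1) ((\int[mu]_(u in `](t / n.+1%:R * j%:R)%R, (t / n.+1%:R * j.+1%:R)%R])
      (k u)%:E) * (crossing_cdf t z (t / n.+1%:R * j.+1%:R))%:E) =
  \sum_(j < n.+1) P (hits (t / n.+1%:R * j%:R) (t / n.+1%:R * j.+1%:R) `&`
    [set w | (W t w - W (t / n.+1%:R * j.+1%:R) w <= z - b (t / n.+1%:R * j.+1%:R))%R]))%E.
Proof.
move=> t0; apply: eq_bigr => j _.
have h0 : 0 < t / n.+1%:R by rewrite divr_gt0// ltr0n.
have hj : 0 <= t / n.+1%:R * j%:R by rewrite mulr_ge0// ltW.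
rewrite hits_indep ?P_hits ?crossing_cdfE//.
  by rewrite ler_pM2l// ler_nat.
rewrite -[leRHS](divfK (_ : n.+1%:R != 0 :> R))// ler_pM2l// ler_nat.
exact: ltn_ord.
Qed.

(** Being at most y <= b(t) at time [t] forces a passage before [t]. Without overshoot the path at
    the grid point is at least b - eps, so the remaining increment is at most y + eps - b. A union
    bound suffices. *)
Lemma grid_cdf_le (t y eps : R) (n : nat) : 0 < t -> y <= b t ->
  (P [set w | (W t w + x <= y)%R] <=
   \sum_(j < n.+1) ((\int[mu]_(u in `](t / n.+1%:R * j%:R)%R, (t / n.+1%:R * j.+1%:R)%R])
      (k u)%:E) * (crossing_cdf t (y + eps) (t / n.+1%:R * j.+1%:R))%:E) +
   P (overshoots t n eps))%E.
Proof.
move=> t0 yb; rewrite grid_hits_sum//.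
have h0 : 0 < t / n.+1%:R by rewrite divr_gt0// ltr0n.
have hn : t / n.+1%:R * n.+1%:R = t by rewrite divfK.
set s := fun j : nat => t / n.+1%:R * j%:R.
pose A j := hits (s j) (s j.+1) `&` [set w | W t w - W (s j.+1) w <= y + eps - b (s j.+1)].
have s0 j : 0 <= s j by rewrite mulr_ge0// ltW.
have mA j : measurable (A j).
  apply: measurableI; last exact: measurable_incr_le.
  by apply: measurable_hits => //; rewrite ler_pM2l// ler_nat.
have mU : measurable (\big[setU/set0]_(j < n.+1) A j).
  by apply: bigsetU_measurable => j _.
apply: (@le_trans _ _ (P (\big[setU/set0]_(j < n.+1) A j `|` overshoots t n eps))).
  apply: le_measure; rewrite ?inE.
  - rewrite (_ : [set w | _] = [set w | W t w - W 0 w <= y - x]).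
      exact: measurable_incr_le.
    by apply/seteqP; split => w /=; case: hW => -> _ _ _; rewrite subr0 lerBrDr.
  - by apply: measurableU => //; exact: measurable_overshoots.
  move=> w /= hw.
  have hh : hits 0 t w.
    rewrite hitsE ?(ltW t0)//; split => /=; first by move=> u u0; rewrite leNgt u0.
    move=> /(_ t t0 (lexx t)); rewrite gap_ge0 ?(ltW t0)// ltNge => /negP; apply.
    by rewrite subr_le0 (le_trans hw).
  case: hh => u; rewrite /= in_itv/= => /andP[u0 ut] hu.
  have [|gu] := ltP eps `|gap W b x w (grid_above (t / n.+1%:R) u)|.
    by move=> gu; right; exists u => //=; rewrite in_itv/= u0.
  left; have [j ju uj] := grid_above_itv h0 u0.
  rewrite -(bigcup_mkord n.+1 A); exists j.
    by rewrite /= -(ltr_nat R) -(ltr_pM2l h0) hn; exact: lt_le_trans ut.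
  split; first by exists u => //=; rewrite in_itv/= ju.
  move: gu; rewrite (grid_aboveE h0 ju uj) gap_ge0; last exact: s0.
  rewrite ler_norml => /andP[gu _] /=; rewrite -/(s j.+1) in gu *.
  by move: (W (s j.+1) w) (W t w) (b (s j.+1)) hw gu => /= v v' c hw gu; lra.
apply: le_trans (measureU2 _ _ _) _ => //; first exact: measurable_overshoots.
apply: leeD => //; exact: (Boole_inequality P (A := A)).
Qed.

(** The converse inclusion. Here the sum must be the probability of a union, so the events of
    distinct cells have to be disjoint: the passage time lies in one cell only. *)
Lemma grid_cdf_ge (t y eps : R) (n : nat) : 0 < t ->
  (\sum_(j < n.+1) ((\int[mu]_(u in `](t / n.+1%:R * j%:R)%R, (t / n.+1%:R * j.+1%:R)%R])
      (k u)%:E) * (crossing_cdf t (y - eps) (t / n.+1%:R * j.+1%:R))%:E) <=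
   P [set w | (W t w + x <= y)%R] + P (overshoots t n eps))%E.
Proof.
move=> t0; rewrite grid_hits_sum//.
have h0 : 0 < t / n.+1%:R by rewrite divr_gt0// ltr0n.
have hn : t / n.+1%:R * n.+1%:R = t by rewrite divfK.
set s := fun j : nat => t / n.+1%:R * j%:R.
pose A j := hits (s j) (s j.+1) `&` [set w | W t w - W (s j.+1) w <= y - eps - b (s j.+1)].
have s0 j : 0 <= s j by rewrite mulr_ge0// ltW.
have mA j : measurable (A j).
  apply: measurableI; last exact: measurable_incr_le.
  by apply: measurable_hits => //; rewrite ler_pM2l// ler_nat.
have tA : trivIset setT A.
  move=> i j _ _ [w [[[u]]]]; rewrite /= in_itv/= => /andP[iu ui] hu _ [[v]].
  rewrite /= in_itv/= hu => /andP[jv vj] [uv] _; move: jv vj; rewrite -uv => ju uj.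
  have := grid_aboveE h0 iu ui; rewrite (grid_aboveE h0 ju uj).
  by move=> /(mulfI (lt0r_neq0 h0))/eqP; rewrite eqr_nat eqSS => /eqP.
have mU : measurable (\big[setU/set0]_(j < n.+1) A j).
  by apply: bigsetU_measurable => j _.
have mO : measurable (overshoots t n eps) by exact: measurable_overshoots.
have mY : measurable [set w | W t w + x <= y].
  rewrite (_ : [set w | _] = [set w | W t w - W 0 w <= y - x]).
    exact: measurable_incr_le.
  by apply/seteqP; split => w /=; case: hW => -> _ _ _; rewrite subr0 lerBrDr.
apply: le_trans (measureU2 _ mY mO).
have <- := measure_semi_additive_ord_I P (fun k _ => mA k) (sub_trivIset (@subsetT _ _) tA) mU.
apply: le_measure; rewrite ?inE//; first exact: measurableU.
rewrite -(bigcup_mkord n.+1 A) => w [j /= jn] [[u]]; rewrite /= in_itv/= => /andP[ju uj] hu hz.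
have ut : u <= t by apply: (le_trans uj); rewrite -[leRHS]hn ler_pM2l// ler_nat.
have u0 : 0 < u by apply: le_lt_trans ju; exact: s0.
have [|gu] := ltP eps `|gap W b x w (grid_above (t / n.+1%:R) u)|.
  by move=> gu; right; exists u => //=; rewrite in_itv/= u0.
left; move: gu; rewrite (grid_aboveE h0 ju uj) gap_ge0; last exact: s0.
rewrite ler_norml => /andP[_ gu] /=; rewrite -/(s j.+1) in gu *.
by move: (W (s j.+1) w) (W t w) (b (s j.+1)) hz gu => /= v v' c hz gu; lra.
Qed.

Lemma continuous_boundary (u : R) : 0 < u -> {for u, continuous b}.
Proof.
by move=> u0; have /continuous_within_itvcyP[/(_ u)+ _] := cb; apply; rewrite in_itv/= u0.
Qed.

Lemma continuous_crossing_cdf (t z u : R) : 0 < u -> u < t ->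
  {for u, continuous (fun r => gauss_cdf ((z - b r) / Num.sqrt (2 * (t - r))))}.
Proof.
move=> u0 ut; have c0 : 0 < 2 * (t - u) by rewrite mulr_gt0// subr_gt0.
have cs : {for u, continuous (fun r => Num.sqrt (2 * (t - r)))}.
  apply: (cvg_comp (fun r => 2 * (t - r)) Num.sqrt); last exact: sqrt_continuous.
  by apply: cvgMr; apply: cvgB; [exact: cvg_cst|exact: cvg_id].
have hv : {for u, continuous (fun r => (z - b r) / Num.sqrt (2 * (t - r)))}.
  apply: cvgM; first by apply: cvgB; [exact: cvg_cst|exact: continuous_boundary].
  by apply: cvgV; [rewrite gt_eqF// sqrtr_gt0|exact: cs].
have hg v : {for v, continuous (@gauss_cdf R)}.
  have [d1 _] := is_derive_gauss_cdf v.
  exact/differentiable_continuous/derivable1_diffP.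
exact: (continuous_comp hv (hg _)).
Qed.

Lemma crossing_cdf_lt (t z r : R) : 0 <= r -> r < t ->
  crossing_cdf t z r = gauss_cdf ((z - b r) / Num.sqrt (2 * (t - r))).
Proof. by move=> r0 rt; rewrite /crossing_cdf incr_cdf. Qed.

Lemma continuous_crossing (t z u : R) : 0 < u -> u < t ->
  {for u, continuous (crossing_cdf t z)}.
Proof.
move=> u0 ut; have := @continuous_crossing_cdf t z u u0 ut.
rewrite /prop_for /continuous_at -(crossing_cdf_lt z (ltW u0) ut); apply: cvg_trans.
apply: near_eq_cvg; near=> r; rewrite crossing_cdf_lt//.
  by near: r; apply: filterS (lt_nbhsr u0) => v; exact: ltW.
by near: r; exact: lt_nbhsl.
Unshelve. all: by end_near. Qed.

Lemma measurable_density (A : set R) : A `<=` `]0, +oo[ -> measurable A ->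
  measurable_fun A k.
Proof.
move=> A0 mA; suff : measurable_fun (`]0, +oo[%classic : set R) k by exact: measurable_funS.
apply: open_continuous_measurable_fun => [|u]; first exact: interval_open.
by rewrite inE/= in_itv/= andbT => u0; exact: ck.
Qed.

Lemma density_lty (t : R) : 0 < t -> (\int[mu]_(u in `]0%R, t]) (k u)%:E < +oo)%E.
Proof.
move=> t0; rewrite -P_hits//; apply: (le_lt_trans (probability_le1 P _)); last exact: ltry.
by apply: measurable_hits => //; exact: ltW.
Qed.

(** The limit is restated on []0, t[], dropping the null endpoint at which the closed form fails. *)
Lemma cvg_grid_cdf (t z : R) : 0 < t ->
  ((\sum_(j < n.+1) ((\int[mu]_(u in `](t / n.+1%:R * j%:R)%R, (t / n.+1%:R * j.+1%:R)%R])
      (k u)%:E) * (crossing_cdf t z (t / n.+1%:R * j.+1%:R))%:E))%E @[n --> \oo] -->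
  (\int[mu]_(u in `]0%R, t[)
     (k u * gauss_cdf ((z - b u) / Num.sqrt (2 * (t - u))))%:E)%E)%E.
Proof.
move=> t0.
have -> : (\int[mu]_(u in `]0%R, t[)
     (k u * gauss_cdf ((z - b u) / Num.sqrt (2 * (t - u))))%:E =
   \int[mu]_(u in `]0%R, t]) (k u * crossing_cdf t z u)%:E)%E.
  transitivity (\int[mu]_(u in `]0%R, t[) (k u * crossing_cdf t z u)%:E)%E.
    apply: eq_integral => u; rewrite inE/= in_itv/= => /andP[u0 ut].
    by rewrite crossing_cdf_lt// ltW.
  apply: integral_itv_bndo_bndc; apply/measurable_EFinP; apply: measurable_funM.
    by apply: measurable_density => // u; rewrite /= !in_itv/= andbT => /andP[].
  apply: open_continuous_measurable_fun => [|u]; first exact: interval_open.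
  by rewrite inE/= in_itv/= => /andP[u0 ut]; exact: (@continuous_crossing t z u).
apply: cvg_grid_sum => //.
- by apply: measurable_density => // u; rewrite /= !in_itv/= andbT => /andP[].
- by move=> u u0 _; exact: k_ge0.
- exact: density_lty.
- move=> u u0 ut; exact: (@continuous_crossing t z u).
- move=> u u0 ut; rewrite -!lee_fin crossing_cdfE measure_ge0/=.
  by apply: probability_le1; exact: measurable_incr_le.
Qed.

Lemma measurable_crossing (t z : R) :
  measurable_fun `]0, t[ (fun u => k u * gauss_cdf ((z - b u) / Num.sqrt (2 * (t - u)))).
Proof.
apply: measurable_funM.
  by apply: measurable_density => // u; rewrite /= !in_itv/= andbT => /andP[].
apply: open_continuous_measurable_fun => [|u]; first exact: interval_open.
by rewrite inE/= in_itv/= => /andP[u0 ut]; exact: continuous_crossing_cdf.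
Qed.

Lemma cvg_crossing_shift (t : R) (z_ : R^nat) (z : R) : 0 < t -> z_ n @[n --> \oo] --> z ->
  (\int[mu]_(u in `]0%R, t[)
     (k u * gauss_cdf ((z_ n - b u) / Num.sqrt (2 * (t - u))))%:E)%E @[n --> \oo] -->
  (\int[mu]_(u in `]0%R, t[)
     (k u * gauss_cdf ((z - b u) / Num.sqrt (2 * (t - u))))%:E)%E.
Proof.
move=> t0 cz; apply: (@dominated_cvg _ _ _ mu _ _ _ _ (fun u => (k u)%:E)).
- exact: measurable_itv.
- by move=> n; apply/measurable_EFinP; exact: measurable_crossing.
- move=> u; rewrite /= in_itv/= => /andP[u0 ut]; apply: cvg_EFin; first exact: nearW.
  apply: cvgMr.
  have hv : (z_ n - b u) / Num.sqrt (2 * (t - u)) @[n --> \oo] -->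
      (z - b u) / Num.sqrt (2 * (t - u)).
    by apply: cvgMl; apply: cvgB => //; exact: cvg_cst.
  have hg v : {for v, continuous (@gauss_cdf R)}.
    have [d1 _] := is_derive_gauss_cdf v.
    exact/differentiable_continuous/derivable1_diffP.
  exact: (cvg_comp _ (@gauss_cdf R) hv (hg _)).
- by [].
- apply: (@integrableS _ _ _ mu `]0, t]%classic) => //.
    by apply: subset_itvl; rewrite bnd_simp.
  apply/integrableP; split.
    apply/measurable_EFinP.
    by apply: measurable_density => // u; rewrite /= !in_itv/= andbT => /andP[].
  suff -> : (\int[mu]_(u in `]0%R, t]) `|(k u)%:E| = \int[mu]_(u in `]0%R, t]) (k u)%:E)%E.
    exact: density_lty.
  apply: eq_integral => u; rewrite inE/= in_itv/= => /andP[u0 ut].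
  by rewrite ger0_norm ?k_ge0.
- move=> n u; rewrite /= in_itv/= => /andP[u0 ut].
  by rewrite lee_fin normrM !ger0_norm ?k_ge0 ?gauss_cdf_ge0// ler_piMr ?k_ge0 ?gauss_cdf_le1.
Qed.

(* Decomposing {W_t + x <= y} along the value s of the passage time, at which
   the path sits at b s and starts afresh. *)
Lemma first_passage_cdf (t y : R) : 0 < t -> y <= b t ->
  ((gauss_cdf ((y - x) / Num.sqrt (2 * t)))%:E =
  \int[mu]_(u in `]0%R, t[)
     (k u * gauss_cdf ((y - b u) / Num.sqrt (2 * (t - u))))%:E)%E.
Proof.
move=> t0 yb.
have -> : ((gauss_cdf ((y - x) / Num.sqrt (2 * t)))%:E = P [set w | (W t w + x <= y)%R])%E.
  rewrite -[in X in Num.sqrt X](subr0 t) -incr_cdf//; congr (P _).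
  by apply/seteqP; split => w /=; case: hW => -> _ _ _; rewrite subr0 lerBrDr.
set V := fun z => (\int[mu]_(u in `]0%R, t[)
     (k u * gauss_cdf ((z - b u) / Num.sqrt (2 * (t - u))))%:E)%E.
(* With [e] fixed, the grid is refined first, which removes the overshoot probability; only then
   does [e] tend to 0. *)
have cV e : 0 < e -> (P [set w | (W t w + x <= y)%R] <= V (y + e)%R)%E /\
    (V (y - e)%R <= P [set w | (W t w + x <= y)%R])%E.
  move=> e0; have cO := cvg_overshoots t0 e0; split.
    have h1 := cvgeD (fin_num_adde_defl (V (y + e)) (isT : (0 : \bar R)%E \is a fin_num)) (@cvg_grid_cdf t (y + e) t0) cO.
    rewrite -[V _]adde0; apply: (cvge_to_ge (h1 _)).
    by apply: nearW => n; exact: grid_cdf_le.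
  have h1 := cvgeD (fin_num_adde_defl (P [set w | (W t w + x <= y)%R]) (isT : (0 : \bar R)%E \is a fin_num)) (cvg_cst (P [set w | (W t w + x <= y)%R])) cO.
  rewrite -[P _]adde0; apply: (lee_cvg_to (@cvg_grid_cdf t (y - e) t0) (h1 _ _)).
  by apply: nearW => n; exact: grid_cdf_ge.
have cVn (z_ : R^nat) : z_ n @[n --> \oo] --> y -> V (z_ n) @[n --> \oo] --> V y.
  exact: cvg_crossing_shift.
apply/eqP; rewrite eq_le; apply/andP; split.
  apply: (cvge_to_ge (cVn (fun n => y + n.+1%:R^-1) _)).
    by rewrite -[X in _ --> X]addr0; apply: cvgD; [exact: cvg_cst|exact: cvg_harmonic].
  by apply: nearW => n; case: (cV n.+1%:R^-1) => //; rewrite invr_gt0.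
apply: (cvge_to_le (cVn (fun n => y - n.+1%:R^-1) _)).
  by rewrite -[X in _ --> X]subr0; apply: cvgB; [exact: cvg_cst|exact: cvg_harmonic].
by apply: nearW => n; case: (cV n.+1%:R^-1) => //; rewrite invr_gt0.
Qed.

End first_passage_identity.

(** * Gaussian moments of Hermite polynomials *)

Section gaussian_polynomials.
Context (R : realType).
Local Notation mu := (@lebesgue_measure R).
Implicit Types (p q : {poly R}) (n m : nat) (u v A c : R).

Definition gpoly p v : R := p.[v] * expR (- v ^+ 2).

Definition gderiv p : {poly R} := p^`() - ('X *+ 2) * p.

Lemma is_derive_gpoly p v : is_derive v 1 (gpoly p) (gpoly (gderiv p) v).
Proof.
have -> : gpoly p = (horner p) * (expR \o horner (- 'X^2)).
  by apply/funext => u; rewrite fctE /= /gpoly hornerN hornerXn.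
have := is_deriveM (is_derive_poly p v)
  (is_derive1_comp (is_derive_expR (- 'X^2).[v]) (is_derive_poly (- 'X^2) v)).
move=> h; apply: is_derive_eq.
rewrite /= /gpoly /gderiv !(hornerE, derivN, derivXn, hornerXn)/= expr1.
by rewrite -![_ *: _]/(_ * _); ring.
Qed.

Lemma continuous_gpoly p : continuous (gpoly p).
Proof.
move=> v; have [d1 _] := is_derive_gpoly p v.
exact/differentiable_continuous/derivable1_diffP.
Qed.

Lemma exp_monomial_bound n v : `|v| ^+ n <= n`!%:R * expR `|v|.
Proof.
case: n => [|n].
  by rewrite expr0 fact0 mul1r; apply: le_trans (expR_ge1Dx _); rewrite lerDl.
have := @expR_ge1Dxn R `|v| n (normr_ge0 _).
move=> h; rewrite -ler_pdivrMl ?ltr0n ?fact_gt0// mulrC.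
by apply: le_trans h; rewrite lerDr.
Qed.

Lemma exp_poly_bound p : exists2 C : R, 0 <= C &
  forall v, `|p.[v]| <= C * expR `|v|.
Proof.
exists (\sum_(i < size p) `|p`_i| * i`!%:R).
  by apply: sumr_ge0 => i _; rewrite mulr_ge0.
move=> v; rewrite horner_coef mulr_suml; apply: (le_trans (ler_norm_sum _ _ _)).
apply: ler_sum => i _; rewrite normrM normrX -mulrA ler_wpM2l//.
exact: exp_monomial_bound.
Qed.

(* 2 A |v| <= c v^2 + A^2 / c *)
Lemma exp_linear_gauss A c v : 0 < c ->
  expR (A * `|v|) * expR (- (c * v ^+ 2)) <=
  expR (A ^+ 2 / (2 * c)) * expR (- (c / 2 * v ^+ 2)).
Proof.
move=> c0; rewrite -!expRD ler_expR -subr_ge0.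
have -> : A ^+ 2 / (2 * c) + - (c / 2 * v ^+ 2) - (A * `|v| + - (c * v ^+ 2)) =
    (A - c * `|v|) ^+ 2 / (2 * c).
  by rewrite -(real_normK (num_real v)); field; rewrite lt0r_neq0.
by rewrite divr_ge0 ?sqr_ge0// mulr_ge0// ltW.
Qed.

Lemma measurable_gauss_scaled c : measurable_fun setT (fun v : R => expR (- (c * v ^+ 2))).
Proof.
apply: continuous_measurable_fun => v.
apply: (@continuous_comp _ _ _ (fun v => - (c * v ^+ 2)) expR); last exact: continuous_expR.
by apply: cvgN; apply: cvgMr; exact: exprn_continuous.
Qed.

(** After rescaling, sqrt(c) times the integral is the finite Gaussian integral, which rules out
    infinite values. *)
Lemma integrable_gauss_scaled c : 0 < c ->
  mu.-integrable setT (fun v => (expR (- (c * v ^+ 2)))%:E).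
Proof.
move=> c0; apply/integrableP; split.
  by apply/measurable_EFinP; exact: measurable_gauss_scaled.
have s0 : 0 < Num.sqrt c by rewrite sqrtr_gt0.
have mF : measurable_fun setT (fun v : R => (gauss_fun v)%:E).
  by apply/measurable_EFinP; exact: measurable_gauss_fun.
have F0 v : (0 <= (gauss_fun v)%:E :> \bar R)%E by rewrite lee_fin gauss_fun_ge0.
have := ge0_integral_scale s0 mF F0; rewrite integralT_gauss.
have -> : (\int[mu]_v `|(expR (- (c * v ^+ 2)))%:E| =
    \int[mu]_v (gauss_fun (Num.sqrt c * v))%:E)%E.
  apply: eq_integral => v _; rewrite abse_EFin ger0_norm ?expR_ge0//.
  by rewrite /gauss_fun exprMn sqr_sqrtr// ltW.
case: (\int[mu]_v _)%E => [r _|/esym|_]; rewrite ?ltry//.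
by rewrite mulry gtr0_sg// mul1e.
Qed.

Lemma integrable_exp_gauss A c : 0 < c ->
  mu.-integrable setT (fun v => (expR (A * `|v|) * expR (- (c * v ^+ 2)))%:E).
Proof.
move=> c0; apply: (@le_integrable _ _ _ mu _ _ _
    (fun v => (expR (A ^+ 2 / (2 * c)))%:E * (expR (- (c / 2 * v ^+ 2)))%:E)%E) => //.
- apply/measurable_EFinP; apply: measurable_funM; last exact: measurable_gauss_scaled.
  apply: (measurableT_comp (@measurable_expR R)).
  by apply: measurable_funM => //; exact: measurable_normr.
- move=> v _; rewrite lee_fin.
  rewrite (ger0_norm (mulr_ge0 (expR_ge0 _) (expR_ge0 _))).
  rewrite (ger0_norm (mulr_ge0 (expR_ge0 _) (expR_ge0 _))).
  exact: exp_linear_gauss.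
- by apply: integrableZl => //; apply: integrable_gauss_scaled; rewrite divr_gt0.
Qed.

Lemma measurable_horner p : measurable_fun setT (horner p).
Proof. by apply: continuous_measurable_fun; exact: continuous_horner. Qed.

Lemma measurable_gpoly p : measurable_fun setT (gpoly p).
Proof. by apply: continuous_measurable_fun; exact: continuous_gpoly. Qed.

Lemma integrable_gpoly p : mu.-integrable setT (fun v => (gpoly p v)%:E).
Proof.
have [C C0 hC] := exp_poly_bound p.
apply: (@le_integrable _ _ _ mu _ _ _
    (fun v => C%:E * (expR (1 * `|v|) * expR (- (1 * v ^+ 2)))%:E)%E) => //.
- by apply/measurable_EFinP; exact: measurable_gpoly.
- move=> v _; rewrite lee_fin /gpoly normrM !mul1r.
  rewrite (ger0_norm C0) (ger0_norm (mulr_ge0 (expR_ge0 _) (expR_ge0 _))) mulrA.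
  by rewrite normrM (ger0_norm (expR_ge0 _)) ler_pM2r ?expR_gt0.
- by apply: integrableZl => //; exact: integrable_exp_gauss.
Qed.

Lemma gpoly_bounded p : exists2 C : R, 0 <= C & forall v, `|gpoly p v| <= C.
Proof.
have [C C0 hC] := exp_poly_bound p.
exists (C * expR (1 ^+ 2 / (2 * 1))); first by rewrite mulr_ge0 ?expR_ge0.
move=> v; rewrite /gpoly normrM (ger0_norm (expR_ge0 _)).
apply: (@le_trans _ _ (C * (expR (1 * `|v|) * expR (- (1 * v ^+ 2))))).
  by rewrite !mul1r mulrA ler_pM2r ?expR_gt0.
rewrite ler_wpM2l//; apply: (le_trans (exp_linear_gauss 1 v ltr01)).
rewrite ler_piMr ?expR_ge0// -expR0 ler_expR oppr_le0.
by rewrite mulr_ge0 ?sqr_ge0.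
Qed.

(** Boundedness of v p(v) exp(-v^2) yields decay at rate 1/n; the sign [s] serves both ends of the
    line. *)
Lemma cvg_gpoly_infty p (s : R) : `|s| = 1 -> gpoly p (s * n%:R) @[n --> \oo] --> 0.
Proof.
move=> s1; have [C C0 hC] := gpoly_bounded (p * 'X).
rewrite -cvg_shiftS; apply/norm_cvg0P.
apply: (@squeeze_cvgr _ _ _ _ (cst 0) (fun n => C * n.+1%:R^-1)).
- apply: nearW => n; rewrite normr_ge0/= ler_pdivlMr ?ltr0n//.
  have := hC (s * n.+1%:R); rewrite /gpoly hornerM hornerX !normrM s1 mul1r.
  by rewrite (ger0_norm (ler0n _ _)) mulrAC.
- exact: cvg_cst.
- by rewrite -[X in _ --> X](mulr0 C); apply: cvgMr; exact: cvg_harmonic.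
Qed.

Definition gmoment p : R := \int[mu]_v gpoly p v.

Lemma gpolyB p q v : gpoly (p - q) v = gpoly p v - gpoly q v.
Proof. by rewrite /gpoly hornerD hornerN mulrBl. Qed.

Lemma gmomentB p q : gmoment (p - q) = gmoment p - gmoment q.
Proof.
rewrite /gmoment -RintegralB//; [|exact: integrable_gpoly..].
by apply: eq_Rintegral => v _; rewrite gpolyB.
Qed.

Lemma gmomentZ c p : gmoment (c *: p) = c * gmoment p.
Proof.
rewrite /gmoment -RintegralZl//; last exact: integrable_gpoly.
by apply: eq_Rintegral => v _; rewrite /gpoly hornerZ mulrA.
Qed.

Lemma gmoment1 : gmoment 1 = Num.sqrt pi.
Proof.
rewrite /gmoment /Rintegral.
have -> : (\int[mu]_v (gpoly 1 v)%:E = (Num.sqrt pi)%:E)%E; last by [].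
by rewrite -integralT_gauss; apply: eq_integral => v _; rewrite /gpoly hornerC mul1r.
Qed.

(** The integrand is the derivative of [gpoly p], which vanishes at both infinities: the fundamental
    theorem on [-n - 1, n + 1], then dominated convergence. *)
Lemma gmoment_deriv p : gmoment (gderiv p) = 0.
Proof.
have ci n : (\int[mu]_(v in `[(- n.+1%:R)%R, n.+1%:R]) (gpoly (gderiv p) v)%:E =
    (gpoly p n.+1%:R - gpoly p (- n.+1%:R))%:E)%E.
  rewrite EFinB; apply: continuous_FTC2.
  - by rewrite gtrN.
  - by apply: continuous_subspaceT; exact: continuous_gpoly.
  - split.
    + by move=> v _; case: (is_derive_gpoly p v).
    + by apply: cvg_at_right_filter; exact: continuous_gpoly.
    + by apply: cvg_at_left_filter; exact: continuous_gpoly.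
  - by move=> v _; rewrite derive1E; case: (is_derive_gpoly p v).
have h1 : (\int[mu]_v ((gpoly (gderiv p) \_ `[(- n.+1%:R)%R, n.+1%:R]) v)%:E)%E @[n --> \oo] -->
    (\int[mu]_v (gpoly (gderiv p) v)%:E)%E.
  apply: (@dominated_cvg _ _ _ mu _ _ _ _ (fun v => `|(gpoly (gderiv p) v)%:E|)%E).
  - exact: measurableT.
  - move=> n; apply/measurable_EFinP; apply/(measurable_restrictT _ _).1 => //.
    by apply: measurable_funTS; exact: measurable_gpoly.
  - move=> v _; apply: cvg_near_cst.
    have [N vN] : exists N : nat, `|v| < N%:R.
      by exists (Num.truncn `|v|).+1; rewrite truncnS_gt.
    exists N => // n /= Nn; rewrite patchE mem_set//= in_itv/= -ler_norml.
    by rewrite (le_trans (ltW vN))// ler_nat ltnW.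
  - by [].
  - by apply: integrable_abse; exact: integrable_gpoly.
  - move=> n v _; rewrite patchE; case: ifP => // _.
    by rewrite -[point]/(0 : R) abse0.
have h2 : (fun n => \int[mu]_v ((gpoly (gderiv p) \_ `[(- n.+1%:R)%R, n.+1%:R]) v)%:E)%E =
    (fun n => (gpoly p n.+1%:R - gpoly p (- n.+1%:R))%:E).
  apply/funext => n; rewrite -ci [RHS]integral_mkcond; apply: eq_integral => v _.
  by rewrite !patchE; case: ifP.
have h3 : (gpoly p n.+1%:R - gpoly p (- n.+1%:R))%:E @[n --> \oo] --> 0%:E.
  apply: cvg_EFin; first exact: nearW.
  rewrite /comp/= -[X in _ --> X](subrr (0 : R)); apply: cvgB.
    have := @cvg_gpoly_infty p 1 (normr1 _); rewrite -cvg_shiftS.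
    by under eq_fun do rewrite mul1r.
  have := @cvg_gpoly_infty p (-1) (normrN1 _); rewrite -cvg_shiftS.
  by under eq_fun do rewrite mulN1r.
rewrite h2 in h1; rewrite /gmoment /Rintegral.
by rewrite -(cvg_lim (@ereal_hausdorff _) h1) (cvg_lim (@ereal_hausdorff _) h3).
Qed.

(** [- gderiv p] is 2 X p - p', so this is the recurrence H_(n+1) = 2 x H_n - H_n'. *)
Fixpoint hpoly n : {poly R} := if n is m.+1 then - gderiv (hpoly m) else 1.

Lemma hermiteE n v : hermite n v = (hpoly n).[v].
Proof.
have h : derive1n n (fun y : R => expR (- y ^+ 2)) =
    (fun v => (-1) ^+ n * gpoly (hpoly n) v).
  elim: n => [|n IH].
    by apply/funext => u; rewrite /= /gpoly hornerC expr0 !mul1r.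
  apply/funext => u; rewrite derive1nS IH derive1E.
  have d1 := is_derive_gpoly (hpoly n) u.
  have -> : (fun v => (-1) ^+ n * gpoly (hpoly n) v) = (-1) ^+ n \*: gpoly (hpoly n).
    by [].
  rewrite derive_val /= /gpoly hornerN [(-1) ^+ n.+1]exprS.
  by rewrite -[_ *: _]/(_ * _); ring.
rewrite /hermite h /gpoly.
have s1 : (-1) ^+ n * (-1) ^+ n = 1 :> R by rewrite -expr2 sqrr_sign.
have e1 : expR (v ^+ 2) * expR (- v ^+ 2) = 1 by rewrite -expRD subrr expR0.
by rewrite mulrACA s1 mul1r mulrCA e1 mulr1.
Qed.

Lemma gmoment_hpolyS n p : gmoment (hpoly n.+1 * p) = gmoment (hpoly n * p^`()).
Proof.
have -> : hpoly n.+1 * p = hpoly n * p^`() - gderiv (hpoly n * p).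
  by rewrite /= /gderiv derivM; ring.
by rewrite gmomentB gmoment_deriv subr0.
Qed.

(** Integration by parts, [n] times. Orthogonality and the norms follow by differentiating
    polynomials of known degree. *)
Lemma gmoment_hpoly n p : gmoment (hpoly n * p) = gmoment p^`(n).
Proof.
elim: n p => [|n IH] p; first by rewrite mul1r.
by rewrite gmoment_hpolyS IH derivSn.
Qed.

Lemma size_hpoly_coef n : (size (hpoly n) <= n.+1)%N /\ (hpoly n)`_n = 2 ^+ n.
Proof.
elim: n => [|n [IH1 IH2]]; first by rewrite size_poly1 coefC.
split.
  rewrite /= /gderiv size_polyN; apply: (leq_trans (size_polyD _ _)).
  rewrite geq_max size_polyN; apply/andP; split.
    apply: leq_trans (leq_trans IH1 _); last exact: leqnSn.
    exact: leq_trans (size_poly _ _) (leq_pred _).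
  rewrite mulrnAl -scaler_nat; apply: leq_trans (size_scale_leq _ _) _.
  rewrite mulrC; apply: leq_trans (size_polyMleq _ _) _; rewrite size_polyX.
  by rewrite addn2.
rewrite /= /gderiv coefN coefB coef_deriv mulrnAl coefMn coefXM/= IH2.
rewrite nth_default ?mul0rn ?sub0r ?opprK ?exprS ?mulr_natl//.
exact: leq_trans IH1 _.
Qed.

Lemma gmoment_hpoly_lt n p : (size p <= n)%N -> gmoment (hpoly n * p) = 0.
Proof.
move=> pn; rewrite gmoment_hpoly derivn_poly0//.
by rewrite -[0](scale0r 1) gmomentZ mul0r.
Qed.

Lemma gmoment_hpoly_sqr n : gmoment (hpoly n * hpoly n) = 2 ^+ n * n`!%:R * Num.sqrt pi.
Proof.
have [h1 h2] := size_hpoly_coef n.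
rewrite gmoment_hpoly.
have -> : (hpoly n)^`(n) = (2 ^+ n * n`!%:R) *: 1.
  apply/polyP => i; rewrite coef_derivn coefZ coef1.
  case: i => [|i].
    by rewrite addn0 ffactnn h2 mulr1 mulr_natr.
  by rewrite nth_default ?mul0rn ?mulr0// (leq_trans h1)// addnS ltnS leq_addr.
by rewrite gmomentZ gmoment1.
Qed.

Lemma gmoment_hpoly_neq n m : n != m -> gmoment (hpoly n * hpoly m) = 0.
Proof.
wlog mn : n m / (m < n)%N => [h|_].
  rewrite neq_ltn => /orP[] nm; last by apply: h => //; rewrite gtn_eqF.
  by rewrite mulrC h// gtn_eqF.
by apply: gmoment_hpoly_lt; apply: leq_trans mn; case: (size_hpoly_coef m).
Qed.

End gaussian_polynomials.

(** * Density of polynomials in weighted L^2 spaces *)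

Section weighted_square_integral.
Context (R : realType) (w : R -> R).
Local Notation mu := (@lebesgue_measure R).
Hypothesis w_ge0 : forall x, 0 <= w x.
Hypothesis mw : measurable_fun setT w.
Implicit Types (f g h : R -> R) (p q : {poly R}).

(** The square of the weighted norm, infinite values allowed. With no square root taken, (a + c)^2
    <= 2 a^2 + 2 c^2 plays the role of the triangle inequality. *)
Definition sqnorm f : \bar R := (\int[mu]_x (f x ^+ 2 * w x)%:E)%E.

Lemma sqr_weight_ge0 f x : (0 <= (f x ^+ 2 * w x)%:E)%E.
Proof. by rewrite lee_fin mulr_ge0// sqr_ge0. Qed.

Lemma measurable_sqr_weight f : measurable_fun setT f ->
  measurable_fun setT (fun x => (f x ^+ 2 * w x)%:E).
Proof.
by move=> mf; apply/measurable_EFinP; apply: measurable_funM => //; exact: measurable_funX.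
Qed.

Lemma sqnorm_ge0 f : (0 <= sqnorm f)%E.
Proof. by apply: integral_ge0 => x _; exact: sqr_weight_ge0. Qed.

Lemma le_sqnorm f g : measurable_fun setT f -> measurable_fun setT g ->
  (forall x, `|f x| <= `|g x|) -> (sqnorm f <= sqnorm g)%E.
Proof.
move=> mf mg fg; apply: ge0_le_integral => //.
- by move=> x _; exact: sqr_weight_ge0.
- exact: measurable_sqr_weight.
- exact: measurable_sqr_weight.
- move=> x _; rewrite lee_fin ler_wpM2r// -(real_normK (num_real (f x))).
  by rewrite -(real_normK (num_real (g x))) ler_pXn2r ?nnegrE.
Qed.

Lemma sqnormZ (c : R) f : measurable_fun setT f ->
  sqnorm (fun x => c * f x) = ((c ^+ 2)%:E * sqnorm f)%E.
Proof.
move=> mf; rewrite /sqnorm -ge0_integralZl//.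
- by apply: eq_integral => x _; rewrite exprMn -mulrA EFinM.
- exact: measurable_sqr_weight.
- by move=> x _; exact: sqr_weight_ge0.
- by rewrite lee_fin sqr_ge0.
Qed.

Lemma sqnormD f g : measurable_fun setT f -> measurable_fun setT g ->
  (sqnorm (fun x => f x + g x)%R <= 2%:E * sqnorm f + 2%:E * sqnorm g)%E.
Proof.
move=> mf mg; rewrite /sqnorm -!ge0_integralZl//; last 4 first.
- exact: measurable_sqr_weight.
- by move=> x _; exact: sqr_weight_ge0.
- exact: measurable_sqr_weight.
- by move=> x _; exact: sqr_weight_ge0.
rewrite -ge0_integralD//; last 4 first.
- by move=> x _; rewrite mule_ge0// sqr_weight_ge0.
- by apply: measurable_funeM; exact: measurable_sqr_weight.
- by move=> x _; rewrite mule_ge0// sqr_weight_ge0.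
- by apply: measurable_funeM; exact: measurable_sqr_weight.
apply: ge0_le_integral => //.
- by move=> x _; exact: (sqr_weight_ge0 (f \+ g)).
- by apply: (@measurable_sqr_weight (f \+ g)); exact: measurable_funD.
- by apply: emeasurable_funD; apply: measurable_funeM; exact: measurable_sqr_weight.
- move=> x _; rewrite -!EFinM -EFinD lee_fin !mulrA -mulrDl ler_wpM2r//.
  have := sqr_ge0 (f x - g x); set a := f x; set c := g x => h; nra.
Qed.

Lemma cvg_sqnorm (f_ : (R -> R)^nat) f g : measurable_fun setT g ->
  (sqnorm g < +oo)%E -> (forall n, measurable_fun setT (f_ n)) ->
  (forall x, f_ n x @[n --> \oo] --> f x) -> (forall n x, `|f_ n x| <= g x) ->
  sqnorm (fun x => f_ n x - f x) @[n --> \oo] --> 0%E.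
Proof.
move=> mg gfin mf_ cf fg.
have mf : measurable_fun setT f by exact: measurable_fun_cvg (fun x _ => cf x).
have fg' x : `|f x| <= g x.
  by apply: (cvgr_to_le (cvg_norm (cf x))); apply: nearW.
rewrite -(integral0 mu setT).
apply: (@dominated_cvg _ _ _ mu _ _ _ _ (fun x => (4 * (g x ^+ 2 * w x))%:E)) => //.
- by move=> n; apply: (@measurable_sqr_weight (f_ n \- f)); exact: measurable_funB.
- move=> x _; apply: cvg_EFin; first exact: nearW.
  rewrite /comp/= -[X in _ --> X](mul0r (w x)); apply: cvgMl.
  have h : f_ n x - f x @[n --> \oo] --> 0.
    by rewrite -[X in _ --> X](subrr (f x)); apply: cvgB => //; exact: cvg_cst.
  have h2 := cvg_comp _ (fun y : R => y ^+ 2) h (@exprn_continuous _ 2 0).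
  by rewrite expr0n/= in h2; exact: h2.
- under eq_fun do rewrite EFinM.
  apply: integrableZl => //; apply/integrableP; split; first exact: measurable_sqr_weight.
  by under eq_integral do rewrite gee0_abs ?sqr_weight_ge0//.
- move=> n x _; rewrite lee_fin normrM (ger0_norm (w_ge0 x)) mulrA ler_wpM2r//.
  rewrite normrX -[4](_ : 2 ^+ 2 = _); last by rewrite expr2 -natrM.
  rewrite -exprMn ler_pXn2r ?nnegrE//.
    by rewrite mulr_natl mulr2n (le_trans (ler_normB _ _))// lerD.
  by rewrite mulr_ge0// (le_trans _ (fg' x)).
Qed.

End weighted_square_integral.

(** * From polynomials to arbitrary square integrable functions *)

Section polynomial_density.
Context (R : realType) (w : R -> R).
Local Notation mu := (@lebesgue_measure R).
Hypothesis w_ge0 : forall x, 0 <= w x.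
Hypothesis mw : measurable_fun setT w.
Hypothesis expw : forall A : R, (\int[mu]_x (expR (A * `|x|) * w x)%:E < +oo)%E.
Implicit Types (f g h : R -> R) (p q : {poly R}).

Local Notation N := (sqnorm w).

Definition poly_approximable f := forall e : R, 0 < e ->
  exists p : {poly R}, (N (fun x => f x - p.[x])%R <= e%:E)%E.

Lemma sqnorm_exp_lty (C A B : R) : (N (fun x => C * expR (A * `|x| + B))%R < +oo)%E.
Proof.
have -> : N (fun x => C * expR (A * `|x| + B)) =
    (\int[mu]_x ((C ^+ 2 * expR (2 * B))%:E * (expR ((2 * A) * `|x|) * w x)%:E))%E.
  apply: eq_integral => x _; rewrite -EFinM mulrA exprMn; congr (_ * _)%:E.
  rewrite -(mulrA (C ^+ 2)); congr (_ * _); rewrite expr2 -!expRD; congr expR; ring.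
rewrite ge0_integralZl//.
- by rewrite lte_mul_pinfty// lee_fin mulr_ge0 ?sqr_ge0 ?expR_ge0.
- apply/measurable_EFinP; apply: measurable_funM => //.
  apply: (measurableT_comp (@measurable_expR R)).
  by apply: measurable_funM => //; exact: measurable_normr.
- by move=> x _; rewrite lee_fin mulr_ge0 ?expR_ge0.
- by rewrite lee_fin mulr_ge0 ?sqr_ge0 ?expR_ge0.
Qed.

Lemma measurable_exp_abs (C A B : R) :
  measurable_fun setT (fun x : R => C * expR (A * `|x| + B)).
Proof.
apply: measurable_funM => //; apply: (measurableT_comp (@measurable_expR R)).
apply: measurable_funD => //; apply: measurable_funM => //; exact: measurable_normr.
Qed.

Lemma poly_approximable_closed f : measurable_fun setT f ->
  (forall e : R, 0 < e -> exists g, [/\ measurable_fun setT g,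
     poly_approximable g & (N (fun x => f x - g x)%R <= e%:E)%E]) ->
  poly_approximable f.
Proof.
(* Two errors of e / 4, each doubled by [sqnormD], add up to [e]. *)
move=> mf hf e e0; have e40 : 0 < e / 4 by rewrite divr_gt0.
have [g [mg ag fg]] := hf _ e40; have [p gp] := ag _ e40; exists p.
have -> : (fun x => f x - p.[x]) = (fun x => (f x - g x) + (g x - p.[x])).
  by apply/funext => x; rewrite addrA subrK.
apply: (le_trans (sqnormD w_ge0 mw _ _)).
- exact: measurable_funB.
- by apply: measurable_funB => //; exact: measurable_horner.
have -> : e%:E = (2%:E * (e / 4)%:E + 2%:E * (e / 4)%:E)%E.
  by rewrite -!EFinM -EFinD; congr EFin; field.
by apply: leeD; apply: lee_wpmul2l.
Qed.

Lemma poly_approximable_lim (f_ : (R -> R)^nat) f : measurable_fun setT f ->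
  (forall n, measurable_fun setT (f_ n)) -> (forall n, poly_approximable (f_ n)) ->
  N (fun x => f_ n x - f x)%R @[n --> \oo] --> 0%E -> poly_approximable f.
Proof.
move=> mf mf_ af_ cf; apply: poly_approximable_closed => // e e0.
have [n _ /(_ n (leqnn n))/= hn] : \forall n \near \oo, (N (fun x => f_ n x - f x)%R <= e%:E)%E.
  have o : open_nbhs 0%E [set y : \bar R | (y < e%:E)%E].
    by split; [exact: open_ereal_lt_ereal|rewrite /= lte_fin].
  have : \forall n \near \oo, (N (fun x => f_ n x - f x)%R < e%:E)%E.
    exact: (cf _ (open_nbhs_nbhs o)).
  by apply: filterS => n; exact: ltW.
exists (f_ n); split => //; apply: le_trans hn; apply: le_sqnorm => //.
- exact: measurable_funB.
- exact: measurable_funB.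
- by move=> x; rewrite distrC.
Qed.

Lemma poly_approximableD f g : measurable_fun setT f -> measurable_fun setT g ->
  poly_approximable f -> poly_approximable g -> poly_approximable (fun x => f x + g x).
Proof.
move=> mf mg af ag e e0; have e40 : 0 < e / 4 by rewrite divr_gt0.
have [p fp] := af _ e40; have [q gq] := ag _ e40; exists (p + q).
have -> : (fun x => f x + g x - (p + q).[x]) = (fun x => (f x - p.[x]) + (g x - q.[x])).
  by apply/funext => x; rewrite hornerD opprD addrACA.
apply: (le_trans (sqnormD w_ge0 mw _ _)).
- by apply: measurable_funB => //; exact: measurable_horner.
- by apply: measurable_funB => //; exact: measurable_horner.
have -> : e%:E = (2%:E * (e / 4)%:E + 2%:E * (e / 4)%:E)%E.
  by rewrite -!EFinM -EFinD; congr EFin; field.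
by apply: leeD; apply: lee_wpmul2l.
Qed.

Lemma poly_approximableZ (c : R) f : measurable_fun setT f ->
  poly_approximable f -> poly_approximable (fun x => c * f x).
Proof.
(* The added 1 keeps the divisor positive when c = 0. *)
move=> mf af e e0; have c1 : 0 < c ^+ 2 + 1 by rewrite ltr_wpDl ?sqr_ge0.
have [p fp] := af _ (divr_gt0 e0 c1); exists (c *: p).
have -> : (fun x => c * f x - (c *: p).[x]) = (fun x => c * (f x - p.[x])).
  by apply/funext => x; rewrite hornerZ mulrBr.
rewrite (sqnormZ w_ge0 mw); last by apply: measurable_funB => //; exact: measurable_horner.
apply: (@le_trans _ _ ((c ^+ 2)%:E * (e / (c ^+ 2 + 1))%:E)%E).
  by apply: lee_wpmul2l => //; rewrite lee_fin sqr_ge0.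
rewrite -EFinM lee_fin mulrCA ger_pMr// ler_pdivrMr// mul1r lerDl//.
Qed.

Lemma poly_approximable_horner p : poly_approximable (horner p).
Proof.
move=> e e0; exists p; have -> : (fun x => p.[x] - p.[x]) = cst 0.
  by apply/funext => x; rewrite subrr.
by rewrite /sqnorm integral0_eq ?lee_fin ?ltW// => x _; rewrite expr0n mul0r.
Qed.

(* The bounded functions that map polynomials into their closure form an algebra
   stable under bounded pointwise limits; it contains the sines, hence the
   indicators of half-lines, hence every bounded measurable function. *)
Definition poly_multiplier f := [/\ measurable_fun setT f,
  exists K : R, forall x, `|f x| <= K &
  forall p, poly_approximable (fun x => f x * p.[x])].

(** Since |p(x)| <= C exp(|x|), the products are dominated by K C exp(|x|), whose square has a
    finite integral for a weight with exponential moments. *)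
Lemma poly_multiplier_lim (f_ : (R -> R)^nat) f (K : R) :
  (forall n, poly_multiplier (f_ n)) -> (forall n x, `|f_ n x| <= K) ->
  (forall x, f_ n x @[n --> \oo] --> f x) -> poly_multiplier f.
Proof.
move=> mf_ fK cf; have mf : measurable_fun setT f.
  by apply: (measurable_fun_cvg (h := f_)) => [n|x _]; [case: (mf_ n)|exact: cf].
split => //.
  by exists K => x; apply: (cvgr_to_le (cvg_norm (cf x))); apply: nearW.
move=> p; have [C C0 hC] := exp_poly_bound p.
have mfp g : measurable_fun setT g -> measurable_fun setT (fun x => g x * p.[x]).
  by move=> mg; apply: measurable_funM => //; exact: measurable_horner.
apply: (@poly_approximable_lim (fun n x => f_ n x * p.[x])).
- exact: mfp.
- by move=> n; apply: mfp; case: (mf_ n).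
- by move=> n; case: (mf_ n).
apply: (@cvg_sqnorm _ w w_ge0 mw _ _ (fun x => (K * C) * expR (1 * `|x| + 0))).
- exact: measurable_exp_abs.
- exact: sqnorm_exp_lty.
- by move=> n; apply: mfp; case: (mf_ n).
- by move=> x; apply: cvgMl; exact: cf.
- move=> n x; rewrite normrM mul1r addr0 -mulrA.
  by apply: ler_pM.
Qed.

(** First g p is replaced by a polynomial q, at a cost controlled by the bound on [f]; then f q is
    approximable because [f] is a multiplier. Approximability alone would not survive products. *)
Lemma poly_multiplierM f g :
  poly_multiplier f -> poly_multiplier g -> poly_multiplier (fun x => f x * g x).
Proof.
move=> [mf [K hK] af] [mg [L hL] ag]; split; first exact: measurable_funM.
  by exists (K * L) => x; rewrite normrM ler_pM.
move=> p; apply: poly_approximable_closed.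
  by apply: measurable_funM; [exact: measurable_funM|exact: measurable_horner].
move=> e e0; have K1 : 0 < K ^+ 2 + 1 by rewrite ltr_wpDl ?sqr_ge0.
have [q gq] := ag p _ (divr_gt0 e0 K1).
have K0 : 0 <= K by exact: le_trans (hK 0).
exists (fun x => f x * q.[x]); split => //.
  by apply: measurable_funM => //; exact: measurable_horner.
have mD : measurable_fun setT (fun x => g x * p.[x] - q.[x]).
  apply: measurable_funB; last exact: measurable_horner.
  by apply: measurable_funM => //; exact: measurable_horner.
apply: (@le_trans _ _ (N (fun x => K * (g x * p.[x] - q.[x])))).
  apply: le_sqnorm => //.
  - apply: measurable_funB; apply: measurable_funM => //; last exact: measurable_horner.
    exact: measurable_funM.
    exact: measurable_horner.
  - exact: measurable_funM.
  - by move=> x; rewrite -mulrA -mulrBr !normrM ler_wpM2r// (ger0_norm K0).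
rewrite (sqnormZ w_ge0 mw)//.
apply: (@le_trans _ _ ((K ^+ 2)%:E * (e / (K ^+ 2 + 1))%:E)%E).
  by apply: lee_wpmul2l => //; rewrite lee_fin sqr_ge0.
by rewrite -EFinM lee_fin mulrCA ger_pMr// ler_pdivrMr// mul1r lerDl.
Qed.

Lemma poly_multiplierD f g :
  poly_multiplier f -> poly_multiplier g -> poly_multiplier (fun x => f x + g x).
Proof.
move=> [mf [K hK] af] [mg [L hL] ag]; split; first exact: measurable_funD.
  by exists (K + L) => x; rewrite (le_trans (ler_normD _ _))// lerD.
move=> p; have -> : (fun x => (f x + g x) * p.[x]) = (fun x => f x * p.[x] + g x * p.[x]).
  by apply/funext => x; rewrite mulrDl.
by apply: poly_approximableD => //; apply: measurable_funM => //; exact: measurable_horner.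
Qed.

Lemma poly_multiplier_cst (c : R) : poly_multiplier (cst c).
Proof.
split; [exact: measurable_cst|by exists (Num.norm c)|move=> p].
have -> : (fun x => cst c x * p.[x]) = horner (c *: p).
  by apply/funext => x; rewrite hornerZ.
exact: poly_approximable_horner.
Qed.

Lemma poly_multiplierX f n : poly_multiplier f -> poly_multiplier (fun x => f x ^+ n).
Proof.
move=> af; elim: n => [|n IH]; first exact: poly_multiplier_cst.
have -> : (fun x => f x ^+ n.+1) = (fun x => f x * f x ^+ n).
  by apply/funext => x; rewrite exprS.
exact: poly_multiplierM.
Qed.

Lemma poly_multiplier1B f : poly_multiplier f -> poly_multiplier (fun x => 1 - f x).
Proof.
move=> af.
have -> : (fun x => 1 - f x) = (fun x => cst 1 x + cst (-1) x * f x).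
  by apply/funext => x; rewrite /= mulN1r.
apply: poly_multiplierD; first exact: poly_multiplier_cst.
by apply: poly_multiplierM => //; exact: poly_multiplier_cst.
Qed.

(** The Taylor partial sums are polynomials in [x], dominated by exp(|a| |x - c|). Exponential
    moments for every rate are what this domination needs. *)
Lemma poly_multiplier_sin (a c : R) : poly_multiplier (fun x => sin (a * (x - c))).
Proof.
split.
- apply: continuous_measurable_fun => x.
  apply: (@continuous_comp _ _ _ (fun x : R => a * (x - c)) (@sin R)); last exact: continuous_sin.
  by apply: cvgMr; apply: cvgB; [exact: cvg_id|exact: cvg_cst].
- by exists 1 => x; exact: sin_max.
move=> p; have [C C0 hC] := exp_poly_bound p.
pose S n y : R := series (sin_coeff y) n.
have SE n : exists q, forall x, q.[x] = S n (a * (x - c)).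
  exists (\sum_(0 <= i < n) (((odd i)%:R * (-1) ^+ i.-1./2) / i`!%:R) *: (a *: ('X - c%:P)) ^+ i).
  move=> x; rewrite horner_sum; apply: eq_bigr => i _.
  rewrite /sin_coeff hornerZ horner_exp hornerZ hornerXsubC /=.
  by rewrite mulrAC.
have cS y : S n y @[n --> \oo] --> sin y.
  by rewrite unlock; exact: is_cvg_series_sin_coeff.
have bS n y : `|S n y| <= expR `|y|.
  apply: (@le_trans _ _ (series (exp_coeff `|y|) n)); last first.
    apply: nondecreasing_cvgn_le; last exact: is_cvg_series_exp_coeff.
    apply/nondecreasing_seqP => m; rewrite /series/= big_nat_recr//= lerDl.
    exact: exp_coeff_ge0.
  rewrite /S /series/=; apply: (le_trans (ler_norm_sum _ _ _)).
  apply: ler_sum => i _; rewrite /sin_coeff /exp_coeff/= !normrM normfV normrX.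
  rewrite (ger0_norm (ler0n _ i`!)) ler_wpM2r ?invr_ge0 ?ler0n//.
  rewrite normrN1 expr1n mulr1 normrX ler_piMl ?exprn_ge0//.
  by case: (odd i); rewrite ?normr1 ?normr0.
have mS n : measurable_fun setT (fun x : R => S n (a * (x - c))).
  have [q qE] := SE n; rewrite (_ : (fun x => _) = horner q); first exact: measurable_horner.
  by apply/funext => x; rewrite qE.
have msin : measurable_fun setT (fun x : R => sin (a * (x - c))).
  by apply: (measurable_fun_cvg (h := fun n (x : R) => S n (a * (x - c)))) => // x _.
apply: (@poly_approximable_lim (fun n (x : R) => S n (a * (x - c)) * p.[x])).
- by apply: measurable_funM => //; exact: measurable_horner.
- by move=> n; apply: measurable_funM => //; exact: measurable_horner.
- move=> n; have [q qE] := SE n.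
  rewrite (_ : (fun x => _) = horner (q * p)); first exact: poly_approximable_horner.
  by apply/funext => x; rewrite hornerM qE.
apply: (@cvg_sqnorm _ w w_ge0 mw _ _ (fun x => C * expR ((`|a| + 1) * `|x| + `|a| * `|c|))).
- exact: measurable_exp_abs.
- exact: sqnorm_exp_lty.
- by move=> n; apply: measurable_funM => //; exact: measurable_horner.
- by move=> x; apply: cvgMl; exact: cS.
- move=> n x; rewrite normrM [leRHS](_ : _ = expR (`|a| * (`|x| + `|c|)) * (C * expR `|x|)).
    apply: ler_pM => //; apply: (le_trans (bS _ _)); rewrite ler_expR normrM.
    by rewrite ler_wpM2l// ler_normB.
  by rewrite mulrCA -expRD; congr (_ * expR _); ring.
Qed.

(* The exponents n * 2 ^ n rather than 2 ^ n settle the limit at u = 1/2. *)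
Lemma cvg_threshold (u : R) : 0 <= u <= 1 ->
  (1 - u ^+ n) ^+ (n * 2 ^ n) @[n --> \oo] --> (if u < 1/2 then 1 else 0 : R).
Proof.
move=> /andP[u0 u1].
have un0 n : 0 <= u ^+ n by rewrite exprn_ge0.
have un1 n : u ^+ n <= 1 by rewrite exprn_ile1.
(* Bernoulli's inequality, applied below with y = -u^n, y = u^n and y = 1/s - 1. *)
have bern (y : R) m : -1 <= y -> 1 + m%:R * y <= (1 + y) ^+ m.
  move=> y1; elim: m => [|m IH]; first by rewrite mul0r addr0 expr0.
  rewrite exprS; apply: (@le_trans _ _ ((1 + y) * (1 + m%:R * y))); last first.
    by rewrite ler_wpM2l//; lra.
  rewrite -natr1; have : 0 <= m%:R * (y * y) by rewrite mulr_ge0 ?ler0n// -expr2 sqr_ge0.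
  set M := m%:R; move=> h; nra.
case: ifPn => [uh|]; last rewrite -leNgt => uh.
- apply: (@squeeze_cvgr _ _ _ _ (fun n => 1 - n%:R * (2 * u) ^+ n) (cst 1)); last exact: cvg_cst.
    apply: nearW => n; apply/andP; split; last first.
      by apply: exprn_ile1; rewrite ?subr_ge0 ?un1// gerBl.
    have := bern (- u ^+ n) (n * 2 ^ n)%N; rewrite lerN2 => /(_ (un1 n)).
    by rewrite natrM natrX mulrN exprMn mulrA.
  have [|u00] := eqVneq u 0.
    move=> ->; rewrite mulr0; apply: cvg_near_cst; exists 1%N => // n /= n0.
    by rewrite expr0n gtn_eqF// mulr0 subr0.
  have up : 0 < 2 * u by rewrite mulr_gt0// lt0r u00.
  (* To see that n (2 u)^n tends to 0, write 2 u = s^2: n s^n is bounded by Bernoulli, and the other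
     factor s^n tends to 0. *)
  pose s := Num.sqrt (2 * u); have s0 : 0 < s by rewrite sqrtr_gt0.
  have s1 : s < 1 by rewrite -sqrtr1 ltr_sqrt//; lra.
  have sE : 2 * u = s * s by rewrite -expr2 sqr_sqrtr// ltW.
  pose D := s^-1 - 1; have D0 : 0 < D by rewrite subr_gt0 invf_gt1.
  have ns n : n%:R * s ^+ n <= D^-1.
    have := bern D n; rewrite (le_trans _ (ltW D0)) ?lerN10// => /(_ isT).
    have -> : 1 + D = s^-1 by rewrite /D addrC subrK.
    rewrite exprVn => h.
    have h2 : n%:R * D <= (s ^+ n)^-1 by rewrite (le_trans _ h)// lerDr.
    rewrite -(ler_pM2r D0) mulVf ?gt_eqF// mulrAC.
    have sn0 : 0 < s ^+ n by rewrite exprn_gt0.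
    by rewrite -ler_pdivlMr// mul1r.
  rewrite -[X in _ --> X]subr0; apply: cvgB; first exact: cvg_cst.
  apply: (@squeeze_cvgr _ _ _ _ (cst 0) (fun n => D^-1 * s ^+ n)).
  - apply: nearW => n; rewrite mulr_ge0 ?exprn_ge0 ?(ltW up)//=.
    by rewrite sE exprMn mulrA ler_wpM2r// exprn_ge0// ltW.
  - exact: cvg_cst.
  - rewrite -[X in _ --> X](mulr0 D^-1); apply: cvgMr; apply: cvg_expr.
    by rewrite ger0_norm// ltW.
(* Multiplying by (1 + u^n)^k keeps the power below 1, while (1 + u^n)^k >= 1 + n (2 u)^n >= n + 1
   because 2 u >= 1. *)
- apply: (@squeeze_cvgr _ _ _ _ (cst 0) (fun n => n.+1%:R^-1)).
  + apply: nearW => n; rewrite exprn_ge0 ?subr_ge0//=.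
    set k := (n * 2 ^ n)%N.
    have h1 : (1 - u ^+ n) ^+ k * (1 + u ^+ n) ^+ k <= 1.
      rewrite -exprMn; apply: exprn_ile1; have := un0 n; have := un1 n; set y := u ^+ n; nra.
    have h2 : n.+1%:R <= (1 + u ^+ n) ^+ k.
      apply: (@le_trans _ _ (1 + k%:R * u ^+ n)); last first.
        by apply: bern; rewrite (le_trans _ (un0 n))// lerN10.
      rewrite -natr1 addrC lerD2l natrM natrX -mulrA -exprMn ler_peMr ?ler0n//.
      by rewrite exprn_ege1//; lra.
    rewrite -[leRHS]mul1r ler_pdivlMr ?ltr0n//; apply: le_trans h1.
    by rewrite ler_wpM2l// exprn_ge0// subr_ge0.
  + exact: cvg_cst.
  + exact: cvg_harmonic.
Qed.

Lemma poly_multiplier_threshold f : poly_multiplier f ->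
  (forall x, 0 <= f x <= 1) -> poly_multiplier (fun x => if f x < 1/2 then 1 else 0).
Proof.
move=> af f01.
apply: (@poly_multiplier_lim (fun n x => (1 - f x ^+ n) ^+ (n * 2 ^ n)) _ 1).
- by move=> n; apply: poly_multiplierX; apply: poly_multiplier1B; exact: poly_multiplierX.
- move=> n x; have /andP[f0 f1] := f01 x.
  have g0 : 0 <= 1 - f x ^+ n by rewrite subr_ge0 exprn_ile1.
  by rewrite ger0_norm ?exprn_ge0// exprn_ile1// gerBl exprn_ge0.
- by move=> x; exact: cvg_threshold.
Qed.

(** The sine of (x - c) / (n + 1) has the sign of x - c once |x - c| < (n + 1) pi, so thresholding
    (1 + sin) / 2 at 1/2 gives the indicator in the limit. At x = c the value is exactly 1/2, which
    the strict threshold rejects, as the open ray demands. *)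
Lemma poly_multiplier_ray (c : R) : poly_multiplier \1_(`]-oo, c[).
Proof.
pose f n x := (1 + sin (n.+1%:R^-1 * (x - c))) / 2.
have af n : poly_multiplier (f n).
  have -> : f n = (fun x => cst (2^-1) x + cst (2^-1) x * sin (n.+1%:R^-1 * (x - c))).
    by apply/funext => x; rewrite /f /= mulrDl mul1r mulrC.
  apply: poly_multiplierD; first exact: poly_multiplier_cst.
  by apply: poly_multiplierM; [exact: poly_multiplier_cst|exact: poly_multiplier_sin].
have f01 n x : 0 <= f n x <= 1.
  have := sin_max (n.+1%:R^-1 * (x - c)); rewrite ler_norml /f => /andP[h1 h2].
  by apply/andP; split; lra.
apply: (@poly_multiplier_lim (fun n x => if f n x < 1/2 then 1 else 0) _ 1).
- by move=> n; exact: poly_multiplier_threshold.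
- by move=> n x; case: ifP => _; rewrite ?normr1 ?normr0.
move=> x; apply: cvg_near_cst.
have [M Mx] : exists M : nat, `|x - c| < M%:R * pi.
  exists (Num.truncn (`|x - c| / pi)).+1.
  by rewrite -ltr_pdivrMr ?pi_gt0// truncnS_gt.
exists M => // n /= Mn.
have n0 : 0 < n.+1%:R :> R by [].
have small : `|n.+1%:R^-1 * (x - c)| < pi.
  rewrite normrM ger0_norm ?invr_ge0 ?ler0n// mulrC ltr_pdivrMr// mulrC.
  by rewrite (lt_le_trans Mx)// ler_pM2r ?pi_gt0// ler_nat ltnW.
rewrite indicE; have -> : (x \in `]-oo, c[%classic) = (x < c).
  by apply/idP/idP; rewrite inE/= in_itv.
rewrite /f; move: small; rewrite ltr_norml => /andP[s1 s2].
have [xc|cx] := ltP x c.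
  have : 0 < sin (- (n.+1%:R^-1 * (x - c))).
    apply: sin_gt0_pi; rewrite oppr_gt0 ltrNl s1 andbT.
    by rewrite pmulr_rlt0 ?invr_gt0// subr_lt0.
  by rewrite sinN => h; rewrite ifT//; lra.
have : 0 <= sin (n.+1%:R^-1 * (x - c)).
  by apply: sin_ge0_pi; rewrite (ltW s2) andbT mulr_ge0 ?invr_ge0 ?ler0n// subr_ge0.
by move=> h; rewrite ifF//; apply/negbTE; rewrite -leNgt; lra.
Qed.

(** The pi-lambda argument again: open left rays are stable under intersection and generate the
    Borel sets. *)
Lemma poly_multiplier_indic (A : set R) : measurable A -> poly_multiplier \1_A.
Proof.
rewrite (_ : measurable = <<s (@RGenInftyO.G R) >>); last exact: RGenInftyO.measurableE.
move: A; apply: lambda_system_subset => //.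
- move=> _ _ [x ->] [y ->]; exists (Num.min x y).
  by apply/seteqP; split => z /=; rewrite !in_itv/= lt_min; [move=> [-> ->]|move=> /andP[]].
- split => //.
  + have -> : \1_[set: R] = cst (1 : R) by apply/funext => x; rewrite indicE in_setT.
    exact: poly_multiplier_cst.
  + move=> A B BA aA aB.
    have -> : \1_(A `\` B) = (fun x => \1_A x * (1 - \1_B x)) :> (R -> R).
      apply/funext => x; rewrite !indicE in_setD.
      by case: (x \in A); case: (x \in B); rewrite /= ?subr0 ?subrr ?mulr1 ?mul0r ?mulr0.
    by apply: poly_multiplierM => //; exact: poly_multiplier1B.
  + move=> F ndF aF; apply: (@poly_multiplier_lim (fun n => \1_(F n)) _ 1) => //.
      by move=> n x; rewrite indicE; case: (x \in _); rewrite ?normr1 ?normr0.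
    move=> x; apply: cvg_near_cst; rewrite indicE.
    have [xF|xF] := pselect ((\bigcup_k F k) x).
      have [m _ Fm] := xF; exists m => // n /= mn.
      by rewrite indicE !mem_set//; have /subsetPset := ndF _ _ mn; exact.
    by apply: nearW => n; rewrite indicE !memNset// => Fn; apply: xF; exists n.
- by move=> _ [x ->]; exact: poly_multiplier_ray.
Qed.

Import HBNNSimple.

Lemma poly_multiplier_simple (h : {nnsfun R >-> R}) : poly_multiplier h.
Proof.
pose s : seq R := finmap.enum_fset (fset_set (range h)).
have hs n : poly_multiplier (fun x => \sum_(i < n) (s`_i * \1_(h @^-1` [set s`_i]) x)).
  elim: n => [|n IH].
    have -> : (fun x => \sum_(i < 0) (s`_i * \1_(h @^-1` [set s`_i]) x)) = cst 0.
      by apply/funext => x; rewrite big_ord0.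
    exact: poly_multiplier_cst.
  have -> : (fun x => \sum_(i < n.+1) (s`_i * \1_(h @^-1` [set s`_i]) x)) =
    (fun x => \sum_(i < n) (s`_i * \1_(h @^-1` [set s`_i]) x) +
      cst s`_n x * \1_(h @^-1` [set s`_n]) x).
    by apply/funext => x; rewrite big_ord_recr.
  apply: poly_multiplierD => //; apply: poly_multiplierM; first exact: poly_multiplier_cst.
  by apply: poly_multiplier_indic; exact: measurable_sfunP.
rewrite (_ : (h : R -> R) = (fun x => \sum_(i < size s) (s`_i * \1_(h @^-1` [set s`_i]) x))).
  exact: hs.
by apply/funext => x; rewrite fimfunEord.
Qed.

(** Simple functions increase to [f], so [f] itself is the dominating function. *)
Lemma poly_approximable_ge0 f : measurable_fun setT f -> (forall x, 0 <= f x) ->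
  (N f < +oo)%E -> poly_approximable f.
Proof.
move=> mf f0 ffin.
have mEf : measurable_fun [set: R] (EFin \o f) by exact/measurable_EFinP.
pose h := nnsfun_approx measurableT mEf.
have ch x : h n x @[n --> \oo] --> f x.
  have /(_ x I) := @cvg_nnsfun_approx _ _ _ _ measurableT _ mEf (fun x _ => f0 x).
  by move=> /fine_cvgP[].
have hf n x : `|h n x| <= f x.
  rewrite ger0_norm// -(cvg_lim (@Rhausdorff R) (ch x)).
  apply: (@nondecreasing_cvgn_le _ (fun n => h n x)); last by apply/cvg_ex; exists (f x).
  by move=> i j ij; have /lefP := nd_nnsfun_approx measurableT mEf ij; exact.
apply: (@poly_approximable_lim (fun n => h n)) => //.
- move=> n; have [_ _ /(_ 1)] := poly_multiplier_simple (h n).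
  by under eq_fun do rewrite hornerC mulr1.
- exact: (cvg_sqnorm w_ge0 mw mf ffin _ ch hf).
Qed.

Lemma poly_dense f : measurable_fun setT f -> (N f < +oo)%E -> poly_approximable f.
Proof.
move=> mf ffin.
have mp : measurable_fun setT f^\+ by exact: measurable_funrpos.
have mn : measurable_fun setT f^\- by exact: measurable_funrneg.
have -> : f = (fun x => f^\+ x + -1 * f^\- x).
  by apply/funext => x; rewrite mulN1r -{1}(funrposBneg f).
apply: poly_approximableD => //.
- exact: measurable_funM.
- apply: poly_approximable_ge0 => //.
  apply: le_lt_trans ffin; apply: le_sqnorm => // x.
  rewrite /funrpos ger0_norm ?le_max ?lexx ?orbT// ge_max normr_ge0 andbT.
  exact: ler_norm.
- apply: poly_approximableZ => //; apply: poly_approximable_ge0 => //.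
  apply: le_lt_trans ffin; apply: le_sqnorm => // x.
  rewrite /funrneg ger0_norm ?le_max ?lexx ?orbT// ge_max normr_ge0 andbT.
  by rewrite -normrN ler_norm.
Qed.

End polynomial_density.

(** * Hermite expansions *)

Section hermite_expansions.
Context (R : realType).
Local Notation mu := (@lebesgue_measure R).
Implicit Types (p q : {poly R}).

Lemma ge0_integrable (f : R -> R) : measurable_fun setT f -> (forall x, 0 <= f x) ->
  (\int[mu]_x (f x)%:E < +oo)%E -> mu.-integrable setT (fun x => (f x)%:E).
Proof.
move=> mf f0 ffin; apply/integrableP; split; first exact/measurable_EFinP.
by under eq_integral do rewrite gee0_abs ?lee_fin//.
Qed.

(* Test the sign of phi against polynomials in L^2 with weight |phi|. *)
Lemma vanishing_moments (phi : R -> R) : measurable_fun setT phi ->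
  (forall A : R, (\int[mu]_x (expR (A * `|x|) * `|phi x|)%:E < +oo)%E) ->
  (forall p, \int[mu]_x (p.[x] * phi x) = 0) ->
  (\int[mu]_x `|phi x|%:E = 0)%E.
Proof.
move=> mphi ephi phi0; pose w x := `|phi x|.
have w0 x : 0 <= w x by exact: normr_ge0.
have mw : measurable_fun setT w by exact: measurableT_comp.
have wfin : (\int[mu]_x (w x)%:E < +oo)%E.
  have := ephi 0; congr (_ < _)%E.
  by apply: eq_integral => x _; rewrite mul0r expR0 mul1r.
pose s x : R := Num.sg (phi x).
have ms : measurable_fun setT s.
  have -> : s = (fun x => \1_(phi @^-1` `]0, +oo[) x - \1_(phi @^-1` `]-oo, 0[) x).
    apply/funext => x; rewrite /s !indicE.
    have -> : (x \in phi @^-1` `]0, +oo[) = (0 < phi x).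
      by apply/idP/idP; rewrite inE/= in_itv/= andbT.
    have -> : (x \in phi @^-1` `]-oo, 0[) = (phi x < 0).
      by apply/idP/idP; rewrite inE/= in_itv.
    by case: sgrP => _ //=; rewrite ?subr0 ?sub0r.
  apply: measurable_funB; apply: measurable_indic.
    by rewrite -[X in measurable X]setTI; exact: mphi.
  by rewrite -[X in measurable X]setTI; exact: mphi.
have sw x : s x * w x = phi x by rewrite /s /w mulr_sg_norm.
(* Where [phi] vanishes the sign is 0 rather than 1 or -1, but so is the weight. *)
have ssw x : s x ^+ 2 * w x = w x by rewrite expr2 -mulrA sw /s /w -normrEsg.
have sfin : (sqnorm w s < +oo)%E.
  by move: wfin; congr (_ < _)%E; apply: eq_integral => x _; rewrite ssw.
apply/eqP; rewrite eq_le integral_ge0 ?andbT => [|x _]; last by rewrite lee_fin.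
apply/lee_addgt0Pr => e e0; rewrite add0e.
have [p hp] := poly_dense w0 mw ephi ms sfin e0.
have iw : mu.-integrable setT (fun x => (w x)%:E).
  apply/integrableP; split; first exact/measurable_EFinP.
  by under eq_integral do rewrite gee0_abs ?lee_fin//.
have ip : mu.-integrable setT (fun x => (p.[x] * phi x)%:E).
  have [C C0 hC] := exp_poly_bound p.
  apply: (@le_integrable _ _ _ mu _ _ _ (fun x => C%:E * (expR (1 * `|x|) * w x)%:E)%E) => //.
  - by apply/measurable_EFinP; apply: measurable_funM => //; exact: measurable_horner.
  - move=> x _; rewrite lee_fin !normrM (ger0_norm C0) (ger0_norm (expR_ge0 _)) mul1r mulrA.
    by rewrite /w normr_id ler_wpM2r.
  - apply: integrableZl => //; apply/integrableP; split.
      apply/measurable_EFinP; apply: measurable_funM => //.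
      apply: (measurableT_comp (@measurable_expR R)).
      by apply: measurable_funM => //; exact: measurable_normr.
    by under eq_integral do rewrite gee0_abs ?lee_fin ?mulr_ge0 ?expR_ge0//; exact: ephi.
apply: (le_trans _ hp).
have i2 : mu.-integrable setT (fun x => (w x - 2 * (p.[x] * phi x))%:E).
  under eq_fun do rewrite EFinB EFinM.
  by apply: integrableB => //; exact: integrableZl.
(* Expanding, (s - p)^2 |phi| = |phi| - 2 p phi + p^2 |phi|. The middle term integrates to 0 and the
   last is nonnegative, so the integral of |phi| is at most the approximation error. *)
have -> : (\int[mu]_x `|phi x|%:E = \int[mu]_x (w x - 2 * (p.[x] * phi x))%:E)%E.
  under [RHS]eq_integral do rewrite EFinB EFinM.
  rewrite integralB//; last exact: integrableZl.
  rewrite integralZl// -[X in (_ - _ * X)%E]fineK ?integrable_fin_num//.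
  by rewrite [fine _](phi0 p) mule0 sube0.
have mD : measurable_fun setT (fun x => s x - p.[x]).
  by apply: measurable_funB => //; exact: measurable_horner.
apply: le_integral => //.
  apply/integrableP; split; first exact: measurable_sqr_weight.
  under eq_integral do rewrite gee0_abs ?(sqr_weight_ge0 w0 (fun x => s x - p.[x]))//.
  by apply: le_lt_trans hp _; exact: ltry.
move=> x _; rewrite lee_fin.
have -> : (s x - p.[x]) ^+ 2 * w x = s x ^+ 2 * w x - 2 * (p.[x] * (s x * w x)) + p.[x] ^+ 2 * w x.
  by ring.
by rewrite sw ssw lerDl mulr_ge0// sqr_ge0.
Qed.

Definition gint (G : R -> R) p : R := \int[mu]_u (G u * gpoly p u).

Lemma integrable_gint (G : R -> R) p : L2_gauss G ->
  mu.-integrable setT (fun u => (G u * gpoly p u)%:E).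
Proof.
move=> [mG Gfin].
have iG : mu.-integrable setT (fun u => (G u ^+ 2 * expR (- u ^+ 2))%:E).
  apply: ge0_integrable => //; last by move=> u; rewrite mulr_ge0 ?sqr_ge0 ?expR_ge0.
  by apply: measurable_funM; [exact: measurable_funX|exact: measurable_gauss_fun].
apply: (@le_integrable _ _ _ mu _ _ _ (fun u => (G u ^+ 2 * expR (- u ^+ 2))%:E + (gpoly (p * p) u)%:E)%E) => //.
- by apply/measurable_EFinP; apply: measurable_funM => //; exact: measurable_gpoly.
- move=> u _; rewrite lee_fin /gpoly hornerM mulrA normrM (ger0_norm (expR_ge0 _)).
  rewrite -mulrDl [leRHS]normrM (ger0_norm (expR_ge0 _)) ler_wpM2r ?expR_ge0//.
  rewrite normrM [leRHS]ger0_norm; last by rewrite addr_ge0 ?sqr_ge0// -expr2 sqr_ge0.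
  rewrite -(real_normK (num_real (G u))) -expr2 -(real_normK (num_real p.[u])).
  have aux (a c : R) : 0 <= a -> 0 <= c -> a * c <= a ^+ 2 + c ^+ 2.
    by move=> a0 c0; have := sqr_ge0 (a - c); nra.
  exact: aux.
- by apply: integrableD => //; exact: integrable_gpoly.
Qed.

Lemma gint_sub (G : R -> R) p q :
  (forall p, mu.-integrable setT (fun u => (G u * gpoly p u)%:E)) ->
  gint G (p - q) = gint G p - gint G q.
Proof.
move=> hG; rewrite /gint -RintegralB//; [|exact: hG..].
by apply: eq_Rintegral => u _; rewrite gpolyB mulrBr.
Qed.

Lemma gint_scale (G : R -> R) (c : R) p :
  (forall p, mu.-integrable setT (fun u => (G u * gpoly p u)%:E)) ->
  gint G (c *: p) = c * gint G p.
Proof.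
move=> hG; rewrite /gint -RintegralZl//; last exact: hG.
by apply: eq_Rintegral => u _; rewrite /gpoly hornerZ; ring.
Qed.

Lemma hermite_coefE (G : R -> R) n :
  hermite_coef G n = gint G (hpoly R n) / (2 ^+ n * n`!%:R * Num.sqrt pi).
Proof.
rewrite /hermite_coef /gint -gmoment_hpoly_sqr; congr (_ / _).
  by apply: eq_Rintegral => u _; rewrite hermiteE /gpoly mulrA.
by apply: eq_Rintegral => u _; rewrite hermiteE /gpoly hornerM -expr2.
Qed.

Definition hsum (G : R -> R) (N : nat) : {poly R} :=
  \sum_(n < N) hermite_coef G n *: hpoly R n.

Lemma horner_hsum (G : R -> R) N u :
  (hsum G N).[u] = \sum_(n < N) hermite_coef G n * hermite n u.
Proof. by rewrite /hsum horner_sum; apply: eq_bigr => n _; rewrite hornerZ hermiteE. Qed.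

Lemma hnorm_neq0 n : 2 ^+ n * n`!%:R * Num.sqrt pi != 0 :> R.
Proof.
apply: lt0r_neq0; rewrite !mulr_gt0 ?exprn_gt0 ?ltr0n ?fact_gt0//.
by rewrite sqrtr_gt0 pi_gt0.
Qed.

Lemma gmoment_hsum (G : R -> R) N (m : nat) : (m < N)%N ->
  gmoment (hsum G N * hpoly R m) = gint G (hpoly R m).
Proof.
have gD p q : gmoment (p + q) = gmoment p + gmoment q :> R.
  have -> : p + q = p - (-1) *: q by rewrite scaleN1r opprK.
  by rewrite gmomentB gmomentZ mulN1r opprK.
move=> mN; rewrite /hsum mulr_suml.
have -> : gmoment (\sum_(i < N) (hermite_coef G i *: hpoly R i) * hpoly R m) =
    \sum_(i < N) hermite_coef G i * gmoment (hpoly R i * hpoly R m).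
  elim/big_ind2 : _ => [|x y x' y' <- <-|i _].
  - by rewrite -[0](scale0r 1) gmomentZ mul0r.
  - exact: gD.
  - by rewrite -scalerAl gmomentZ.
rewrite (bigD1 (Ordinal mN))//= gmoment_hpoly_sqr big1 => [|i iN].
  by rewrite addr0 hermite_coefE divfK// hnorm_neq0.
rewrite gmoment_hpoly_neq ?mulr0//.
Qed.

(** Induction on the degree, removing the leading term by a multiple of [hpoly R m], whose leading
    coefficient is 2^m. Integrability against every [gpoly] is the only demand on [G], so the lemma
    also serves for uniqueness within [class_G]. *)
Lemma gint_hsum (G : R -> R) N p :
  (forall p, mu.-integrable setT (fun u => (G u * gpoly p u)%:E)) ->
  (size p <= N)%N ->
  gint G p = gmoment (hsum G N * p).
Proof.
move=> hG pN; move: {2}(size p) (leqnn (size p)) => m.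
elim: m p pN => [|m IH] p pN pm.
  move: pm; rewrite leqn0 size_poly_eq0 => /eqP ->.
  by rewrite mulr0 -[0](scale0r (0 : {poly R})) gint_scale// gmomentZ !mul0r.
have [pm'|pm'] := leqP (size p) m; first exact: IH.
have sm : size p = m.+1 by apply/eqP; rewrite eqn_leq pm.
have mN : (m < N)%N by rewrite -sm.
pose c := p`_m / 2 ^+ m; pose q := p - c *: hpoly R m.
have [s1 s2] := size_hpoly_coef R m.
have sq : (size q <= m)%N.
  apply/leq_sizeP => j; rewrite leq_eqVlt => /predU1P[<-|mj].
    by rewrite coefB coefZ s2 /c divfK ?subrr// expf_neq0.
  rewrite coefB coefZ !nth_default ?mulr0 ?subr0//; first exact: leq_trans s1 mj.
  by rewrite sm.
have -> : p = q - (- c) *: hpoly R m by rewrite scaleNr opprK /q subrK.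
rewrite gint_sub// gint_scale// mulrBr gmomentB -scalerAr gmomentZ gmoment_hsum//.
by rewrite IH// (leq_trans sq)// ltnW.
Qed.

(** Pythagoras: the error of the partial sum is orthogonal to the difference [r] between the partial
    sum and [p]. An infinite right-hand side is set aside before integrals are added. *)
Lemma hsum_best (G : R -> R) N p : L2_gauss G -> (size p <= N)%N ->
  (sqnorm (@gauss_fun R) (fun u => ((hsum G N).[u] - G u)%R) <=
   sqnorm (@gauss_fun R) (fun u => (G u - p.[u])%R))%E.
Proof.
move=> hG pN; have [mG _] := hG.
pose r := hsum G N - p.
have sr : (size r <= N)%N.
  apply: (leq_trans (size_polyD _ _)); rewrite geq_max size_polyN pN andbT.
  apply: (leq_trans (size_sum _ _ _)); apply/bigmax_leqP => i _.
  apply: leq_trans (size_scale_leq _ _) _; have [h _] := size_hpoly_coef R i.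
  by apply: (leq_trans h); exact: ltn_ord.
pose D u := (hsum G N).[u] - G u.
have mD : measurable_fun setT D.
  by apply: measurable_funB => //; exact: measurable_horner.
have orth : \int[mu]_u (gpoly (hsum G N * r) u - G u * gpoly r u) = 0.
  rewrite RintegralB//; [|exact: integrable_gpoly|exact: integrable_gint].
  by rewrite -/(gint G r) (gint_hsum (fun p => integrable_gint p hG) sr) subrr.
have iD : mu.-integrable setT (fun u => (gpoly (hsum G N * r) u - G u * gpoly r u)%:E).
  under eq_fun do rewrite EFinB.
  by apply: integrableB => //; [exact: integrable_gpoly|exact: integrable_gint].
have i2 : mu.-integrable setT
    (fun u => (2 * (gpoly (hsum G N * r) u - G u * gpoly r u))%:E).
  by under eq_fun do rewrite EFinM; exact: integrableZl.
have mg := @measurable_gauss_fun R.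
have w0 := @gauss_fun_ge0 R.
have mGp : measurable_fun setT (fun u => G u - p.[u]).
  by apply: measurable_funB => //; exact: measurable_horner.
have [->|fin] := eqVneq (sqnorm (@gauss_fun R) (fun u => G u - p.[u])) +oo%E.
  by rewrite leey.
have iGp : mu.-integrable setT (fun u => ((G u - p.[u]) ^+ 2 * gauss_fun u)%:E).
  apply: ge0_integrable => [|u|].
  - by apply: measurable_funM => //; exact: measurable_funX.
  - by rewrite mulr_ge0 ?sqr_ge0.
  - by rewrite ltey.
have -> : sqnorm (@gauss_fun R) (fun u => G u - p.[u]) =
    (\int[mu]_u ((G u - p.[u]) ^+ 2 * gauss_fun u +
       2 * (gpoly (hsum G N * r) u - G u * gpoly r u))%:E)%E.
  under [RHS]eq_integral do rewrite EFinD.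
  rewrite integralD//.
  have -> : (\int[mu]_u (2 * (gpoly (hsum G N * r) u - G u * gpoly r u))%:E = 0)%E.
    under eq_integral do rewrite EFinM.
    rewrite integralZl// -[X in (_ * X)%E]fineK ?integrable_fin_num//.
    by rewrite [fine _]orth mule0.
  by rewrite adde0.
have le u : D u ^+ 2 * gauss_fun u <= (G u - p.[u]) ^+ 2 * gauss_fun u +
       2 * (gpoly (hsum G N * r) u - G u * gpoly r u).
  rewrite /gpoly -/(gauss_fun u) hornerM.
  have -> : (G u - p.[u]) ^+ 2 * gauss_fun u +
      2 * ((hsum G N).[u] * r.[u] * gauss_fun u - G u * (r.[u] * gauss_fun u)) =
      D u ^+ 2 * gauss_fun u + r.[u] ^+ 2 * gauss_fun u.
    by rewrite /D /r hornerD hornerN; ring.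
  by rewrite lerDl mulr_ge0 ?sqr_ge0.
apply: ge0_le_integral => //.
- by move=> u _; rewrite lee_fin mulr_ge0 ?sqr_ge0.
- exact: (measurable_sqr_weight mg mD).
- under eq_fun do rewrite EFinD.
  apply: emeasurable_funD; first exact: (measurable_sqr_weight mg mGp).
  by case/integrableP : i2.
- by move=> u _; rewrite lee_fin; exact: le.
Qed.

(** Some polynomial is within [e] by density, and every partial sum of at least its size does as
    well. *)
Lemma hermite_expansion (G : R -> R) : L2_gauss G ->
  L2_gauss_cvg (fun N u => (hsum G N).[u]) G.
Proof.
move=> hG; have [mG Gfin] := hG.
have expg A : (\int[mu]_x (expR (A * `|x|) * gauss_fun x)%:E < +oo)%E.
  have := @integrable_exp_gauss R A 1 ltr01 => /integrableP[_].
  congr (_ < _)%E; apply: eq_integral => x _.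
  by rewrite abse_EFin mul1r ger0_norm// mulr_ge0 ?expR_ge0.
have dense := poly_dense (@gauss_fun_ge0 R) (@measurable_gauss_fun R) expg mG Gfin.
have small e : 0 < e -> \forall N \near \oo,
    (0 <= sqnorm (@gauss_fun R) (fun u => ((hsum G N).[u] - G u)%R) <= e%:E)%E.
  move=> e0; have [p hp] := dense e e0; exists (size p) => // N /= pN.
  rewrite sqnorm_ge0 ?andbT//=; last exact: gauss_fun_ge0.
  exact: le_trans (hsum_best hG pN) hp.
apply/fine_cvgP; split.
  apply: filterS (small 1 ltr01) => N /andP[h1 h2].
  by rewrite fin_numE; apply/andP; split; [rewrite gt_eqF// (lt_le_trans _ h1)|rewrite lt_eqF// (le_lt_trans h2)// ltry].
apply/cvgrPdist_le => e e0; apply: filterS (small e e0) => N /andP[h1 h2].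
rewrite sub0r normrN ger0_norm ?fine_ge0// -lee_fin fineK//.
by rewrite fin_numE; apply/andP; split; [rewrite gt_eqF// (lt_le_trans _ h1)|rewrite lt_eqF// (le_lt_trans h2)// ltry].
Qed.

End hermite_expansions.

(** * Gaussian kernels and their derivatives *)

Section gaussian_kernel.
Context (R : realType).
Local Notation mu := (@lebesgue_measure R).
Implicit Types (c y z v : R) (n : nat).

(* The n-th derivative at z of exp (- (z / c)^2) / c. *)
Definition gkernel n c z : R := c^-1 ^+ n.+1 * gpoly ((-1) ^+ n *: hpoly R n) (z / c).

Lemma is_derive_rescale (F : R -> R) (F' c a y : R) :
  is_derive ((y - a) / c) 1 F F' -> is_derive y 1 (fun y => F ((y - a) / c)) (F' / c).
Proof.
move=> dF.
have dg : is_derive y 1 (fun y : R => (y - a) / c) c^-1.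
  have -> : (fun y : R => (y - a) / c) = c^-1 \*: (id - cst a).
    by apply/funext => z; rewrite !fctE /= mulrC.
  by apply: is_derive_eq; rewrite subr0 /GRing.scale /= mulr1.
exact: (@is_derive1_comp _ F (fun y : R => (y - a) / c) y F' c^-1 dF dg).
Qed.

Lemma is_derive_gkernel n c a y :
  is_derive y 1 (fun y => gkernel n c (y - a)) (gkernel n.+1 c (y - a)).
Proof.
have dF := is_derive_rescale (is_derive_gpoly ((-1) ^+ n *: hpoly R n) ((y - a) / c)).
have -> : (fun y => gkernel n c (y - a)) =
    c^-1 ^+ n.+1 \*: (fun y => gpoly ((-1) ^+ n *: hpoly R n) ((y - a) / c)) by [].
apply: is_derive_eq.
have -> : gderiv ((-1) ^+ n *: hpoly R n) = (-1) ^+ n.+1 *: hpoly R n.+1.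
  rewrite /= /gderiv derivZ exprS mulN1r scaleNr scalerN opprK scalerBr.
  by rewrite -scalerAr.
by rewrite /gkernel [c^-1 ^+ n.+2]exprS -[_ *: _]/(_ * _); ring.
Qed.

Lemma is_derive_gauss_cdf_kernel c a y :
  is_derive y 1 (fun y => gauss_cdf ((y - a) / c)) ((Num.sqrt pi)^-1 * gkernel 0 c (y - a)).
Proof.
have dF := is_derive_rescale (is_derive_gauss_cdf ((y - a) / c)).
apply: is_derive_eq; rewrite /gkernel /gpoly /gauss_pdf /= scale1r hornerC; ring.
Qed.

Lemma gkernel_bounded n (c0 : R) : 0 < c0 ->
  exists2 C : R, 0 <= C & forall c z, c0 <= c -> `|gkernel n c z| <= C.
Proof.
move=> c00; have [C C0 hC] := gpoly_bounded ((-1) ^+ n *: hpoly R n).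
exists (c0^-1 ^+ n.+1 * C); first by rewrite mulr_ge0// exprn_ge0// invr_ge0 ltW.
move=> c z cc; have cp : 0 < c by exact: lt_le_trans cc.
rewrite /gkernel normrM normrX ger0_norm ?invr_ge0 ?(ltW cp)//.
apply: ler_pM => //; first by rewrite exprn_ge0// invr_ge0 ltW.
by rewrite lerXn2r// ?nnegrE ?invr_ge0 ?(ltW cp) ?(ltW c00)// lef_pV2 ?posrE.
Qed.

(** Away from z = 0 one has 1/c <= |z/c| / a, so the singular factor c^(-n-1) is absorbed into the
    polynomial, uniformly as [c] tends to 0. *)
Lemma gkernel_far_bounded n (a : R) : 0 < a ->
  exists2 C : R, 0 <= C & forall c z, 0 < c -> a <= `|z| -> `|gkernel n c z| <= C.
Proof.
move=> a0; have [C C0 hC] := gpoly_bounded (((-1) ^+ n *: hpoly R n) * 'X^(n.+1)).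
exists (a^-1 ^+ n.+1 * C); first by rewrite mulr_ge0// exprn_ge0// invr_ge0 ltW.
move=> c z c0 az.
have cE : c^-1 <= a^-1 * `|z / c|.
  rewrite normrM normfV (ger0_norm (ltW c0)) mulrA -[leLHS]mul1r ler_wpM2r ?invr_ge0 ?(ltW c0)//.
  by rewrite mulrC ler_pdivlMr// mul1r.
rewrite /gkernel normrM normrX ger0_norm ?invr_ge0 ?(ltW c0)//.
apply: (@le_trans _ _ ((a^-1 * `|z / c|) ^+ n.+1 * `|gpoly ((-1) ^+ n *: hpoly R n) (z / c)|)).
  rewrite ler_wpM2r// lerXn2r// ?nnegrE ?invr_ge0 ?(ltW c0)//.
  by rewrite mulr_ge0// invr_ge0 ltW.
rewrite exprMn -mulrA ler_wpM2l ?exprn_ge0 ?invr_ge0 ?(ltW a0)//.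
apply: le_trans (hC (z / c)).
by rewrite /gpoly hornerM hornerXn -normrX -normrM mulrA [_ ^+ _ * _]mulrC.
Qed.

Lemma is_derive_under_integral (D : set R) (kap M M' : R -> R)
    (phi phi' : R -> R -> R) (y0 e : R) : measurable D -> 0 < e ->
  measurable_fun D kap ->
  mu.-integrable D (fun u => (kap u * M u)%:E) ->
  mu.-integrable D (fun u => (kap u * M' u)%:E) ->
  (forall y, measurable_fun D (phi y)) ->
  (forall y u, `|y - y0| < e -> D u -> `|phi y u| <= M u) ->
  (forall y u, `|y - y0| < e -> D u -> `|phi' y u| <= M' u) ->
  (forall y u, D u -> is_derive y 1 (phi ^~ u) (phi' y u)) ->
  is_derive y0 1 (fun y => \int[mu]_(u in D) (kap u * phi y u))
                 (\int[mu]_(u in D) (kap u * phi' y0 u)).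
Proof.
move=> mD e0 mk iM iM' mphi hM hM' dphi.
pose f y u := kap u * phi y u.
have I0 : `](y0 - e), (y0 + e)[%classic y0.
  by rewrite /= in_itv/= ltrBlDr !ltrDl e0.
have IE (y : R) : (`](y0 - e), (y0 + e)[%classic : set R) y -> `|y - y0| < e.
  by rewrite /= in_itv/= => /andP[h1 h2]; rewrite ltr_norml; apply/andP; split; lra.
have df y u : D u -> is_derive y 1 (f ^~ u) (kap u * phi' y u).
  move=> Du; have dp := dphi y u Du.
  have -> : f ^~ u = kap u \*: (phi ^~ u) by [].
  by apply: is_derive_eq.
have intf (y : R) : (`](y0 - e), (y0 + e)[%classic : set R) y -> mu.-integrable D (EFin \o f y).
  move=> /IE hy; apply: le_integrable iM => //.
    by apply/measurable_EFinP; exact: (measurable_funM mk (mphi y)).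
  move=> u Du; rewrite /= lee_fin /f !normrM ler_wpM2l//.
  by apply: le_trans (hM _ _ hy Du) _; exact: ler_norm.
have derf1 (y u : R) : (`](y0 - e), (y0 + e)[%classic : set R) y -> D u -> derivable (f ^~ u) y 1.
  by move=> _ Du; case: (df y u Du).
have pE y u : D u -> partial1of2 f y u = kap u * phi' y u.
  by move=> Du; rewrite partial1of2E; case: (df y u Du).
(* The dominating function has to be nonnegative outside [D] too, hence the absolute value. *)
have G0 u : 0 <= `|kap u * M' u| by [].
have iG : mu.-integrable D (EFin \o (fun u => `|kap u * M' u|)).
  by have := integrable_abse iM'.
have Gub (y u : R) : (`](y0 - e), (y0 + e)[%classic : set R) y -> D u -> `|partial1of2 f y u| <= `|kap u * M' u|.
  move=> /IE hy Du; rewrite pE// !normrM ler_wpM2l//.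
  by apply: le_trans (hM' _ _ hy Du) _; exact: ler_norm.
apply: DeriveDef.
  exact: (@derivable_under_integral R _ _ mu f D mD y0 (y0 - e) (y0 + e) I0 intf derf1 _ G0 iG Gub).
rewrite -derive1E.
rewrite (@differentiation_under_integral R _ _ mu f D mD y0 (y0 - e) (y0 + e) I0 intf derf1 _ G0 iG Gub).
by apply: eq_Rintegral => u; rewrite inE => Du; exact: pE.
Qed.

End gaussian_kernel.

(** * Kernels centred on the moving boundary *)

Section boundary_kernel.
Context (R : realType) (b : R -> R) (t : R).
Local Notation mu := (@lebesgue_measure R).
Hypothesis cb : forall u, 0 < u -> {for u, continuous b}.
Hypothesis t0 : 0 < t.
Implicit Types (y u : R) (n : nat).

Lemma sqrt_horizon_gt0 u : u < t -> 0 < Num.sqrt (2 * (t - u)).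
Proof. by move=> ut; rewrite sqrtr_gt0 mulr_gt0// subr_gt0. Qed.

Lemma continuous_sqrt_horizon u : {for u, continuous (fun r => Num.sqrt (2 * (t - r)))}.
Proof.
apply: (@continuous_comp _ _ _ (fun r : R => 2 * (t - r)) (@Num.sqrt R)); last exact: sqrt_continuous.
by apply: cvgMr; apply: cvgB; [exact: cvg_cst|exact: cvg_id].
Qed.

Lemma measurable_boundary_kernel n y : measurable_fun `]0, t[%classic
  (fun u => gkernel n (Num.sqrt (2 * (t - u))) (y - b u)).
Proof.
apply: open_continuous_measurable_fun => [|u]; first exact: interval_open.
rewrite inE/= in_itv/= => /andP[u0 ut].
have cV : {for u, continuous (fun u => (Num.sqrt (2 * (t - u)))^-1)}.
  by apply: cvgV; [rewrite gt_eqF// sqrt_horizon_gt0|exact: continuous_sqrt_horizon].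
have cz : {for u, continuous (fun u => (y - b u) / Num.sqrt (2 * (t - u)))}.
  by apply: cvgM => //; apply: cvgB; [exact: cvg_cst|exact: cb].
apply: cvgM.
  exact: (continuous_comp cV (@exprn_continuous _ n.+1 _)).
exact: (continuous_comp cz (@continuous_gpoly _ _ _)).
Qed.

(* Near the endpoint u = t the kernel is singular, but there y stays away from
   b u. *)
Lemma boundary_kernel_bounded n y0 : y0 < b t ->
  exists2 e : R, 0 < e & exists2 C : R, 0 <= C & forall y u,
    `|y - y0| < e -> 0 < u -> u < t ->
    `|gkernel n (Num.sqrt (2 * (t - u))) (y - b u)| <= C.
Proof.
(* [m] is a third of the distance: y moves by less than [m] and b u by less than [m] near [t], so
   they stay at least [m] apart. *)
move=> yb; pose m := (b t - y0) / 3; have m0 : 0 < m by rewrite divr_gt0// subr_gt0.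
have /cvgrPdist_lt/(_ m m0)/nbhs_ballP[eta /= eta0 heta] := cb t0.
have [C1 C10 hC1] := gkernel_far_bounded n m0.
have c0 : 0 < Num.sqrt (2 * eta) by rewrite sqrtr_gt0 mulr_gt0.
have [C2 C20 hC2] := gkernel_bounded n c0.
exists m => //; exists (C1 + C2); first by rewrite addr_ge0.
move=> y u hy u0 ut; have [ue|ue] := ltP (t - u) eta.
  apply: (@le_trans _ _ C1); last by rewrite lerDl.
  apply: hC1; first exact: sqrt_horizon_gt0.
  have /heta : ball t eta u by rewrite /ball/= ger0_norm// subr_ge0 ltW.
  move: hy; rewrite !ltr_norml => /andP[h1 h2] /andP[h3 h4].
  rewrite distrC ler_normr; apply/orP; left.
  have : b t = y0 + 3 * m by rewrite /m; field.
  lra.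
apply: (@le_trans _ _ C2); last by rewrite lerDr.
by apply: hC2; rewrite ler_wsqrtr// ler_pM2l.
Qed.

Variable kap : R -> R.
Hypothesis ikap : mu.-integrable `]0, t[%classic (EFin \o kap).

Let mkap : measurable_fun `]0, t[%classic kap.
Proof. by case/integrableP : ikap => /measurable_EFinP. Qed.

Let ikapC (C : R) : mu.-integrable `]0, t[%classic (fun u => (kap u * C)%:E).
Proof.
rewrite (_ : (fun u => _) = (fun u => C%:E * (kap u)%:E)%E); first exact: integrableZl.
by apply/funext => u; rewrite muleC.
Qed.

Lemma is_derive_boundary_kernel n y0 : y0 < b t ->
  is_derive y0 1
   (fun y => \int[mu]_(u in `]0, t[) (kap u * gkernel n (Num.sqrt (2 * (t - u))) (y - b u)))
   (\int[mu]_(u in `]0, t[) (kap u * gkernel n.+1 (Num.sqrt (2 * (t - u))) (y0 - b u))).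
Proof.
move=> yb; have [e e0 [C C0 hC]] := boundary_kernel_bounded n yb.
have [e' e'0 [C' C'0 hC']] := boundary_kernel_bounded n.+1 yb.
apply: (@is_derive_under_integral R _ kap (cst C) (cst C')
  (fun y u => gkernel n (Num.sqrt (2 * (t - u))) (y - b u))
  (fun y u => gkernel n.+1 (Num.sqrt (2 * (t - u))) (y - b u)) y0 (Num.min e e')) => //.
- by rewrite lt_min e0.
- exact: ikapC.
- exact: ikapC.
- by move=> y; exact: measurable_boundary_kernel.
- by move=> y u; rewrite lt_min/= in_itv/= => /andP[h _] /andP[u0 ut]; exact: hC.
- by move=> y u; rewrite lt_min/= in_itv/= => /andP[_ h] /andP[u0 ut]; exact: hC'.
- by move=> y u _; exact: is_derive_gkernel.
Qed.

Lemma is_derive_boundary_cdf y0 : y0 < b t ->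
  is_derive y0 1
   (fun y => \int[mu]_(u in `]0, t[) (kap u * gauss_cdf ((y - b u) / Num.sqrt (2 * (t - u)))))
   (\int[mu]_(u in `]0, t[)
      (kap u * ((Num.sqrt pi)^-1 * gkernel 0 (Num.sqrt (2 * (t - u))) (y0 - b u)))).
Proof.
move=> yb; have [e e0 [C C0 hC]] := boundary_kernel_bounded 0 yb.
have spi : 0 <= (Num.sqrt pi)^-1 :> R by rewrite invr_ge0 sqrtr_ge0.
apply: (@is_derive_under_integral R _ kap (cst 1) (cst ((Num.sqrt pi)^-1 * C))
  (fun y u => gauss_cdf ((y - b u) / Num.sqrt (2 * (t - u))))
  (fun y u => (Num.sqrt pi)^-1 * gkernel 0 (Num.sqrt (2 * (t - u))) (y - b u)) y0 e) => //.
- exact: ikapC.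
- exact: ikapC.
- move=> y; apply: open_continuous_measurable_fun => [|u]; first exact: interval_open.
  rewrite inE/= in_itv/= => /andP[u0 ut].
  have cz : {for u, continuous (fun u => (y - b u) / Num.sqrt (2 * (t - u)))}.
    apply: cvgM; first by apply: cvgB; [exact: cvg_cst|exact: cb].
    by apply: cvgV; [rewrite gt_eqF// sqrt_horizon_gt0|exact: continuous_sqrt_horizon].
  have hg v : {for v, continuous (@gauss_cdf R)}.
    have [d1 _] := is_derive_gauss_cdf v.
    exact/differentiable_continuous/derivable1_diffP.
  exact: (continuous_comp cz (hg _)).
- by move=> y u _ _; rewrite ger0_norm ?gauss_cdf_ge0 ?gauss_cdf_le1.
- move=> y u hy; rewrite /= in_itv/= => /andP[u0 ut].
  by rewrite normrM (ger0_norm spi) ler_wpM2l//; exact: hC.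
- by move=> y u _; exact: is_derive_gauss_cdf_kernel.
Qed.

End boundary_kernel.

(** * Kernels centred at the starting point *)

Section initial_kernel.
Context (R : realType) (c : R).
Local Notation mu := (@lebesgue_measure R).
Hypothesis c0 : 0 < c.
Implicit Types (y u : R) (n : nat).

(** Half of the exponent v^2 pays for the polynomial factor. For the other half, (y - x)^2 >= x^2 /
    2 - y^2 gives the rate 1 / (4 c^2), uniformly in [y] near [y0]. *)
Lemma gkernel_gauss_bound n y0 : exists2 C : R, 0 <= C & forall y x,
  `|y - y0| < 1 -> `|gkernel n c (y - x)| <= C * expR (- ((4 * c ^+ 2)^-1 * x ^+ 2)).
Proof.
have [C C0 hC] := exp_poly_bound ((-1) ^+ n *: hpoly R n).
have c20 : 0 < c ^+ 2 by rewrite exprn_gt0.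
pose Y := `|y0| + 1.
pose B := c^-1 ^+ n.+1 * (C * (expR (1 ^+ 2 / (2 * 1)) * expR (Y ^+ 2 / (2 * c ^+ 2)))).
have ci0 : 0 <= c^-1 ^+ n.+1 by rewrite exprn_ge0// invr_ge0 ltW.
exists B; first by rewrite !mulr_ge0 ?expR_ge0.
move=> y x hy; have yY : y ^+ 2 <= Y ^+ 2.
  rewrite -(real_normK (num_real y)) lerXn2r ?nnegrE ?addr_ge0//.
  have -> : y = y0 + (y - y0) by rewrite addrC subrK.
  by rewrite (le_trans (ler_normD _ _))// lerD2l ltW.
rewrite /gkernel normrM (ger0_norm ci0) -mulrA ler_wpM2l//.
rewrite /gpoly normrM (ger0_norm (expR_ge0 _)); set v := (y - x) / c.
apply: (@le_trans _ _ (C * (expR (1 * `|v|) * expR (- (1 * v ^+ 2))))).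
  by rewrite !mul1r mulrA ler_wpM2r ?expR_ge0.
rewrite -mulrA ler_wpM2l//; apply: (le_trans (exp_linear_gauss 1 v ltr01)).
rewrite -[leRHS]mulrA ler_wpM2l ?expR_ge0// -expRD ler_expR.
rewrite -subr_ge0.
have -> : Y ^+ 2 / (2 * c ^+ 2) + - ((4 * c ^+ 2)^-1 * x ^+ 2) - - (1 / 2 * v ^+ 2) =
  (2 * (Y ^+ 2 - y ^+ 2) + (2 * y - x) ^+ 2) / (4 * c ^+ 2).
  rewrite /v; field; exact: lt0r_neq0.
apply: divr_ge0; last by rewrite mulr_ge0 ?(ltW c20).
by apply: addr_ge0; [rewrite mulr_ge0// subr_ge0|exact: sqr_ge0].
Qed.

Lemma measurable_initial_kernel n y : measurable_fun setT (fun x : R => gkernel n c (y - x)).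
Proof.
apply: continuous_measurable_fun => x.
apply: cvgMr.
have cz : {for x, continuous (fun x : R => (y - x) / c)}.
  by apply: cvgMl; apply: cvgB; [exact: cvg_cst|exact: cvg_id].
exact: (continuous_comp cz (@continuous_gpoly _ _ _)).
Qed.

Variable g : R -> R.
Hypothesis mg : measurable_fun (`]0, +oo[%classic : set R) g.
Hypothesis ig : forall a : R, 0 < a ->
  mu.-integrable (`]0, +oo[%classic : set R) (fun x => (g x * expR (- (a * x ^+ 2)))%:E).

Lemma is_derive_initial_kernel n y0 :
  is_derive y0 1
   (fun y => \int[mu]_(x in `]0, +oo[) (g x * gkernel n c (y - x)))
   (\int[mu]_(x in `]0, +oo[) (g x * gkernel n.+1 c (y0 - x))).
Proof.
have [C C0 hC] := gkernel_gauss_bound n y0.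
have [C' C'0 hC'] := gkernel_gauss_bound n.+1 y0.
have a0 : 0 < (4 * c ^+ 2)^-1 by rewrite invr_gt0 mulr_gt0// exprn_gt0.
have iM (A : R) : mu.-integrable (`]0, +oo[%classic : set R)
    (fun x => (g x * (A * expR (- ((4 * c ^+ 2)^-1 * x ^+ 2))))%:E).
  rewrite (_ : (fun x => _) =
    (fun x => A%:E * (g x * expR (- ((4 * c ^+ 2)^-1 * x ^+ 2)))%:E)%E); last first.
    by apply/funext => x; rewrite -EFinM mulrCA.
  by apply: integrableZl => //; exact: ig.
apply: (@is_derive_under_integral R _ g
  (fun x => C * expR (- ((4 * c ^+ 2)^-1 * x ^+ 2)))
  (fun x => C' * expR (- ((4 * c ^+ 2)^-1 * x ^+ 2)))
  (fun y x => gkernel n c (y - x)) (fun y x => gkernel n.+1 c (y - x)) y0 1) => //.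
- by move=> y; apply: measurable_funTS; exact: measurable_initial_kernel.
- by move=> y x hy _; exact: hC.
- by move=> y x hy _; exact: hC'.
- by move=> y x _; exact: is_derive_gkernel.
Qed.

End initial_kernel.

(** * The integral equation *)

(** The difference of the integrals of the two parts is finite only if both are, even with the
    convention for oo - oo. This extracts integrability from the integral equation itself. *)
Lemma fin_num_integrable d (T : measurableType d) (R : realType)
    (m : {measure set T -> \bar R}) (D : set T) (h : T -> \bar R) :
  measurable D -> measurable_fun D h -> (\int[m]_(x in D) h x)%E \is a fin_num ->
  m.-integrable D h.
Proof.
move=> mD mh; rewrite integralE => hfin; apply/integrableP; split=> //.
have -> : (\int[m]_(x in D) `|h x| = \int[m]_(x in D) (h^\+ x + h^\- x))%E.
  by apply: eq_integral => x _; rewrite -/((abse \o h) x) fune_abse.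
rewrite ge0_integralD//; [|exact: measurable_funepos|exact: measurable_funeneg].
have p0 : (0 <= \int[m]_(x in D) h^\+ x)%E by exact: integral_ge0.
have n0 : (0 <= \int[m]_(x in D) h^\- x)%E by exact: integral_ge0.
move: hfin p0 n0; case: (\int[m]_(x in D) h^\+ x)%E => [r| |]; case: (\int[m]_(x in D) h^\- x)%E => [r'| |]//= _ _ _.
by rewrite -EFinD ltry.
Qed.

(** Rounding the time up to a grid gives functions that depend on [x] alone on each strip;
    continuity in time makes them converge to [k]. *)
Lemma measurable_caratheodory (R : realType) (D : set R) (k : R -> R -> R) :
  measurable D -> (forall s, 0 < s -> measurable_fun D (k s)) ->
  (forall x s, D x -> 0 < s -> {for s, continuous (k^~ x)}) ->
  measurable_fun ((`]0, +oo[%classic : set R) `*` D) (fun p => k p.1 p.2).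
Proof.
move=> mD mk ck.
apply: (@measurable_fun_cvg _ _ _ _
  (fun n p => k (grid_above (1 / n.+1%:R) p.1) p.2)); last first.
  move=> [s x] /= [+ Dx]; rewrite in_itv/= andbT => s0.
  have cg := @cvg_grid_above R 1 s ltr01; have cs := ck _ _ Dx s0.
  exact: (cvg_comp (fun n => grid_above (1 / n.+1%:R) s) (k^~ x) cg cs).
move=> n; set h := 1 / n.+1%:R; have h0 : 0 < h :> R by rewrite divr_gt0.
pose I j : set R := `]h * j%:R, h * j.+1%:R]%classic.
have -> : (`]0, +oo[%classic : set R) `*` D = \bigcup_j (I j `*` D).
  apply/seteqP; split => [[s x] /= [+ Dx]|[s x] [j _ /= [+ Dx]]].
    rewrite in_itv/= andbT => s0; have [j js sj] := grid_above_itv h0 s0.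
    by exists j => //; split => //; rewrite /I/= in_itv/= js.
  rewrite /I/= in_itv/= => /andP[js _]; split => //=; rewrite in_itv/= andbT.
  by apply: le_lt_trans js; rewrite mulr_ge0// ltW.
have mIj j : measurable (I j `*` D) by apply: measurableX => //; exact: measurable_itv.
apply/measurable_fun_bigcup => // j.
apply: (@eq_measurable_fun _ _ _ _ _ (fun p : R * R => k (h * j.+1%:R) p.2)).
  move=> [s x]; rewrite inE => -[/= + _]; rewrite /I/= in_itv/= => /andP[js sj].
  by rewrite (grid_aboveE h0 js sj).
apply: (@measurable_comp _ _ _ _ _ _ D (k (h * j.+1%:R)) _ (fun p : R * R => p.2)) => //.
- by move=> _ [[s x] [_ Dx] <-].
- by apply: mk; rewrite mulr_gt0.
- by apply: measurable_funTS; exact: measurable_snd.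
Qed.

Lemma Fubini_setX d d' (X : measurableType d) (Y : measurableType d') (R : realType)
    (m : {sigma_finite_measure set X -> \bar R}) (m' : {sigma_finite_measure set Y -> \bar R})
    (A : set X) (B : set Y) (F : X * Y -> \bar R) :
  measurable A -> measurable B -> measurable_fun (A `*` B) F ->
  (\int[m]_(x in A) \int[m']_(y in B) `|F (x, y)| < +oo)%E ->
  measurable_fun B (fun y => \int[m]_(x in A) F (x, y))%E /\
  (\int[m]_(x in A) \int[m']_(y in B) F (x, y) = \int[m']_(y in B) \int[m]_(x in A) F (x, y))%E.
Proof.
move=> mA mB mF Foo; pose G := F \_ (A `*` B).
have mG : measurable_fun setT G.
  by apply/(measurable_restrictT _ (measurableX mA mB)).
have G1 (h : \bar R -> \bar R) : h 0%E = 0%E -> forall x,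
    (\int[m']_y h (G (x, y)) = ((fun x => \int[m']_(y in B) h (F (x, y))) \_ A) x)%E.
  move=> h0 x; rewrite patchE; case: ifPn => xA.
    rewrite [RHS]integral_mkcond; apply: eq_integral => y _.
    by rewrite /G !patchE in_setX xA/=; case: ifPn.
  by apply: integral0_eq => y _; rewrite /G patchE in_setX (negbTE xA).
have G2 y : (\int[m]_x G (x, y) = ((fun y => \int[m]_(x in A) F (x, y)) \_ B) y)%E.
  rewrite patchE; case: ifPn => yB.
    rewrite [RHS]integral_mkcond; apply: eq_integral => x _.
    by rewrite /G !patchE in_setX yB andbT.
  by apply: integral0_eq => x _; rewrite /G patchE in_setX (negbTE yB) andbF.
have iG : (m \x m')%E.-integrable setT G.
  apply/(integrable12ltyP _ _ mG); under eq_integral do rewrite (G1 abse abse0)//.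
  by rewrite -integral_mkcond.
split.
  apply/(measurable_restrictT _ mB).
  rewrite (_ : _ \_ B = fun y => \int[m]_x G (x, y))%E; first exact: measurable_fubini_G iG.
  by apply/funext => y; rewrite G2.
rewrite integral_mkcond [RHS]integral_mkcond.
under eq_integral do rewrite -(G1 id erefl)//.
by under [RHS]eq_integral do rewrite -G2; exact: Fubini.
Qed.

Lemma integrable_boundary_kernel (R : realType) (b : R -> R) (t y : R) (n : nat)
    (kap : R -> R) : (forall u, 0 < u -> {for u, continuous b}) -> 0 < t -> y < b t ->
  (@lebesgue_measure R).-integrable `]0, t[%classic (EFin \o kap) ->
  (@lebesgue_measure R).-integrable `]0, t[%classic
    (fun u => (kap u * gkernel n (Num.sqrt (2 * (t - u))) (y - b u))%:E).
Proof.
move=> cb t0 yb ikap.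
have [e e0 [C C0 hC]] := boundary_kernel_bounded cb t0 n yb.
have iC : (@lebesgue_measure R).-integrable `]0, t[%classic (fun u => (kap u)%:E * C%:E)%E.
  by apply: integrableZr => //; exact: measurable_itv.
apply: le_integrable iC => //.
  apply/measurable_EFinP; apply: measurable_funM.
    by case/integrableP : ikap => /measurable_EFinP.
  exact: measurable_boundary_kernel.
move=> u; rewrite /= in_itv/= => /andP[u0 ut].
rewrite lee_fin [leLHS]normrM [leRHS]normrM ler_wpM2l// (ger0_norm C0).
by apply: hC => //; rewrite subrr normr0.
Qed.

(** * The passage density as a kernel, and Fubini *)

Section density_kernel.
Context d (T : measurableType d) (R : realType) (P : probability T R)
  (W : R -> {RV P >-> R}) (b : R -> R) (k : R -> R -> R).
Local Notation mu := (@lebesgue_measure R).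
Hypotheses (hW : standard_brownian_motion W) (hb : C1_boundary b)
  (hk : first_passage_density b W k).
Implicit Types (x y s t u : R).

Let b0 : b 0 = 0. Proof. by case: hb. Qed.
Let cb : {within `[0, +oo[, continuous b}. Proof. by case: hb. Qed.
Let cbu u : 0 < u -> {for u, continuous b}.
Proof. by move=> u0; exact: continuous_boundary. Qed.

Lemma density_ge0 t x : 0 < t -> 0 < x -> 0 <= k t x.
Proof. by move=> t0 x0; have [+ _ _] := hk x0; exact. Qed.

Lemma density_integrable t x : 0 < t -> 0 < x ->
  mu.-integrable `]0, t]%classic (EFin \o k^~ x).
Proof.
move=> t0 x0; have [k0 ck kP] := hk x0.
apply/integrableP; split.
  apply/measurable_EFinP.
  by apply: (measurable_density ck) => // u; rewrite /= !in_itv/= andbT => /andP[].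
rewrite (_ : integral _ _ _ = \int[mu]_(u in `]0%R, t]) (k u x)%:E)%E; last first.
  apply: eq_integral => u; rewrite inE/= in_itv/= => /andP[u0 ut].
  by rewrite ger0_norm ?k0.
exact: (density_lty hW b0 cb x0 kP t0).
Qed.

(** Both sides of [first_passage_cdf] are differentiated in the level. That identity holds for
    levels up to [b t], hence on a neighbourhood of y < b(t). *)
Lemma first_passage_gkernel t x y : 0 < t -> 0 < x -> y < b t ->
  gkernel 0 (Num.sqrt (2 * t)) (y - x) =
  \int[mu]_(u in `]0, t[) (k u x * gkernel 0 (Num.sqrt (2 * (t - u))) (y - b u)).
Proof.
move=> t0 x0 yb; have [k0 ck kP] := hk x0.
have ik : mu.-integrable `]0, t[%classic (EFin \o k^~ x).
  apply: integrableS (density_integrable t0 x0) => //.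
  by apply: subset_itvl; rewrite bnd_simp.
have E z : z <= b t -> gauss_cdf ((z - x) / Num.sqrt (2 * t)) =
    \int[mu]_(u in `]0, t[) (k u x * gauss_cdf ((z - b u) / Num.sqrt (2 * (t - u)))).
  move=> zb; have := first_passage_cdf hW b0 cb x0 k0 ck kP t0 zb.
  by rewrite /Rintegral => <-.
have dr := is_derive_boundary_cdf cbu t0 ik yb.
have dl := is_derive_gauss_cdf_kernel (Num.sqrt (2 * t)) x y.
have dl' := near_eq_is_derive _ dl.
have {}dl' : is_derive y 1 (fun z => \int[mu]_(u in `]0, t[)
    (k u x * gauss_cdf ((z - b u) / Num.sqrt (2 * (t - u)))))
    ((Num.sqrt pi)^-1 * gkernel 0 (Num.sqrt (2 * t)) (y - x)).
  apply: dl'; near=> z; apply: E.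
  by apply: ltW; near: z; exact: lt_nbhsl.
have := @derive_val _ _ _ _ _ _ _ dl'; rewrite (@derive_val _ _ _ _ _ _ _ dr) => h.
have spi : (Num.sqrt pi)^-1 != 0 :> R by rewrite invr_eq0 gt_eqF// sqrtr_gt0 pi_gt0.
apply: (mulfI spi); rewrite -h.
rewrite -RintegralZl//; last exact: integrable_boundary_kernel.
by apply: eq_Rintegral => u _; rewrite mulrCA.
Unshelve. all: by end_near. Qed.
(** A path started higher survives whenever the lower one does, so the function is monotone in [x].
    The value 1 at x <= 0 keeps it monotone on the whole line. *)
Lemma measurable_first_passage_cdf s : 0 <= s ->
  measurable_fun (`]0, +oo[%classic : set R) (fun x => \int[mu]_(u in `]0, s]) k u x).
Proof.
move=> s0.
pose F x := if 0 < x then fine (P (hits W b x 0 s)) else 1.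
suff mF : measurable_fun (`]0, +oo[%classic : set R) F.
  apply: eq_measurable_fun mF => x; rewrite inE/= in_itv/= andbT => x0.
  by rewrite /F x0; have [_ _ kP] := hk x0; rewrite (P_hits kP s (lexx _)).
apply: nonincreasing_measurable => [|x y xy]; first exact: measurable_itv.
have F1 z : F z <= 1.
  rewrite /F; case: ifPn => // z0; rewrite -lee_fin fineK ?fin_num_measure//.
    by apply: probability_le1; exact: measurable_hits.
  exact: measurable_hits.
rewrite {2}/F; case: ifPn => x0; last exact: F1.
have y0 := lt_le_trans x0 xy; rewrite /F y0 fine_le ?fin_num_measure//; try exact: measurable_hits.
apply: le_measure; rewrite ?inE; try exact: measurable_hits.
rewrite !hitsE// => w [_ hw]; split => [u u0 /(lt_le_trans u0)|hx]; first by rewrite ltxx.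
apply: hw => u u0 us; apply: lt_le_trans (hx _ u0 us) _.
by rewrite /gap lerD2r lerD2l.
Qed.

(** By continuity in time the density is the limit of difference quotients of the passage
    probabilities, which are measurable in [x]. *)
Lemma measurable_density_space s : 0 < s ->
  measurable_fun (`]0, +oo[%classic : set R) (k s).
Proof.
move=> s0.
pose F x r := \int[mu]_(u in `]0, r]) k u x.
pose h (n : nat) x := n.+1%:R * (F x (s + n.+1%:R^-1) - F x s).
apply: (@measurable_fun_cvg _ _ _ _ h).
  move=> n; apply: measurable_funM => //; apply: measurable_funB.
    by apply: measurable_first_passage_cdf; rewrite addr_ge0 ?invr_ge0 ?ltW.
  by apply: measurable_first_passage_cdf; exact: ltW.
move=> x; rewrite /= in_itv/= andbT => x0; have [k0 ck kP] := hk x0.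
have s1 : s < s + 1 by rewrite ltrDl.
have [dF <-] := continuous_FTC1 s1 (density_integrable (lt_trans s0 s1) x0) s0 (ck _ s0).
rewrite derive1E.
have hc : (n.+1%:R^-1 : R) @[n --> \oo] --> 0^'.
  move=> A; rewrite /dnbhs withinE /= => -[B hB AB].
  have hn : \forall n \near \oo, B n.+1%:R^-1 := cvg_harmonic hB.
  suff : \forall n \near \oo, A n.+1%:R^-1 by [].
  near=> n; have Bn : B n.+1%:R^-1 by near: n.
  have : (A `&` [set y : R | y != 0]) n.+1%:R^-1 by rewrite AB; split => //=; rewrite invr_eq0 pnatr_eq0.
  by case.
have := cvg_comp _ _ hc dF; apply: cvg_trans; apply: near_eq_cvg; apply: nearW => n.
by rewrite /h /F /= invrK [_%:A]mulr1 [s + _]addrC.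
Unshelve. all: by end_near. Qed.

Lemma gkernel0_ge0 (c z : R) : 0 <= c -> 0 <= gkernel 0 c z.
Proof.
move=> c0; rewrite /gkernel mulr_ge0 ?exprn_ge0 ?invr_ge0//.
by rewrite /gpoly mulr_ge0 ?expR_ge0// expr0 scale1r -hermiteE /hermite expr0 mul1r -expRD subrr expR0.
Qed.

Variables f g : R -> R.
Hypotheses (hf : density_on_halfline f) (he : solves_equation k f g)
  (mg : measurable_fun (`]0, +oo[%classic : set R) g)
  (ig : forall a, 0 < a ->
    mu.-integrable (`]0, +oo[%classic : set R) (fun x => (g x * expR (- (a * x ^+ 2)))%:E)).

Lemma integrable_initial_kernel n c y : 0 < c ->
  mu.-integrable (`]0, +oo[%classic : set R) (fun x => (g x * gkernel n c (y - x))%:E).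
Proof.
move=> c0; have [C C0 hC] := gkernel_gauss_bound c0 n y.
have a0 : 0 < (4 * c ^+ 2)^-1 by rewrite invr_gt0 mulr_gt0// exprn_gt0.
have iM : mu.-integrable (`]0, +oo[%classic : set R)
    (fun x => C%:E * (g x * expR (- ((4 * c ^+ 2)^-1 * x ^+ 2)))%:E)%E.
  by apply: integrableZl => //; exact: ig.
apply: le_integrable iM => //.
  apply/measurable_EFinP/measurable_funM => //.
  by apply: measurable_funTS; exact: measurable_initial_kernel.
move=> x _; rewrite -EFinM lee_fin [in leRHS]mulrCA [leLHS]normrM [leRHS]normrM ler_wpM2l//.
rewrite [leRHS]ger0_norm ?mulr_ge0 ?expR_ge0//; apply: hC.
by rewrite subrr normr0.
Qed.

Lemma solution_gkernel0 t y : 0 < t -> y < b t ->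
  \int[mu]_(x in `]0, +oo[) (g x * gkernel 0 (Num.sqrt (2 * t)) (y - x)) =
  \int[mu]_(s in `]0, t[) (f s * gkernel 0 (Num.sqrt (2 * (t - s))) (y - b s)).
Proof.
move=> t0 yb; pose K s := gkernel 0 (Num.sqrt (2 * (t - s))) (y - b s).
have c0 : 0 < Num.sqrt (2 * t) by rewrite sqrtr_gt0 mulr_gt0.
have K0 s : 0 <= K s by exact: gkernel0_ge0 (sqrtr_ge0 _).
have mA : measurable (`]0, +oo[%classic : set R) by exact: measurable_itv.
have mB : measurable (`]0, t[%classic : set R) by exact: measurable_itv.
have mK : measurable_fun (`]0, t[%classic : set R) K by exact: measurable_boundary_kernel.
have mk : measurable_fun ((`]0, +oo[%classic : set R) `*` (`]0, +oo[%classic : set R))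
    (fun p => k p.1 p.2).
  apply: measurable_caratheodory => //; first exact: measurable_density_space.
  by move=> x s; rewrite /= in_itv/= andbT => x0 s0; have [_ ck _] := hk x0; exact: ck.
pose F (p : R * R) := (g p.1 * (k p.2 p.1 * K p.2))%:E.
have mF : measurable_fun ((`]0, +oo[%classic : set R) `*` (`]0, t[%classic : set R)) F.
  apply/measurable_EFinP/measurable_funM.
    apply: (@measurable_comp _ _ _ _ _ _ (`]0, +oo[%classic : set R) g _ (fun p : R * R => p.1)) => //.
      by move=> _ [[x s] [x0 _] <-].
    by apply: measurable_funTS; exact: measurable_fst.
  apply: measurable_funM; last first.
    apply: (@measurable_comp _ _ _ _ _ _ (`]0, t[%classic : set R) K _ (fun p : R * R => p.2)) => //.
      by move=> _ [[x s] [_ s0] <-].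
    by apply: measurable_funTS; exact: measurable_snd.
  apply: (@measurable_comp _ _ _ _ _ _ ((`]0, +oo[%classic : set R) `*` (`]0, +oo[%classic : set R))
    (fun p : R * R => k p.1 p.2) _ (fun p : R * R => (p.2, p.1))) => //.
  - by apply: measurableX; exact: measurable_itv.
  - move=> _ [[x s] /= [x0 s0] <-]; split => //=.
    by move: s0; rewrite !in_itv/= andbT => /andP[].
  - by apply: measurable_funTS; exact: measurable_swap.
have ikK x : 0 < x -> mu.-integrable (`]0, t[%classic : set R) (fun s => (k s x * K s)%:E).
  move=> x0; apply: integrable_boundary_kernel => //.
  apply: integrableS (density_integrable t0 x0) => //.
  by apply: subset_itvl; rewrite bnd_simp.
have ikKE x : 0 < x ->
    (\int[mu]_(s in `]0%R, t[) (k s x * K s)%:E = (gkernel 0 (Num.sqrt (2 * t)) (y - x))%:E)%E.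
  move=> x0; rewrite (first_passage_gkernel t0 x0 yb) fineK//.
  by apply: integrable_fin_num; [exact: mB|exact: ikK].
have iL := integrable_initial_kernel 0 y c0.
(* As [k] and [K] are nonnegative, the inner integral of the absolute value is |g| times the
   Gaussian kernel, by the identity just integrated. *)
have Foo : (\int[mu]_(x in `]0%R, +oo[) \int[mu]_(s in `]0%R, t[) `|F (x, s)| < +oo)%E.
  have /integrableP[_] := iL; apply: le_lt_trans.
  rewrite le_eqVlt; apply/orP; left; apply/eqP; apply: eq_integral => x.
  rewrite inE/= in_itv/= andbT => x0.
  rewrite [in RHS]normrM EFinM (ger0_norm (gkernel0_ge0 _ (sqrtr_ge0 _))) -ikKE//.
  rewrite -ge0_integralZl//.
  - apply: eq_integral => s; rewrite inE/= in_itv/= => /andP[s0 _].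
    by rewrite /F/= normrM EFinM (ger0_norm (mulr_ge0 (density_ge0 s0 x0) (K0 s))).
  - by have /integrableP[] := ikK _ x0.
  - move=> s; rewrite /= in_itv/= => /andP[s0 _].
    by rewrite lee_fin (mulr_ge0 (density_ge0 s0 x0) (K0 s)).
have [mG FE] := @Fubini_setX _ _ _ _ R mu mu _ _ F mA mB mF Foo.
suff E : (\int[mu]_(x in `]0%R, +oo[) (g x * gkernel 0 (Num.sqrt (2 * t)) (y - x))%:E =
    \int[mu]_(s in `]0%R, t[) (f s * K s)%:E)%E by rewrite /Rintegral E.
transitivity (\int[mu]_(x in `]0%R, +oo[) \int[mu]_(s in `]0%R, t[) F (x, s))%E.
  apply: eq_integral => x; rewrite inE/= in_itv/= andbT => x0.
  rewrite [LHS]EFinM -(ikKE _ x0).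
  have <- : (\int[mu]_(s in `]0%R, t[) ((g x)%:E * (k s x * K s)%:E) =
      (g x)%:E * \int[mu]_(s in `]0%R, t[) (k s x * K s)%:E)%E.
    by apply: integralZl; [exact: measurable_itv|exact: ikK].
  by apply: eq_integral => s _; rewrite -EFinM.
apply: (etrans FE); apply: ae_eq_integral; [exact: measurable_itv|exact: mG| |].
  apply/measurable_EFinP; apply: measurable_funM; last exact: mK.
  have [mf _ _] := hf; apply: measurable_funS mf; first exact: measurable_itv.
  by move=> s; rewrite /= !in_itv/= => /andP[/ltW->].
rewrite /ae_eq; move: he; rewrite /solves_equation; apply: (@filterS _ _ (ae_filter_ringOfSetsType mu)) => s hs; rewrite /= in_itv/= => /andP[s0 st].
have mh : measurable_fun (`]0, +oo[%classic : set R) (fun x => (k s x * g x)%:E).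
  apply/measurable_EFinP; apply: measurable_funM; last exact: mg.
  exact: measurable_density_space.
(* The right side of the equation at [s] is finite, so the integrand is integrable and [K s] can be
   moved inside. *)
have ih : mu.-integrable (`]0, +oo[%classic : set R) (fun x => (k s x * g x)%:E).
  by apply: fin_num_integrable; [exact: measurable_itv|exact: mh|rewrite (hs s0)].
rewrite [RHS]EFinM muleC -(hs s0); 
have <- : (\int[mu]_(x in `]0%R, +oo[) ((K s)%:E * (k s x * g x)%:E) =
    (K s)%:E * \int[mu]_(x in `]0%R, +oo[) (k s x * g x)%:E)%E.
  by apply: integralZl; [exact: measurable_itv|exact: ih].
by apply: eq_integral => x _; rewrite /F /= -EFinM; congr EFin; ring.
Qed.

End density_kernel.

(** * Integrability of functions of the admissible class *)

Section weighted_solutions.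
Context (R : realType).
Local Notation mu := (@lebesgue_measure R).

(** The two alternatives of [class_G] call for the two properties of [M]: boundedness when [g] is
    integrable, integrability when [g] is bounded. *)
Lemma class_G_integrable (g M : R -> R) (C : R) : class_G g ->
  mu.-integrable setT (EFin \o M) -> (forall x, `|M x| <= C) ->
  mu.-integrable (`]0, +oo[%classic : set R) (fun x => (g x * M x)%:E).
Proof.
move=> [mg hg] iM MC.
have mD : measurable (`]0, +oo[%classic : set R) by exact: measurable_itv.
have iMD : mu.-integrable (`]0, +oo[%classic : set R) (EFin \o M).
  exact: integrableS iM.
have mM : measurable_fun (`]0, +oo[%classic : set R) M.
  by case/integrableP : iMD => /measurable_EFinP.
have mgM : measurable_fun (`]0, +oo[%classic : set R) (fun x => g x * M x).
  exact: measurable_funM.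
have [ig|[K hK]] := hg.
  have {}ig : mu.-integrable (`]0, +oo[%classic : set R) (fun x => C%:E * (g x)%:E)%E.
    by apply: integrableZl => //; apply/integrableP; split => //; exact/measurable_EFinP.
  apply: le_integrable ig => //; first exact/measurable_EFinP.
  move=> x _; rewrite -EFinM lee_fin [in leRHS]mulrC [leLHS]normrM [leRHS]normrM ler_wpM2l//.
  by rewrite (le_trans (MC x))// ler_norm.
have /integrableP[_ KM] : mu.-integrable (`]0, +oo[%classic : set R) (fun x => K%:E * (M x)%:E)%E.
  exact: integrableZl.
apply/integrableP; split; first exact/measurable_EFinP.
apply: le_lt_trans KM; apply: ae_ge0_le_integral => //.
- exact/measurableT_comp/measurable_EFinP.
- by apply: measurableT_comp => //; apply: measurable_funeM; exact/measurable_EFinP.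
apply: (@filterS _ _ (ae_filter_ringOfSetsType mu)) hK => x hx; rewrite /= in_itv/= andbT => x0.
rewrite lee_fin !normrM ler_wpM2r//.
by apply: le_trans (ltW (hx x0)) (ler_norm _).
Qed.

Lemma class_G_integrable_exp_gauss (g : R -> R) (A a : R) : class_G g -> 0 < a ->
  mu.-integrable (`]0, +oo[%classic : set R)
    (fun x => (g x * (expR (A * `|x|) * expR (- (a * x ^+ 2))))%:E).
Proof.
move=> hg a0.
apply: (@class_G_integrable _ (fun x => expR (A * `|x|) * expR (- (a * x ^+ 2)))
  (expR (A ^+ 2 / (2 * a))) hg).
  exact: integrable_exp_gauss.
move=> x; rewrite ger0_norm ?mulr_ge0 ?expR_ge0//.
apply: (le_trans (exp_linear_gauss A x a0)).
by rewrite ler_piMr ?expR_ge0// expR_le1 oppr_le0 mulr_ge0 ?sqr_ge0// divr_ge0// ltW.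
Qed.

Lemma class_G_integrable_gauss (g : R -> R) (a : R) : class_G g -> 0 < a ->
  mu.-integrable (`]0, +oo[%classic : set R) (fun x => (g x * expR (- (a * x ^+ 2)))%:E).
Proof.
move=> hg a0; have := class_G_integrable_exp_gauss 0 hg a0; congr (_.-integrable _ _).
by apply/funext => x; rewrite mul0r expR0 mul1r.
Qed.

Lemma hpoly_opp n : hpoly R n \Po (- 'X) = (-1) ^+ n *: hpoly R n.
Proof.
elim: n => [|n IH]; first by rewrite /= comp_polyC expr0 scale1r.
have hd : (hpoly R n)^`() \Po (- 'X) = - ((-1) ^+ n *: (hpoly R n)^`()).
  by rewrite -derivZ -IH deriv_comp derivN derivX mulrN1 opprK.
have -> : hpoly R n.+1 = - ((hpoly R n)^`() - ('X *+ 2) * hpoly R n) by [].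
rewrite raddfN raddfB/= hd comp_polyM IH raddfMn/= comp_polyX.
by rewrite exprS mulN1r -!mul_polyC polyCN; ring.
Qed.
Lemma target_integrable (f : R -> R) t : density_on_halfline f ->
  mu.-integrable (`]0, t[%classic : set R) (EFin \o f).
Proof.
move=> hf; have [mf f0 f1] := hf.
apply: (@integrableS _ _ _ mu (`[0, +oo[%classic)) => //.
  by move=> u; rewrite /= !in_itv/= andbT => /andP[/ltW].
apply/integrableP; split; first exact/measurable_EFinP.
rewrite (_ : integral _ _ _ = \int[mu]_(u in `[0%R, +oo[) (f u)%:E)%E; first by rewrite f1 ltry.
by apply: eq_integral => u; rewrite inE/= in_itv/= andbT => u0; rewrite ger0_norm ?f0.
Qed.

End weighted_solutions.

Section solution_identity.
Context d (T : measurableType d) (R : realType) (P : probability T R)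
  (W : R -> {RV P >-> R}) (b : R -> R) (k : R -> R -> R) (f g : R -> R).
Local Notation mu := (@lebesgue_measure R).
Hypotheses (hW : standard_brownian_motion W) (hb : C1_boundary b)
  (hk : first_passage_density b W k) (hf : density_on_halfline f)
  (hg : class_G g) (he : solves_equation k f g).

(** Induction on [n]: the identity holds at every level below [b t], so both sides have the same
    derivative there. *)
Lemma solution_gkernel n t y : 0 < t -> y < b t ->
  \int[mu]_(x in `]0, +oo[) (g x * gkernel n (Num.sqrt (2 * t)) (y - x)) =
  \int[mu]_(s in `]0, t[) (f s * gkernel n (Num.sqrt (2 * (t - s))) (y - b s)).
Proof.
move=> t0; have c0 : 0 < Num.sqrt (2 * t) by rewrite sqrtr_gt0 mulr_gt0.
have [mg _] := hg.
have ig a : 0 < a -> mu.-integrable (`]0, +oo[%classic : set R)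
    (fun x => (g x * expR (- (a * x ^+ 2)))%:E) by exact: class_G_integrable_gauss.
have cb u : 0 < u -> {for u, continuous b}.
  by move=> u0; case: hb => _ cb _ _; exact: continuous_boundary.
have iF := target_integrable t hf.
elim: n y => [|n IH] y yb; first exact: (solution_gkernel0 hW hb hk hf he mg ig).
have dr := is_derive_boundary_kernel cb t0 iF n yb.
have dl := is_derive_initial_kernel c0 mg ig n y.
have {}dl : is_derive y 1 (fun y => \int[mu]_(s in `]0, t[)
    (f s * gkernel n (Num.sqrt (2 * (t - s))) (y - b s)))
    (\int[mu]_(x in `]0, +oo[) (g x * gkernel n.+1 (Num.sqrt (2 * t)) (y - x))).
  apply: near_eq_is_derive dl; near=> z; apply: IH.
  by near: z; exact: lt_nbhsl.
exact: etrans (esym (@derive_val _ _ _ _ _ _ _ dl)) (@derive_val _ _ _ _ _ _ _ dr).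
Unshelve. all: by end_near. Qed.

End solution_identity.

(** * Both sides at level 0 as Hermite coefficients *)

Section hermite_coefficients.
Context (R : realType).
Local Notation mu := (@lebesgue_measure R).

Lemma Rintegral_scale (c : R) (F : R -> R) : 0 < c -> mu.-integrable setT (EFin \o F) ->
  \int[mu]_x F x = c * \int[mu]_x F (c * x).
Proof.
move=> c0 iF; have mF : measurable_fun setT F by case/integrableP : iF => /measurable_EFinP.
rewrite /Rintegral integralE [in RHS]integralE.
have s1 := @ge0_integral_scale R c _ c0 (measurable_funepos (measurable_int _ iF)) (funepos_ge0 _).
have s2 := @ge0_integral_scale R c _ c0 (measurable_funeneg (measurable_int _ iF)) (funeneg_ge0 _).
have f1 := integrable_pos_fin_num measurableT iF.
have f2 := integrable_neg_fin_num measurableT iF.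
have p1 : (\int[mu]_x ((fun x => (F (c * x)%R)%:E)^\+ x) = (c^-1)%:E * \int[mu]_x (EFin \o F)^\+ x)%E.
  rewrite s1 muleA -EFinM mulVf ?gt_eqF// mul1e; apply: eq_integral => x _.
  by rewrite !funeposE.
have p2 : (\int[mu]_x ((fun x => (F (c * x)%R)%:E)^\- x) = (c^-1)%:E * \int[mu]_x (EFin \o F)^\- x)%E.
  rewrite s2 muleA -EFinM mulVf ?gt_eqF// mul1e; apply: eq_integral => x _.
  by rewrite !funenegE.
rewrite p1 p2 -(fineK f1) -(fineK f2) -!EFinM -!EFinB /=.
by rewrite -mulrBr mulrA divff ?gt_eqF// mul1r.
Qed.

Lemma integrable_scale (c : R) (F : R -> R) : 0 < c -> mu.-integrable setT (EFin \o F) ->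
  mu.-integrable setT (fun x => (F (c * x))%:E).
Proof.
move=> c0 /integrableP[/measurable_EFinP mF Foo]; apply/integrableP; split.
  by apply/measurable_EFinP; apply: measurableT_comp => //; exact: measurable_funM.
move: Foo; rewrite (@ge0_integral_scale R c)//; last first.
  by apply: measurableT_comp => //; exact/measurable_EFinP.
have : (0 <= \int[mu]_x `|(F (c * x)%R)%:E|)%E by exact: integral_ge0.
rewrite [X in (_ * X < _)%E -> _](_ : _ = \int[mu]_x `|(F (c * x)%R)%:E|)%E //.
case: (\int[mu]_x `|(F (c * x)%R)%:E|)%E => [r _ _| _|//]; first by rewrite ltry.
by rewrite gt0_muley ?lte_fin.
Qed.

(** At level y = 0 the kernels are evaluated at -x and -b(s); the parity of H_n cancels the sign
    (-1)^n. *)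
Lemma gkernel_oppr n (c z : R) : gkernel n c (- z) = c^-1 ^+ n.+1 * gpoly (hpoly R n) (z / c).
Proof.
rewrite /gkernel; congr (_ * _).
rewrite -hpoly_opp /gpoly horner_comp hornerN hornerX mulNr opprK.
by rewrite sqrrN.
Qed.

(** Under x = c u, the factor c^(-n-1) of the kernel meets dx = c du, which leaves c^n to
    compensate. *)
Lemma gint_extend0_rescaled (g : R -> R) (c : R) n : 0 < c ->
  mu.-integrable (`]0, +oo[%classic : set R) (fun x => (g x * gkernel n c (0 - x))%:E) ->
  gint (fun u => extend0 g (u * c)) (hpoly R n) =
  c ^+ n * \int[mu]_(x in `]0, +oo[) (g x * gkernel n c (0 - x)).
Proof.
move=> c0 iF; pose F := (fun x => g x * gkernel n c (0 - x)) \_ `]0, +oo[%classic.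
have iFT : mu.-integrable setT (EFin \o F).
  move: iF; rewrite integrable_mkcond//; congr (_.-integrable _ _).
  by rewrite /F -restrict_EFin.
rewrite Rintegral_mkcond -/F (@Rintegral_scale c)//.
rewrite mulrA -exprSr /gint -RintegralZl//; last exact: integrable_scale.
apply: eq_Rintegral => u _; rewrite /F patchE /extend0.
have -> : (c * u \in `]0, +oo[%classic) = (0 < u * c).
  by apply/idP/idP; rewrite inE/= in_itv/= andbT mulrC.
case: ifPn => _; last by rewrite mul0r mulr0.
rewrite sub0r gkernel_oppr [c * u]mulrC mulfK ?gt_eqF// [RHS]mulrCA.
by congr (_ * _); rewrite [RHS]mulrA -exprMn divff ?gt_eqF// expr1n mul1r.
Qed.

Lemma powR_half (x : R) n : 0 <= x -> x `^ (n%:R / 2) = Num.sqrt x ^+ n.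
Proof.
by move=> x0; rewrite mulrC powRrM powR12_sqrt// powR_mulrn// sqrtr_ge0.
Qed.

(** With c = sqrt(2) sqrt(t - s), the factor c^(-n-1) is the power of t - s in [a_coef] up to
    sqrt(2)^(n+1). The endpoints form a null set, so the division by zero at s = t is harmless. *)
Lemma a_coefE (b f : R -> R) t n :
  mu.-integrable (`]0, t[%classic : set R)
    (fun s => (f s * gkernel n (Num.sqrt (2 * (t - s))) (0 - b s))%:E) ->
  a_coef b f t n = Num.sqrt 2 ^+ n.+1 *
    \int[mu]_(s in `]0, t[) (f s * gkernel n (Num.sqrt (2 * (t - s))) (0 - b s)).
Proof.
move=> iF; rewrite -RintegralZl//.
have E s : `]0, t[%classic s ->
    expR (- (b s ^+ 2 / (2 * (t - s)))) / (t - s) `^ (n.+1%:R / 2) *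
    hermite n (b s / Num.sqrt (2 * (t - s))) * f s =
    Num.sqrt 2 ^+ n.+1 * (f s * gkernel n (Num.sqrt (2 * (t - s))) (0 - b s)).
  rewrite /= in_itv/= => /andP[s0 st]; have ts : 0 < t - s by rewrite subr_gt0.
  rewrite sub0r gkernel_oppr /gpoly -hermiteE powR_half ?(ltW ts)//.
  have -> : (b s / Num.sqrt (2 * (t - s))) ^+ 2 = b s ^+ 2 / (2 * (t - s)).
    by rewrite expr_div_n sqr_sqrtr// mulr_ge0// ltW.
  set h := hermite _ _; set e := expR _.
  rewrite sqrtrM// exprVn exprMn; set p := Num.sqrt 2 ^+ n.+1; set q := _ ^+ n.+1.
  have p0 : p != 0 by rewrite expf_neq0// gt_eqF// sqrtr_gt0.
  have q0 : q != 0 by rewrite expf_neq0// gt_eqF// sqrtr_gt0.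
  by field; rewrite p0 q0.
rewrite /a_coef /Rintegral integral_itv_bndoo.
  by congr fine; apply: eq_integral => s; rewrite inE => /E ->.
apply/measurable_EFinP.
apply: (@eq_measurable_fun _ _ _ _ _ (fun s => Num.sqrt 2 ^+ n.+1 *
    (f s * gkernel n (Num.sqrt (2 * (t - s))) (0 - b s)))).
  by move=> s; rewrite inE => /E ->.
by apply: measurable_funM => //; case/integrableP : iF => /measurable_EFinP.
Qed.

Lemma extend0E (g : R -> R) : extend0 g = g \_ `]0, +oo[%classic.
Proof.
apply/funext => x; rewrite patchE /extend0.
by rewrite (_ : (x \in `]0, +oo[%classic) = (0 < x))//; apply/idP/idP; rewrite inE/= in_itv/= andbT.
Qed.

Lemma integrable_rescaled_solution (g : R -> R) (c A : R) : class_G g -> 0 < c ->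
  mu.-integrable setT
    (fun u => (extend0 g (u * c) * (expR (A * `|u|) * expR (- u ^+ 2)))%:E).
Proof.
move=> hg c0.
pose F x := extend0 g x * (expR (A / c * `|x|) * expR (- (c ^- 2 * x ^+ 2))).
have c20 : 0 < c ^- 2 by rewrite invr_gt0 exprn_gt0.
have /(integrable_scale c0) : mu.-integrable setT (EFin \o F).
  have := class_G_integrable_exp_gauss (A / c) hg c20.
  rewrite integrable_mkcond//; congr (_.-integrable _ _); apply/funext => x.
  by rewrite /F extend0E /= !patchE; case: ifP => _ //; rewrite [X in X%:E]mul0r.
congr (_.-integrable _ _); apply/funext => u; rewrite /F [c * u]mulrC; congr (_ * (expR _ * expR _))%:E.
  by rewrite normrM (gtr0_norm c0); field; rewrite gt_eqF.
by field; rewrite gt_eqF.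
Qed.

Lemma integrable_rescaled_gint (g : R -> R) (c : R) p : class_G g -> 0 < c ->
  mu.-integrable setT (fun u => (extend0 g (u * c) * gpoly p u)%:E).
Proof.
move=> hg c0; have [C C0 hC] := exp_poly_bound p.
have iG := @integrable_rescaled_solution g c 1 hg c0.
have [mg _] := hg.
have mE : measurable_fun setT (extend0 g) by rewrite extend0E; apply/(measurable_restrictT g (measurable_itv `]0, +oo[)).
have {}mE : measurable_fun setT (fun u : R => extend0 g (u * c)).
  by apply: measurableT_comp => //; exact: measurable_funM.
have iCG : mu.-integrable setT (fun u =>
    C%:E * (extend0 g (u * c) * (expR (1 * `|u|) * expR (- u ^+ 2)))%:E)%E.
  exact: integrableZl.
apply: le_integrable iCG => //.
  by apply/measurable_EFinP; apply: measurable_funM => //; exact: measurable_gpoly.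
move=> u _; rewrite -EFinM lee_fin [in leRHS]mulrCA [leLHS]normrM [leRHS]normrM ler_wpM2l//.
rewrite /gpoly mulrA [leLHS]normrM [leRHS]normrM ler_wpM2r// mul1r.
by rewrite (le_trans (hC u))// ler_norm.
Qed.

End hermite_coefficients.

(** * Coefficients, expansion and uniqueness of a solution *)

Section conclusion.
Context d (T : measurableType d) (R : realType) (P : probability T R)
  (W : R -> {RV P >-> R}) (b : R -> R) (k : R -> R -> R) (f : R -> R).
Local Notation mu := (@lebesgue_measure R).
Hypotheses (hW : standard_brownian_motion W) (hb : C1_boundary b)
  (hk : first_passage_density b W k) (hf : density_on_halfline f).

(** Of c^n = sqrt(2)^n sqrt(t)^n, the power of sqrt(2) cancels against [a_coefE]; one factor sqrt(2)
    remains and joins sqrt(pi) from the Hermite norm to form sqrt(2 pi). *)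
Lemma solution_hermite_coef g t n : class_G g -> solves_equation k f g ->
  0 < t -> 0 < b t ->
  hermite_coef (fun u => extend0 g (u * Num.sqrt (2 * t))) n =
  (Num.sqrt (2 * pi))^-1 * series_coef b f t n.
Proof.
move=> hg he t0 bt0; have c0 : 0 < Num.sqrt (2 * t) by rewrite sqrtr_gt0 mulr_gt0.
have [mg _] := hg.
have ig a : 0 < a -> mu.-integrable (`]0, +oo[%classic : set R)
    (fun x => (g x * expR (- (a * x ^+ 2)))%:E) by exact: class_G_integrable_gauss.
have cb u : 0 < u -> {for u, continuous b}.
  by move=> u0; case: hb => _ cb _ _; exact: continuous_boundary.
rewrite hermite_coefE gint_extend0_rescaled//; last exact: (integrable_initial_kernel mg ig).
rewrite (solution_gkernel hW hb hk hf hg he n t0 bt0) /series_coef a_coefE; last exact: integrable_boundary_kernel cb t0 bt0 (target_integrable _ hf).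
rewrite powR_half ?ltW//.
set I := Rintegral _ _ _.
have s2 : Num.sqrt 2 != 0 :> R by rewrite gt_eqF// sqrtr_gt0.
have spi : Num.sqrt pi != 0 :> R by rewrite gt_eqF// sqrtr_gt0 pi_gt0.
have fn : n`!%:R != 0 :> R by rewrite pnatr_eq0 -lt0n fact_gt0.
rewrite !sqrtrM// exprMn.
have -> : Num.sqrt 2 ^+ n.+1 = Num.sqrt 2 * Num.sqrt 2 ^+ n :> R by rewrite exprS.
have d0 : 2 ^+ n != 0 :> R by rewrite expf_neq0.
by field; rewrite s2 spi fn d0.
Qed.

(** In the variable x the weight for the rescaled solution is exp(-x^2 / (2 t)). For 2 t > 1 it is
    heavier than exp(-x^2), so square integrability of [G] is a separate premise. *)
Lemma solution_expansion g t : is_solution k f g -> 0 < t -> 0 < b t ->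
  let G := fun u => extend0 g (u * Num.sqrt (2 * t)) in
  L2_gauss G ->
  L2_gauss_cvg (fun N u => hermite_partial_sum b f t N (u * Num.sqrt (2 * t))) G.
Proof.
move=> [hg _ he] t0 bt0 G hG; have c0 : 0 < Num.sqrt (2 * t) by rewrite sqrtr_gt0 mulr_gt0.
suff -> : (fun N u => hermite_partial_sum b f t N (u * Num.sqrt (2 * t))) =
    (fun N u => (hsum G N).[u]) by exact: hermite_expansion.
apply/funext => N; apply/funext => u; rewrite horner_hsum /hermite_partial_sum mulr_sumr.
apply: eq_bigr => n _.
by rewrite (solution_hermite_coef _ hg he t0 bt0) mulrA mulfK// gt_eqF.
Qed.

(** The coefficients at a single admissible [t] depend on [b] and [f] only, so the rescaled
    solutions have the same Gaussian moments; [vanishing_moments] then applies to their weighted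
    difference. *)
Lemma solution_unique g g' t : is_solution k f g -> is_solution k f g' ->
  0 < t -> 0 < b t -> {ae mu, forall x : R, 0 < x -> g' x = g x}.
Proof.
move=> [hg _ he] [hg' _ he'] t0 bt0; set c := Num.sqrt (2 * t).
have c0 : 0 < c by rewrite sqrtr_gt0 mulr_gt0.
pose G u := extend0 g (u * c); pose G' u := extend0 g' (u * c).
have iG p : mu.-integrable setT (fun u => (G u * gpoly p u)%:E).
  exact: integrable_rescaled_gint.
have iG' p : mu.-integrable setT (fun u => (G' u * gpoly p u)%:E).
  exact: integrable_rescaled_gint.
have gintE p : gint G' p = gint G p.
  have hE : hsum G' (size p) = hsum G (size p).
    apply: eq_bigr => n _; congr (_ *: _).
    apply: (etrans (solution_hermite_coef n hg' he' t0 bt0)).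
    exact: esym (solution_hermite_coef n hg he t0 bt0).
  apply: (etrans (gint_hsum iG' (leqnn (size p)))).
  rewrite hE; exact: esym (gint_hsum iG (leqnn (size p))).
pose phi u := (G' u - G u) * expR (- u ^+ 2).
have mphi : measurable_fun setT phi.
  have h (F : R -> R) : (forall p, mu.-integrable setT (fun u => (F u * gpoly p u)%:E)) ->
      measurable_fun setT (fun u => F u * expR (- u ^+ 2)).
    move=> /(_ 1)/integrableP[/measurable_EFinP + _]; congr measurable_fun.
    by apply/funext => u; rewrite /gpoly hornerC mul1r.
  rewrite (_ : phi = (fun u => G' u * expR (- u ^+ 2)) \- (fun u => G u * expR (- u ^+ 2))).
    by apply: measurable_funB; apply: h.
  by apply/funext => u; rewrite /phi /= mulrBl.
have phi0 : (\int[mu]_u `|phi u|%:E = 0)%E.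
  apply: vanishing_moments => // [A|p].
    have iA := integrableB measurableT (integrable_rescaled_solution A hg' c0)
      (integrable_rescaled_solution A hg c0).
    have /integrableP[_] := iA; congr (_ < _)%E; apply: eq_integral => u _.
    rewrite -EFinB abse_EFin -mulrBl normrM /phi [in RHS]normrM; congr EFin.
    by rewrite normrM !(ger0_norm (expR_ge0 _)) mulrCA.
  transitivity (gint G' p - gint G p); last by rewrite gintE subrr.
  rewrite /gint -RintegralB//; [|exact: iG'|exact: iG].
  apply: eq_Rintegral => u _.
  by rewrite /phi /gpoly; ring.
have mphic : measurable_fun setT (fun x : R => phi (c^-1 * x)).
  by apply: measurableT_comp => //; exact: measurable_funM.
(* Scaling back to x = c u, so that the almost everywhere statement concerns [x]. *)
have : (\int[mu]_x `|(phi (c^-1 * x))%:E| = 0)%E.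
  rewrite (@ge0_integral_scale R c)//; last first.
    by apply: measurableT_comp => //; exact/measurable_EFinP.
  rewrite (_ : integral _ _ _ = 0%E) ?mule0// -phi0; apply: eq_integral => u _.
  by rewrite mulrA mulVf ?gt_eqF// mul1r.
have mE : measurable_fun setT (fun x : R => (phi (c^-1 * x))%:E) by exact/measurable_EFinP.
move/(ae_eq_integral_abs mu measurableT mE).
apply: (@filterS _ _ (ae_filter_ringOfSetsType mu)) => x /(_ I) [+] x0.
rewrite /phi /G /G' /extend0 [c^-1 * x]mulrC divfK ?gt_eqF// x0 => /eqP.
by rewrite mulf_eq0 (gt_eqF (expR_gt0 _)) orbF subr_eq0 => /eqP.
Qed.

End conclusion.

Unset Implicit Arguments.

Theorem proposition2p1 (d : measure_display) (T : measurableType d)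
    (R : realType) (P : probability T R) (W : R -> {RV P >-> R})
    (b : R -> R) (k : R -> R -> R) (f : R -> R)
    (hW : standard_brownian_motion W)
    (hb : C1_boundary b)
    (hk : first_passage_density b W k)
    (hf : density_on_halfline f)
    (hpos : exists t : R, 0 < t /\ 0 < b t)
    (g : R -> R) (hg : is_solution k f g) :
  (forall g' : R -> R, is_solution k f g' ->
     {ae @lebesgue_measure R, forall x : R, 0 < x -> g' x = g x}) /\
  (forall t : R, 0 < t -> 0 < b t ->
     let G := fun u : R => extend0 g (u * Num.sqrt (2 * t)) in
     (forall n : nat,
        hermite_coef G n = (Num.sqrt (2 * pi))^-1 * series_coef b f t n) /\
     (L2_gauss G ->
        L2_gauss_cvg
          (fun N u => hermite_partial_sum b f t N (u * Num.sqrt (2 * t))) G)).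
Proof.
split=> [g' hg'|t t0 bt0 G].
  by have [t [t0 bt0]] := hpos; exact: (solution_unique hW hb hk hf hg hg' t0 bt0).
split=> [n|]; last exact: (solution_expansion hW hb hk hf hg t0 bt0).
by have [hG _ he] := hg; exact: (solution_hermite_coef hW hb hk hf n hG he t0 bt0).
Qed.
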